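(* Let $0<\beta<\alpha<\mu\le1$, let $k$ satisfy the kernel regularity assumption with exponent $\mu$ given in the context, and let $\lambda\in\mathbb C$ satisfy $\ker(I-\lambda K)=\{0\}$ in $X_\beta$. Fix the spline order $m\in\{2,3,4\}$. Let $f\in X_\alpha$ and let $\varphi$ be the unique solution of $\varphi-\lambda K\varphi=f$. Then, for all sufficiently small $h$, the approximation $\varphi_h=u_h+J_f$, where $u_h\in S_h$ is defined by $$(u_h-\lambda Ku_h)(t_i^B)=(f_C+\lambda KJ_f)(t_i^B),\qquad i=1,\ldots,n_B,$$ exists uniquely and satisfies $$\|\varphi-\varphi_h\|_{X_\beta}\le C_\lambda h^{\alpha-\beta}\|f\|_{X_\alpha}.$$ The constant $C_\lambda$ is independent of $h$ and $f$, but may depend on the fixed parameter $\lambda$.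
   Context: **Contour.** $\Gamma\subset\mathbb C$ is a simple, closed, positively oriented contour of class $C^2$ with a regular $C^2$, $2\pi$-periodic parametrization $\gamma:\mathbb R\to\Gamma$ (so $\gamma(\theta+2\pi)=\gamma(\theta)$, $\gamma'(\theta)\ne0$, $\gamma$ injective on $[0,2\pi)$). $\mathcal D=\{t_1^d,\ldots,t_{n_d}^d\}\subset\Gamma$, $n_d\ge1$, is a set of distinct points, $t_j^d=\gamma(\theta_j^d)$ with $0<\theta_1^d<\cdots<\theta_{n_d}^d<2\pi$; the point $t_*=\gamma(0)=\gamma(2\pi)\notin\mathcal D$ is the cut. The continuity arcs are the $n_d$ open arcs of $\Gamma\setminus\mathcal D$. For a function $v$ with one-sided limits, $v(t_j^d\pm0)$ denote the limits along the orientation ($-$: incoming, $+$: outgoing), $[v]_{t_j^d}:=v(t_j^d+0)-v(t_j^d-0)$, and functions are represented by incoming values $v(t_j^d)=v(t_j^d-0)$. **Spaces.** For $0<\sigma<1$, $X_\sigma=PH_\sigma(\Gamma,\mathcal D)$ is the space of complex functions that are $\sigma$-Hölder on every continuity arc and have finite lateral limits at all points of $\mathcal D$, with norm $\|v\|_{X_\sigma}=\max_I(\|v\|_{\infty,I}+[v]_{\sigma,I})$, the maximum over the continuity arcs $I$; here $\overline I^{\,\ell}$ is $I$ completed by its two endpoints carrying the lateral values, $\|v\|_{\infty,I}=\sup_{\overline I^{\,\ell}}|v|$ and $[v]_{\sigma,I}=\sup_{t\ne s\in\overline I^{\,\ell}}|v(t)-v(s)|/|t-s|^\sigma$. If $n_d=1$,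 the distance $|t-s|$ in this seminorm is understood as the distance along the (single) completed arc. $H_\sigma(\Gamma)$ ($0<\sigma\le1$) is the space of globally $\sigma$-Hölder (Lipschitz if $\sigma=1$) functions on $\Gamma$ with norm $\sup_\Gamma|v|+\sup_{t\ne s\in\Gamma}|v(t)-v(s)|/|t-s|^\sigma$. **Kernel regularity assumption.** There are constants $M_0,M_\mu$ with $|k(t,\tau)|\le M_0$ and $|k(t,\tau)-k(s,\tau)|\le M_\mu|t-s|^\mu$ for all $t,s,\tau\in\Gamma$, and a modulus of continuity $\omega_k$ with $\omega_k(r)\to0$ as $r\downarrow0$ such that $|k(t,\tau)-k(t,\zeta)|\le\omega_k(|\tau-\zeta|)$ for all $t,\tau,\zeta\in\Gamma$. **Operator.** $(Kv)(t)=\int_\Gamma k(t,\tau)v(\tau)\,d\tau$ (complex contour integral). The solution $\varphi$ exists uniquely in $X_\beta$ and lies in $X_\alpha$. **Generators and decomposition of the data.** For $0\le\theta<2\pi$: $H_j(\gamma(\theta))=0$ if $0\le\theta\le\theta_j^d$ and $=1$ if $\theta_j^d<\theta<2\pi$; $R(\gamma(\theta))=\theta/(2\pi)$; $G_j:=H_j-R$. For $f\in X_\alpha$: $J_f=\sum_{j=1}^{n_d}[f]_{t_j^d}G_j$ and $f_C=f-J_f\in H_\alpha(\Gamma)$. **Splines.** For an integer $n_B\ge4$ put $h=2\pi/n_B$ and choose a phase $\rho_h\in[0,h)$ with $\operatorname{dist}(\theta_j^d-\rho_h,h\mathbb Z)\ge\eta h$ for $j=1,\ldots,n_d$, where $0<\eta<1/(2n_d)$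 is fixed. Put $\theta_i^B=\rho_h+(i-1)h\ (\mathrm{mod}\ 2\pi)$, $t_i^B=\gamma(\theta_i^B)$, $i=1,\ldots,n_B$. Let $N_m$ be the centered cardinal B-spline of order $m$ (degree $m-1$, support $[-m/2,m/2]$, $\sum_{r\in\mathbb Z}N_m(x-r)=1$), $B_j(\gamma(\theta))=\sum_{\ell\in\mathbb Z}N_m\big((\theta-\theta_j^B)/h-\ell n_B\big)$, and $S_h=\operatorname{span}\{B_1,\ldots,B_{n_B}\}$. The parameter $h$ ranges over the values $2\pi/n_B$. *)

(* Defs.v *)
(* Stdlib reals with Coquelicot.  A function on the curve is a total function
   C -> C of which only the values on the curve are ever used. *)
From Stdlib Require Import Reals ZArith Arith.
From Coquelicot Require Import Coquelicot.
Set Implicit Arguments.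
Unset Strict Implicit.
Open Scope R_scope.

Definition curve_deriv (g : R -> C) (x : R) : C :=
  (Derive (fun y => fst (g y)) x, Derive (fun y => snd (g y)) x).

Definition C2_curve (g : R -> C) : Prop :=
  (forall x, @is_derive R_AbsRing C_R_NormedModule g x (curve_deriv g x)) /\
  (forall x, @is_derive R_AbsRing C_R_NormedModule
               (curve_deriv g) x (curve_deriv (curve_deriv g) x)) /\
  (forall x, continuous (curve_deriv (curve_deriv g)) x).

Definition on_curve (g : R -> C) (t : C) : Prop := exists x, g x = t.

Definition contour_int (g : R -> C) (F : C -> C) : C :=
  @RInt C_R_CompleteNormedModule
    (fun x => Cmult (F (g x)) (curve_deriv g x)) 0 (2 * PI).

Definition winding_number (g : R -> C) (z : C) : C :=
  Cdiv (contour_int g (fun tau => Cinv (Cminus tau z)))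
       (Cmult (RtoC (2 * PI)) Ci).

(* z lies in a bounded component of the complement of the curve; components
   and path components of that open set coincide. *)
Definition inside_curve (g : R -> C) (z : C) : Prop :=
  ~ on_curve g z /\
  exists M : R, forall (w : C) (p : R -> C),
    (forall s, continuous p s) -> p 0 = z -> p 1 = w ->
    (forall s, 0 <= s <= 1 -> ~ on_curve g (p s)) ->
    Cmod w <= M.

Record contour (g : R -> C) : Prop := {
  contour_C2 : C2_curve g;
  contour_periodic : forall x, g (x + 2 * PI) = g x;
  contour_regular : forall x, curve_deriv g x <> RtoC 0;
  contour_simple : forall x y, 0 <= x < 2 * PI -> 0 <= y < 2 * PI ->
    g x = g y -> x = y;
  contour_positive : forall z, inside_curve g z -> winding_number g z = RtoC 1
}.

(* Parameters thd 1 < ... < thd nd of the jump points; other values of thd are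
   never used. *)
Definition jump_parameters (nd : nat) (thd : nat -> R) : Prop :=
  (1 <= nd)%nat /\ 0 < thd 1%nat /\ thd nd < 2 * PI /\
  (forall j, (1 <= j < nd)%nat -> thd j < thd (S j)).

(* The parameter in [0, 2 pi) of a point of the curve. *)
Definition param (g : R -> C) (t : C) : R :=
  iota (fun x : R => 0 <= x < 2 * PI /\ g x = t).

Definition left_limit_is (g : R -> C) (v : C -> C) (x : R) (l : C) : Prop :=
  filterlim (fun y => v (g y)) (at_left x) (locally l).
Definition right_limit_is (g : R -> C) (v : C -> C) (x : R) (l : C) : Prop :=
  filterlim (fun y => v (g y)) (at_right x) (locally l).

Definition left_limit (g : R -> C) (v : C -> C) (x : R) : C :=
  @iota C_R_CompleteNormedModule (left_limit_is g v x).
Definition right_limit (g : R -> C) (v : C -> C) (x : R) : C :=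
  @iota C_R_CompleteNormedModule (right_limit_is g v x).

Definition jump (g : R -> C) (v : C -> C) (x : R) : C :=
  Cminus (right_limit g v x) (left_limit g v x).

(* The j-th continuity arc is the image of (thd j, arc_end nd thd j); the last
   one passes through the cut. *)
Definition arc_end (nd : nat) (thd : nat -> R) (j : nat) : R :=
  if Nat.eqb j nd then thd 1%nat + 2 * PI else thd (S j).

Definition in_arc (nd : nat) (thd : nat -> R) (j : nat) (x : R) : Prop :=
  thd j <= x <= arc_end nd thd j.

(* v on the j-th completed arc, with the lateral values at the endpoints *)
Definition arc_value (g : R -> C) (nd : nat) (thd : nat -> R)
    (v : C -> C) (j : nat) (x : R) : C :=
  if Req_EM_T x (thd j) then right_limit g v x
  else if Req_EM_T x (arc_end nd thd j) then left_limit g v x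
  else v (g x).

(* Chordal distance, except that a single completed arc, whose endpoints
   coincide in the plane, is measured by arc length. *)
Definition arc_dist (g : R -> C) (nd : nat) (x y : R) : R :=
  if Nat.eqb nd 1 then Rabs (RInt (fun s => Cmod (curve_deriv g s)) x y)
  else Cmod (Cminus (g x) (g y)).

Definition arc_sup (g : R -> C) (nd : nat) (thd : nat -> R)
    (v : C -> C) (j : nat) : Rbar :=
  Lub_Rbar (fun r => exists x, in_arc nd thd j x /\
    r = Cmod (arc_value g nd thd v j x)).

Definition arc_holder (g : R -> C) (nd : nat) (thd : nat -> R)
    (sigma : R) (v : C -> C) (j : nat) : Rbar :=
  Lub_Rbar (fun r => exists x y,
    in_arc nd thd j x /\ in_arc nd thd j y /\ x <> y /\
    r = Cmod (Cminus (arc_value g nd thd v j x) (arc_value g nd thd v j y))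
        / Rpower (arc_dist g nd x y) sigma).

(* Infinite when v is not piecewise Hoelder; the lub over the nd arcs is a
   maximum. *)
Definition PH_norm_bar (g : R -> C) (nd : nat) (thd : nat -> R)
    (sigma : R) (v : C -> C) : Rbar :=
  Rbar_lub (fun r => exists j, (1 <= j <= nd)%nat /\
    r = Rbar_plus (arc_sup g nd thd v j) (arc_holder g nd thd sigma v j)).

Definition PH_norm (g : R -> C) (nd : nat) (thd : nat -> R)
    (sigma : R) (v : C -> C) : R := real (PH_norm_bar g nd thd sigma v).

(* The left limit at a jump point is v itself: functions are represented by
   their incoming values. *)
Definition PH (g : R -> C) (nd : nat) (thd : nat -> R)
    (sigma : R) (v : C -> C) : Prop :=
  (forall j, (1 <= j <= nd)%nat ->
     left_limit_is g v (thd j) (v (g (thd j))) /\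
     exists l : C, right_limit_is g v (thd j) l) /\
  is_finite (PH_norm_bar g nd thd sigma v).

(* Points with t = s are excluded because Rpower 0 mu = 1. *)
Definition kernel_regular (g : R -> C) (mu : R) (k : C -> C -> C) : Prop :=
  exists (M0 Mmu : R) (omega : R -> R),
    (forall t tau, on_curve g t -> on_curve g tau -> Cmod (k t tau) <= M0) /\
    (forall t s tau, on_curve g t -> on_curve g s -> on_curve g tau -> t <> s ->
       Cmod (Cminus (k t tau) (k s tau))
         <= Mmu * Rpower (Cmod (Cminus t s)) mu) /\
    filterlim omega (at_right 0) (locally 0) /\
    (forall t tau zeta, on_curve g t -> on_curve g tau -> on_curve g zeta ->
       Cmod (Cminus (k t tau) (k t zeta)) <= omega (Cmod (Cminus tau zeta))).

Definition int_op (g : R -> C) (k : C -> C -> C) (v : C -> C) (t : C) : C :=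
  contour_int g (fun tau => Cmult (k t tau) (v tau)).

Definition id_minus (g : R -> C) (k : C -> C -> C) (lam : C)
    (v : C -> C) (t : C) : C :=
  Cminus (v t) (Cmult lam (int_op g k v t)).

Definition step_gen (g : R -> C) (thd : nat -> R) (j : nat) (t : C) : R :=
  if Rle_dec (param g t) (thd j) then 0 else 1.
Definition ramp_gen (g : R -> C) (t : C) : R := param g t / (2 * PI).
Definition generator (g : R -> C) (thd : nat -> R) (j : nat) (t : C) : R :=
  step_gen g thd j t - ramp_gen g t.

Definition jump_part (g : R -> C) (nd : nat) (thd : nat -> R)
    (f : C -> C) (t : C) : C :=
  sum_n_m (fun j => Cmult (jump g f (thd j)) (RtoC (generator g thd j t))) 1 nd.
Definition cont_part (g : R -> C) (nd : nat) (thd : nat -> R)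
    (f : C -> C) (t : C) : C :=
  Cminus (f t) (jump_part g nd thd f t).

(* Centered cardinal B-spline of order m, by the Cox-de Boor recurrence on
   the uniform knots -m/2, -m/2 + 1, ..., m/2. *)
Fixpoint bspline (m : nat) (x : R) : R :=
  match m with
  | O => 0
  | S p =>
    match p with
    | O => if Rle_dec (- (1 / 2)) x
           then if Rlt_dec x (1 / 2) then 1 else 0 else 0
    | S _ => ((INR m / 2 + x) * bspline p (x + 1 / 2)
              + (INR m / 2 - x) * bspline p (x - 1 / 2)) / INR p
    end
  end.

Definition sumZ (a : Z -> R) : R :=
  Series (fun l => a (Z.of_nat l)) + Series (fun l => a (- Z.of_nat (S l))%Z).

Definition mesh (n : nat) : R := 2 * PI / INR n.

(* No reduction modulo 2 pi is needed: for 0 <= rho < mesh n and 1 <= i <= n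
   the value already lies in [0, 2 pi). *)
Definition node (n : nat) (rho : R) (i : nat) : R := rho + INR (i - 1) * mesh n.

Definition periodic_bspline (g : R -> C) (m n : nat) (rho : R)
    (j : nat) (t : C) : R :=
  sumZ (fun l => bspline m ((param g t - node n rho j) / mesh n
                            - IZR l * INR n)).

Definition spline_space (g : R -> C) (m n : nat) (rho : R) (u : C -> C) : Prop :=
  exists c : nat -> C, forall t, on_curve g t ->
    u t = sum_n_m (fun j => Cmult (c j) (RtoC (periodic_bspline g m n rho j t)))
            1 n.

Definition admissible_phase (nd : nat) (thd : nat -> R) (eta : R)
    (n : nat) (rho : R) : Prop :=
  0 <= rho < mesh n /\
  forall j, (1 <= j <= nd)%nat -> forall l : Z,
    eta * mesh n <= Rabs (thd j - rho - mesh n * IZR l).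

Definition collocation_solution (g : R -> C) (nd : nat) (thd : nat -> R)
    (k : C -> C -> C) (lam : C) (m n : nat) (rho : R) (f u : C -> C) : Prop :=
  spline_space g m n rho u /\
  forall i, (1 <= i <= n)%nat ->
    let t := g (node n rho i) in
    id_minus g k lam u t
    = Cplus (cont_part g nd thd f t)
            (Cmult lam (int_op g k (jump_part g nd thd f) t)).

(* Main.v *)
(* Write w = phi - J_f, so that w - lam K w = f_C + lam K J_f on the curve and
   u_h solves the same equation at the nodes; the error is w - u_h.

   K maps bounded functions to mu-Hoelder ones, so by Arzela-Ascoli the
   injectivity of I - lam K forces a bound |v| <= C0 sup |v - lam K v| for all
   bounded integrable v.  Applied to phi it makes w an alpha-Hoelder function with
   constant O(|f|).  The Schoenberg operator Q, which uses the node values of a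
   function as spline coefficients, reproduces constants and approximates
   s-Hoelder functions to order h^s.  For a spline D, both D and Q (lam K D) are splines,
   and spline coefficients are controlled by node values through diagonal
   dominance, so the bound passes to the collocation equations for small h:
   |D| <= C max_i |(D - lam K D)(t_i)|.  This gives unique solvability, and for
   D = Q w - u_h it gives |w - u_h| = O(h^alpha); the Lipschitz bound O(1/h) of
   the B-splines turns this into O(h^(alpha - beta)) for the beta-Hoelder norm. *)
Require Import Defs.
From Stdlib Require Import Reals ZArith Arith Lra Lia Psatz Classical ClassicalEpsilon ssreflect.
From Coquelicot Require Import Coquelicot.
Open Scope R_scope.

(** * Hoelder functions of the parameter *)

(** The residuals of the collocation equations are known at the nodes only, while the inverse bound
    needs them on the whole curve. Between nodes the increments of a spline [D] are controlled only
    with a slope of order [|D| / h], so small node values of [D - lam K D] say nothing directly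
    about the rest of the curve. The difference [D - Q (lam K D)] avoids this: what it leaves out is
    the quasi-interpolation error of [lam K D], whose Hoelder constant is [O(|D|)]. That error is
    [O(h^mu) |D|] and is absorbed for small [h]. Only sup norms of [D] enter this argument.

    Each step in [J_f] carries a ramp that restores its value at the cut, so [f_C] is Hoelder around
    the closed curve and the estimates concern [2 pi]-periodic functions of the parameter. Arcs
    matter only for reading off [f_C] and for converting between parameter bounds and [PH] norms.
    The orders 2 to 4 enter through the common support radius 2 and the central weight of at least
    2/3. *)

Lemma Rpower_pos x s : 0 < Rpower x s.
Proof. exact: exp_pos. Qed.

Lemma Rpower_le_l x y s : 0 <= s -> 0 < x <= y -> Rpower x s <= Rpower y s.
Proof. move=> hs hxy; exact: Rle_Rpower_l. Qed.

Lemma Rpower_split d s s' : Rpower d s = Rpower d s' * Rpower d (s - s').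
Proof. rewrite -Rpower_plus; congr Rpower; lra. Qed.

Lemma Rpower_small A s eps : 0 <= A -> 0 < s -> 0 < eps ->
  exists d, 0 < d /\ forall r, 0 < r < d -> A * Rpower r s < eps.
Proof.
move=> hA hs he.
exists (Rpower (eps / (A + 1)) (/ s)); split; first exact: Rpower_pos.
move=> r [hr hrd].
have hq : 0 < eps / (A + 1) by apply: Rdiv_lt_0_compat; lra.
have hle : Rpower r s <= eps / (A + 1).
  have e : Rpower (Rpower (eps / (A + 1)) (/ s)) s = eps / (A + 1).
    by rewrite Rpower_mult Rinv_l; [exact: Rpower_1 | lra].
  by rewrite -e; apply: Rpower_le_l; lra.
have hlt : A * (eps / (A + 1)) < eps.
  have -> : A * (eps / (A + 1)) = eps - eps / (A + 1) by field; lra.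
  lra.
apply: Rle_lt_trans hlt; exact: Rmult_le_compat_l.
Qed.

Lemma Cminus_diag (a : C) : (a - a = 0)%C.
Proof. ring. Qed.

Lemma Cmod_minus_eq_0 (a b : C) : Cmod (a - b)%C = 0 -> a = b.
Proof.
move=> /Cmod_eq_0 e; have -> : (a = (a - b) + b)%C by ring.
by rewrite e; ring.
Qed.

Lemma Cmod_minus_sym (a b : C) : Cmod (a - b)%C = Cmod (b - a)%C.
Proof. by rewrite -Cmod_opp; congr Cmod; ring. Qed.

Lemma Cmod_minus_triangle (a b c : C) :
  Cmod (a - c)%C <= Cmod (a - b)%C + Cmod (b - c)%C.
Proof.
have -> : (a - c = (a - b) + (b - c))%C by ring.
exact: Cmod_triangle.
Qed.

Lemma Cmod_minus_le (a b : C) : Cmod (a - b)%C <= Cmod a + Cmod b.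
Proof. rewrite -(Cmod_opp b); exact: Cmod_triangle. Qed.

Lemma Cmod_le_minus (a b : C) : Cmod a <= Cmod (a - b)%C + Cmod b.
Proof.
have {1}-> : (a = (a - b) + b)%C by ring.
exact: Cmod_triangle.
Qed.

Lemma continuous_Cmod_eps (F : R -> C) x :
  (forall eps, 0 < eps -> exists d, 0 < d /\
     forall y, Rabs (y - x) < d -> Cmod (F y - F x)%C < eps) ->
  continuous F x.
Proof.
move=> H; apply/filterlim_locally => eps.
have [d [hd Hd]] := H eps (cond_pos eps).
exists (mkposreal d hd) => y hy.
apply: C_NormedModule_mixin_compat1; exact: Hd.
Qed.

(* Increments are only taken for [x < y], since [Rpower 0 s] is not [0]. *)
Definition holder_on (a b A s : R) (F : R -> C) : Prop :=
  forall x y, a <= x -> x < y -> y <= b ->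
    Cmod (F y - F x)%C <= A * Rpower (y - x) s.

Definition holder (A s : R) (F : R -> C) : Prop :=
  forall x y, x < y -> Cmod (F y - F x)%C <= A * Rpower (y - x) s.

Definition periodic (F : R -> C) : Prop := forall x, F (x + 2 * PI) = F x.

Lemma holder_on_ext a b A s F F' :
  (forall x, a <= x <= b -> F x = F' x) -> holder_on a b A s F ->
  holder_on a b A s F'.
Proof.
move=> E H x y hx hxy hy.
by rewrite -!E; [exact: H | lra | lra].
Qed.

Lemma holder_on_plus a b A B s F G :
  holder_on a b A s F -> holder_on a b B s G ->
  holder_on a b (A + B) s (fun x => F x + G x)%C.
Proof.
move=> HF HG x y hx hxy hy.
have -> : (F y + G y - (F x + G x) = (F y - F x) + (G y - G x))%C by ring.
apply: Rle_trans (Cmod_triangle _ _) _.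
have := HF x y hx hxy hy; have := HG x y hx hxy hy; lra.
Qed.

Lemma holder_on_glue a b c A B s F : 0 <= s -> 0 <= A -> 0 <= B ->
  holder_on a b A s F -> holder_on b c B s F -> holder_on a c (A + B) s F.
Proof.
move=> hs hA hB H1 H2 x y hx hxy hy.
have hp := Rpower_pos (y - x) s.
case: (Rle_dec y b) => [hyb|hyb].
  by apply: Rle_trans (H1 _ _ hx hxy hyb) _; nra.
case: (Rle_dec b x) => [hbx|hbx].
  by apply: Rle_trans (H2 _ _ hbx hxy hy) _; nra.
apply: Rle_trans (Cmod_minus_triangle _ (F b) _) _.
have h1 : Rpower (y - b) s <= Rpower (y - x) s by apply: Rpower_le_l; lra.
have h2 : Rpower (b - x) s <= Rpower (y - x) s by apply: Rpower_le_l; lra.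
have := H1 x b hx ltac:(lra) ltac:(lra).
have := H2 b y ltac:(lra) ltac:(lra) hy.
nra.
Qed.

Lemma holder_on_exponent a b A s s' F : 0 <= A -> s' <= s ->
  holder_on a b A s F ->
  holder_on a b (A * Rpower (b - a) (s - s')) s' F.
Proof.
move=> hA hs H x y hx hxy hy.
apply: Rle_trans (H _ _ hx hxy hy) _.
rewrite (Rpower_split (y - x) s s') Rmult_assoc; apply: Rmult_le_compat_l => //.
rewrite Rmult_comm; apply: Rmult_le_compat_r; first exact/Rlt_le/Rpower_pos.
apply: Rpower_le_l; lra.
Qed.

Lemma holder_on_holder A s F a b : holder A s F -> holder_on a b A s F.
Proof. by move=> H x y _ hxy _; apply: H. Qed.

Lemma periodic_IZR F : periodic F -> forall (l : Z) x, F (x + 2 * PI * IZR l) = F x.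
Proof.
move=> HF.
have Hn : forall (n : nat) x, F (x + 2 * PI * INR n) = F x.
  elim=> [|n IH] x; first by congr F; rewrite /=; ring.
  by rewrite -[RHS]IH -[RHS]HF S_INR; congr F; ring.
move=> l x; case: (Z_le_dec 0 l) => hl.
  by rewrite -(Z2Nat.id l hl) -INR_IZR_INZ.
rewrite -[LHS](Hn (Z.to_nat (- l))) INR_IZR_INZ Z2Nat.id; last lia.
by congr F; rewrite opp_IZR; ring.
Qed.

Lemma period_reduce a x : exists l : Z, a <= x - 2 * PI * IZR l < a + 2 * PI.
Proof.
have hp := PI_RGT_0.
exists (Int_part ((x - a) / (2 * PI))).
have [h1 h2] := base_Int_part ((x - a) / (2 * PI)).
have e : x - a = 2 * PI * ((x - a) / (2 * PI)) by field; lra.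
move: h1 h2 e; set q := (x - a) / _; set z := IZR _ => h1 h2 e; nra.
Qed.

(** If [x] and [y] reduce to the same period nothing changes. Otherwise a translate of [a] separates
    them, and going through [F a = F (a + 2 * PI)] costs two increments, hence the factor 2. *)
Lemma holder_periodic a A s F : 0 <= s -> 0 <= A -> periodic F ->
  holder_on a (a + 2 * PI) A s F -> holder (2 * A) s F.
Proof.
move=> hs hA HF H x y hxy.
have hp := PI_RGT_0; have hP := Rpower_pos (y - x) s.
have [k hk] := period_reduce a x; have [l hl] := period_reduce a y.
have Ex : F x = F (x - 2 * PI * IZR k) by rewrite -[RHS](periodic_IZR _ HF k); congr F; ring.
have Ey : F y = F (y - 2 * PI * IZR l) by rewrite -[RHS](periodic_IZR _ HF l); congr F; ring.
have hkl : (k <= l)%Z.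
  case: (Z_le_dec k l) => // h.
  have : IZR (l + 1) <= IZR k by apply: IZR_le; lia.
  rewrite plus_IZR => h'; nra.
case: (Z.eq_dec k l) => [e|ne].
  have := H _ _ (proj1 hk) (_ : x - 2 * PI * IZR k < y - 2 * PI * IZR l) _.
  rewrite -Ex -Ey -e => /(_ ltac:(lra) ltac:(rewrite e; lra)).
  have -> : y - 2 * PI * IZR k - (x - 2 * PI * IZR k) = y - x by ring.
  nra.
have hkl' : IZR k + 1 <= IZR l by rewrite -plus_IZR; apply: IZR_le; lia.
have hkl2 : 2 * PI * IZR k + 2 * PI <= 2 * PI * IZR l by nra.
set x' := x - 2 * PI * IZR k in hk Ex; set y' := y - 2 * PI * IZR l in hl Ey.
(* A period boundary separates [x] from [y], so neither leg is longer than [y - x]. *)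
have hd : y' - a <= y - x /\ a + 2 * PI - x' <= y - x by move: hk hl; rewrite /x' /y'; lra.
rewrite Ex Ey.
apply: Rle_trans (Cmod_minus_triangle _ (F a) _) _.
have h1 : Cmod (F y' - F a)%C <= A * Rpower (y - x) s.
  case: (Req_dec y' a) => [->|n].
    by rewrite Cminus_diag Cmod_0; nra.
  apply: Rle_trans (H a y' _ _ _) _; try lra.
  by apply: Rmult_le_compat_l => //; apply: Rpower_le_l; lra.
have h2 : Cmod (F a - F x')%C <= A * Rpower (y - x) s.
  rewrite -HF.
  apply: Rle_trans (H x' (a + 2 * PI) _ _ _) _; try lra.
  by apply: Rmult_le_compat_l => //; apply: Rpower_le_l; lra.
lra.
Qed.

Lemma holder_continuous A s F x : 0 <= A -> 0 < s -> holder A s F -> continuous F x.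
Proof.
move=> hA hs H; apply: continuous_Cmod_eps => eps he.
have [d [hd Hd]] := Rpower_small A s eps hA hs he.
exists d; split=> // y hy.
case: (Rtotal_order y x) => [hyx|[->|hyx]].
- rewrite Cmod_minus_sym; apply: Rle_lt_trans (H _ _ hyx) (Hd _ _).
  by move: hy; rewrite Rabs_left; lra.
- by rewrite Cminus_diag Cmod_0.
- apply: Rle_lt_trans (H _ _ hyx) (Hd _ _).
  by move: hy; rewrite Rabs_right; lra.
Qed.

(* Splits increments at the scale [h]: below it the exponent drops from [al] to
   [be] at the price [h ^ (al - be)], above it the sup bound is enough. *)
Lemma holder_on_interpolate a b A B h al be F :
  0 < h -> 0 < be < al -> al <= 1 -> 0 <= A -> 0 <= B ->
  (forall x, a <= x <= b -> Cmod (F x) <= B * Rpower h al) ->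
  (forall x y, a <= x -> x < y -> y <= b -> y - x <= h ->
     Cmod (F y - F x)%C <= A * Rpower (y - x) al + B * Rpower h al * ((y - x) / h)) ->
  holder_on a b ((A + 2 * B) * Rpower h (al - be)) be F.
Proof.
move=> hh hbe hal hA hB Hsup Hloc x y hx hxy hy.
have p1 := Rpower_pos h (al - be); have p2 := Rpower_pos (y - x) be.
have p3 := Rpower_pos h be.
case: (Rle_dec (y - x) h) => hd.
- apply: Rle_trans (Hloc x y hx hxy hy hd) _.
  have e1 : Rpower (y - x) al <= Rpower (y - x) be * Rpower h (al - be).
    rewrite (Rpower_split (y - x) al be); apply: Rmult_le_compat_l; first lra.
    apply: Rpower_le_l; lra.
  (* The ratio [(y - x) / h] is at most 1 and [be < 1], so it is at most its own [be]-th power: the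
     linear term becomes a [be]-Hoelder one. *)
  have e2 : (y - x) / h * Rpower h be <= Rpower (y - x) be.
    have q : 0 < (y - x) / h <= 1.
      split; first by apply: Rdiv_lt_0_compat; lra.
      by apply/Rle_div_l; lra.
    have -> : Rpower (y - x) be = Rpower ((y - x) / h) be * Rpower h be.
      rewrite Rpower_mult_distr; try lra.
      congr Rpower; field; lra.
    apply: Rmult_le_compat_r; first lra.
    have {1}-> : (y - x) / h = Rpower ((y - x) / h) be * Rpower ((y - x) / h) (1 - be).
      by rewrite -Rpower_plus -[LHS](Rpower_1 ((y - x) / h)); [congr Rpower; lra | lra].
    rewrite -[X in _ <= X]Rmult_1_r; apply: Rmult_le_compat_l; first exact/Rlt_le/Rpower_pos.
    have {2}<- : Rpower 1 (1 - be) = 1 by rewrite /Rpower ln_1 Rmult_0_r exp_0.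
    apply: Rpower_le_l; lra.
  have e3 : B * Rpower h al * ((y - x) / h) <= B * (Rpower (y - x) be * Rpower h (al - be)).
    rewrite (Rpower_split h al be).
    have -> : B * (Rpower h be * Rpower h (al - be)) * ((y - x) / h)
            = B * ((y - x) / h * Rpower h be * Rpower h (al - be)) by ring.
    apply: Rmult_le_compat_l => //; apply: Rmult_le_compat_r; lra.
  have e4 : 0 <= B * (Rpower (y - x) be * Rpower h (al - be)).
    by apply: Rmult_le_pos => //; apply: Rmult_le_pos; lra.
  nra.
- apply: Rle_trans (Cmod_minus_le _ _) _.
  have := Hsup x ltac:(lra); have := Hsup y ltac:(lra).
  rewrite (Rpower_split h al be).
  have e : Rpower h be <= Rpower (y - x) be by apply: Rpower_le_l; lra.
  have : B * (Rpower h be * Rpower h (al - be))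
         <= B * (Rpower (y - x) be * Rpower h (al - be)).
    apply: Rmult_le_compat_l => //; apply: Rmult_le_compat_r; lra.
  have : 0 <= A * (Rpower (y - x) be * Rpower h (al - be)).
    by apply: Rmult_le_pos => //; apply: Rmult_le_pos; lra.
  nra.
Qed.

(** * Geometry of the contour *)

Lemma continuous_Cmod (F : R -> C) x :
  continuous F x -> continuous (fun y => Cmod (F y)) x.
Proof.
move=> H; apply: (continuous_ext (fun y => @norm R_AbsRing C_R_NormedModule (F y))).
  by move=> y; rewrite Cmod_norm.
apply: (filterlim_comp _ _ _ F _ _ (locally (F x)) _ H).
exact: (@filterlim_norm R_AbsRing C_R_NormedModule (F x)).
Qed.

Lemma continuous_bounded (F : R -> C) a b : a <= b ->
  (forall x, continuous F x) ->
  exists L, 0 < L /\ forall x, a <= x <= b -> Cmod (F x) <= L.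
Proof.
move=> hab hF.
have [|mx [hmx _]] := continuity_ab_maj (fun y => Cmod (F y)) a b hab.
  by move=> c _; apply/continuity_pt_filterlim; apply: continuous_Cmod.
exists (Cmod (F mx) + 1); split; first by have := Cmod_ge_0 (F mx); lra.
by move=> x hx; have := hmx x hx; lra.
Qed.

Lemma continuous_bounded_below (F : R -> C) a b : a <= b ->
  (forall x, continuous F x) -> (forall x, F x <> RtoC 0) ->
  exists c, 0 < c /\ forall x, a <= x <= b -> c <= Cmod (F x).
Proof.
move=> hab hF hn.
have [|mx [hmx _]] := continuity_ab_min (fun y => Cmod (F y)) a b hab.
  by move=> c _; apply/continuity_pt_filterlim; apply: continuous_Cmod.
by exists (Cmod (F mx)); split => //; apply/Cmod_gt_0.
Qed.

Lemma Cmod_RInt_le (F : R -> C) (l : C) M a b : a <= b ->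
  (forall x, a <= x <= b -> Cmod (F x) <= M) ->
  @is_RInt C_R_NormedModule F a b l -> Cmod l <= M * (b - a).
Proof.
move=> hab hM hF.
rewrite Cmod_norm Rmult_comm.
apply: (@norm_RInt_le C_R_NormedModule F (fun _ => M) a b) hF (is_RInt_const a b M) => // x hx.
have := hM x hx; by rewrite Cmod_norm.
Qed.

(** The mean value theorem fails for complex values, so the increment is bounded as the integral of
    the derivative. *)
Lemma derive_increment (F dF : R -> C) L a b : a <= b ->
  (forall x, @is_derive R_AbsRing C_R_NormedModule F x (dF x)) ->
  (forall x, continuous dF x) ->
  (forall x, a <= x <= b -> Cmod (dF x) <= L) ->
  Cmod (F b - F a)%C <= L * (b - a).
Proof.
move=> hab hF hc hL.
apply: (Cmod_RInt_le dF) => //.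
apply: (@is_RInt_derive C_R_CompleteNormedModule F dF) => x _; [exact: hF | exact: hc].
Qed.

Section Curve.
Variable g : R -> C.
Hypothesis hg : contour g.

Let dg := curve_deriv g.
Let ddg := curve_deriv dg.

Lemma curve_is_derive x : @is_derive R_AbsRing C_R_NormedModule g x (dg x).
Proof. by case: hg => [[H _]] *. Qed.

Lemma curve_deriv_is_derive x : @is_derive R_AbsRing C_R_NormedModule dg x (ddg x).
Proof. by case: hg => [[_ [H _]]] *. Qed.

Lemma curve_deriv_continuous x : continuous dg x.
Proof. apply: ex_derive_continuous; exists (ddg x); exact: curve_deriv_is_derive. Qed.

Lemma curve_deriv2_continuous x : continuous ddg x.
Proof. by case: hg => [[_ [_ H]]] *. Qed.

Lemma curve_periodic : periodic g.
Proof. by case: hg. Qed.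

Lemma curve_lipschitz : exists L, 0 < L /\ forall x y, Cmod (g y - g x)%C <= L * Rabs (y - x).
Proof.
have hp := PI_RGT_0.
have [|L [hL HL]] := continuous_bounded dg 0 (2 * PI) _ curve_deriv_continuous; first lra.
have H : holder (2 * L) 1 g.
  apply: (holder_periodic 0); [lra | lra | exact: curve_periodic |].
  move=> x y hx hxy hy; rewrite Rpower_1; last lra.
  apply: (derive_increment g dg); [lra | exact: curve_is_derive | exact: curve_deriv_continuous|].
  by move=> z hz; apply: HL; lra.
exists (2 * L); split; first lra.
move=> x y; case: (Rtotal_order x y) => [h|[->|h]].
- have := H _ _ h; rewrite Rpower_1; last lra.
  by rewrite Rabs_right; lra.
- by rewrite Cminus_diag Cmod_0 Rminus_diag Rabs_R0; lra.
- have := H _ _ h; rewrite Rpower_1; last lra.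
  by rewrite Cmod_minus_sym Rabs_left; lra.
Qed.

Lemma curve_continuous x : continuous g x.
Proof. apply: ex_derive_continuous; exists (dg x); exact: curve_is_derive. Qed.

Lemma curve_injective x y : 0 < y - x < 2 * PI -> g x <> g y.
Proof.
move=> hxy e; have hp := PI_RGT_0.
have [k hk] := period_reduce 0 x; have [l hl] := period_reduce 0 y.
have e' : x - 2 * PI * IZR k = y - 2 * PI * IZR l.
  apply: (contour_simple hg); [lra | lra |].
  rewrite -(periodic_IZR _ curve_periodic k) -(periodic_IZR _ curve_periodic l (y - _)).
  have -> : x - 2 * PI * IZR k + 2 * PI * IZR k = x by ring.
  by have -> : y - 2 * PI * IZR l + 2 * PI * IZR l = y by ring.
have e2 : y - x = 2 * PI * IZR (l - k) by rewrite minus_IZR; lra.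
have [h|h] : (l - k <= 0 \/ 1 <= l - k)%Z by lia.
- have := IZR_le _ _ h; nra.
- have := IZR_le _ _ h; nra.
Qed.

(** Taylor expansion: the chord differs from [s * dg x] by at most [L * s * s], where [L] bounds the
    second derivative, and for [s <= c / (2 * L)] this eats at most half of [c * s]. The bound [L]
    is taken up to [4 * PI] because [x + s] may reach that far. *)
Lemma curve_chord_local : exists c r, 0 < c /\ 0 < r /\
  forall x s, 0 <= x <= 2 * PI -> 0 <= s <= r -> c * s <= Cmod (g (x + s) - g x)%C.
Proof.
have hp := PI_RGT_0.
have [||c [hc Hc]] := continuous_bounded_below dg 0 (2 * PI) _ curve_deriv_continuous.
- lra.
- exact: (contour_regular hg).
have [|L [hL HL]] := continuous_bounded ddg 0 (4 * PI) _ curve_deriv2_continuous; first lra.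
exists (c / 2), (Rmin (2 * PI) (c / (2 * L))); split; first lra.
have hq : 0 < c / (2 * L) by apply: Rdiv_lt_0_compat; lra.
split; first by apply: Rmin_glb_lt; lra.
move=> x s hx hs.
have hs1 : s <= 2 * PI by apply: Rle_trans (Rmin_l _ _); apply: (proj2 hs).
have hs2 : s <= c / (2 * L) by apply: Rle_trans (Rmin_r _ _); apply: (proj2 hs).
have hs3 : L * s <= c / 2.
  have -> : c / 2 = L * (c / (2 * L)) by field; lra.
  by apply: Rmult_le_compat_l; lra.
pose F (y : R) : C := minus (g y) (scal y (dg x)).
have := derive_increment F (fun y => minus (dg y) (dg x)) (L * s) x (x + s) _ _ _ _.
have -> : (F (x + s)%R - F x = (g (x + s) - g x) - RtoC s * dg x)%C.
  rewrite /F; move: (dg x) (g x) (g (x + s)) => [d1 d2] [a1 a2] [b1 b2].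
  by apply: injective_projections; rewrite /minus /plus /opp /scal /= /prod_plus /prod_opp
    /prod_scal /plus /opp /scal /= /mult /=; ring.
have -> : x + s - x = s by ring.
move=> /(_ ltac:(lra)) H.
have h : Cmod (g (x + s) - g x - s * dg x)%C <= L * s * s.
  apply: H.
  - move=> y; apply: (is_derive_minus g (fun y => scal y (dg x))); first exact: curve_is_derive.
    have := @is_derive_scal_l R_AbsRing C_R_NormedModule (fun t => t) y one (dg x) (is_derive_id _).
    by rewrite scal_one.
  - move=> y; apply: (continuous_minus dg (fun _ => dg x)); first exact: curve_deriv_continuous.
    exact: continuous_const.
  - move=> y hy; apply: Rle_trans (_ : L * (y - x) <= _); last first.
      by apply: Rmult_le_compat_l; lra.
    apply: (derive_increment dg ddg); [lra | exact: curve_deriv_is_derive | exact: curve_deriv2_continuous |].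
    by move=> z hz; apply: HL; lra.
have h2 : c * s <= Cmod (s * dg x)%C.
  rewrite Cmod_mult Cmod_R Rabs_right; last lra.
  by have := Hc x hx; nra.
have := Cmod_le_minus (s * dg x)%C (g (x + s) - g x)%C.
rewrite Cmod_minus_sym; nra.
Qed.

(** Chord-arc inequality. Short increments are local; for the others, compactness and injectivity
    give a positive minimum. The margin [delta] keeps the increment away from a full period, where
    the chord closes up. *)
Lemma curve_chord_lower delta : 0 < delta ->
  exists c, 0 < c /\
    forall x y, x < y -> y - x <= 2 * PI - delta -> c * (y - x) <= Cmod (g y - g x)%C.
Proof.
move=> hd; have hp := PI_RGT_0.
have [c [r [hc [hr Hloc]]]] := curve_chord_local.
have [L [hL HL]] := curve_lipschitz.
(* The minimum over pairs is taken in two stages: [X s] minimises the chord over the starting point,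
   then [q] is minimised over the increment. *)
have [X HX] : exists X : R -> R, forall s, 0 <= X s <= 2 * PI /\
    forall x, 0 <= x <= 2 * PI -> Cmod (g (X s + s) - g (X s))%C <= Cmod (g (x + s) - g x)%C.
  apply: (ClassicalEpsilon.choice (fun s X => 0 <= X <= 2 * PI /\
    forall x, 0 <= x <= 2 * PI -> Cmod (g (X + s) - g X)%C <= Cmod (g (x + s) - g x)%C)) => s.
  have [||mx [h1 h2]] := continuity_ab_min (fun x => Cmod (g (x + s) - g x)%C) 0 (2 * PI).
  - lra.
  - move=> x _; apply/continuity_pt_filterlim; apply: continuous_Cmod.
    apply: (continuous_minus (fun x => g (x + s)) g); last exact: curve_continuous.
    apply: (continuous_comp (fun x => x + s) g); last exact: curve_continuous.
    apply: (continuous_plus (fun x => x) (fun _ => s)); [exact: continuous_id | exact: continuous_const].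
  by exists mx.
pose q s := Cmod (g (X s + s) - g (X s))%C.
(* The minimum for [s] is at most the chord of increment [s] that starts at the minimiser for [s'].
   Hence [q] is Lipschitz, although [X] need not be continuous. *)
have qlip1 : forall s s', q s <= q s' + L * Rabs (s - s').
  move=> s s'; rewrite /q.
  have [h1 h2] := HX s'; have := proj2 (HX s) _ h1.
  have := HL (X s' + s') (X s' + s).
  have -> : X s' + s - (X s' + s') = s - s' by ring.
  have := Cmod_minus_triangle (g (X s' + s)) (g (X s' + s')) (g (X s')).
  lra.
have [e [he He]] : exists e, 0 < e /\ forall s, r <= s <= 2 * PI - delta -> e <= q s.
  case: (Rle_dec r (2 * PI - delta)) => hrd; last by exists 1; split; [lra | move=> s; lra].
  have [|mx [h1 h2]] := continuity_ab_min q r (2 * PI - delta) hrd.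
    move=> s _ eps heps; exists (eps / L); split; first by apply: Rdiv_lt_0_compat.
    move=> s' [_]; rewrite /dist /= /Rdist => hs.
    have h1 := qlip1 s s'; have h2 := qlip1 s' s.
    have h3 : L * Rabs (s' - s) < eps.
      have -> : eps = L * (eps / L) by field; lra.
      by apply: Rmult_lt_compat_l.
    rewrite (Rabs_minus_sym s s') in h1; apply: Rabs_def1; lra.
  exists (q mx); split => //.
  apply: Rnot_le_lt => hle.
  have e0 : q mx = 0 := Rle_antisym _ _ hle (Cmod_ge_0 _).
  have := @curve_injective (X mx) (X mx + mx) ltac:(lra).
  apply; by rewrite (Cmod_minus_eq_0 _ _ e0).
exists (Rmin c (e / (2 * PI))).
have hq : 0 < e / (2 * PI) by apply: Rdiv_lt_0_compat; lra.
split; first by apply: Rmin_glb_lt.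
move=> x y hxy hyx.
have [k hk] := period_reduce 0 x.
have -> : g y = g (x - 2 * PI * IZR k + (y - x)).
  rewrite -[RHS](periodic_IZR _ curve_periodic k); congr g; ring.
have -> : g x = g (x - 2 * PI * IZR k).
  rewrite -[RHS](periodic_IZR _ curve_periodic k); congr g; ring.
case: (Rle_dec (y - x) r) => h.
- apply: Rle_trans (Hloc _ (y - x) _ _); try lra.
  by apply: Rmult_le_compat_r; [lra | exact: Rmin_l].
- apply: Rle_trans (proj2 (HX (y - x)) _ _); last lra.
  apply: Rle_trans (He (y - x) _); last lra.
  apply: Rle_trans (_ : e / (2 * PI) * (y - x) <= _).
    by apply: Rmult_le_compat_r; [lra | exact: Rmin_r].
  apply: Rle_trans (_ : e / (2 * PI) * (2 * PI) <= _).
    by apply: Rmult_le_compat_l; lra.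
  by right; field; lra.
Qed.

Lemma on_curve_param x : on_curve g (g x).
Proof. by exists x. Qed.

Lemma on_curve_reduce a t : on_curve g t -> exists x, a <= x < a + 2 * PI /\ g x = t.
Proof.
move=> [x <-]; have [k hk] := period_reduce a x.
exists (x - 2 * PI * IZR k); split => //.
rewrite -(periodic_IZR _ curve_periodic k); congr g; ring.
Qed.

Lemma param_curve x : 0 <= x < 2 * PI -> param g (g x) = x.
Proof.
move=> hx; apply: (@iota_unique R_AbsRing R_CompleteNormedModule) => //.
by move=> y [hy e]; apply: (contour_simple hg).
Qed.

Lemma param_on_curve t : on_curve g t -> 0 <= param g t < 2 * PI /\ g (param g t) = t.
Proof.
move=> /(on_curve_reduce 0) [x [hx <-]]; rewrite param_curve; last lra.
by split => //; lra.
Qed.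

End Curve.

(** * The integral operator *)

(* [ring] does not recognise equations typed in the additive monoid carried by [C] or [R],
   as those between values of [sum_n_m] and of integrals are. *)
Ltac carrier_ring :=
  match goal with |- @eq _ ?a ?b => first [change (@eq C a b) | change (@eq R a b)] end; ring.

Lemma is_RInt_Cmult (F : R -> C) (c l : C) a b :
  @is_RInt C_R_NormedModule F a b l ->
  @is_RInt C_R_NormedModule (fun x => c * F x)%C a b (c * l)%C.
Proof.
move=> H.
have h1 := is_RInt_fct_extend_fst _ _ _ _ H.
have h2 := is_RInt_fct_extend_snd _ _ _ _ H.
case: c => c1 c2.
apply: (@is_RInt_fct_extend_pair R_NormedModule R_NormedModule _ a b
  (c1 * fst l - c2 * snd l) (c1 * snd l + c2 * fst l)) => /=.
- apply: (@is_RInt_minus R_NormedModule (fun x => c1 * fst (F x)) (fun x => c2 * snd (F x)));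
  exact: (@is_RInt_scal R_NormedModule).
- apply: (@is_RInt_plus R_NormedModule (fun x => c1 * snd (F x)) (fun x => c2 * fst (F x)));
  exact: (@is_RInt_scal R_NormedModule).
Qed.

Lemma continuous_Cmult (F G : R -> C) x :
  continuous F x -> continuous G x -> continuous (fun y => F y * G y)%C x.
Proof.
move=> hF hG; apply: continuous_Cmod_eps => eps he.
pose d := Rmin 1 (eps / (2 * (Cmod (F x) + Cmod (G x) + 1))).
have pF := Cmod_ge_0 (F x); have pG := Cmod_ge_0 (G x).
have hd : 0 < d by apply: Rmin_glb_lt; [lra | apply: Rdiv_lt_0_compat; lra].
have near (H : R -> C) : continuous H x ->
    locally x (fun y => Cmod (H y - H x)%C < d).
  move=> hH.
  have := continuous_Cmod (fun y => H y - H x)%C x.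
  move=> /(_ (continuous_minus H (fun _ => H x) x hH (continuous_const _ _))).
  move=> /filterlim_locally /(_ (mkposreal d hd)).
  apply: filter_imp => y; rewrite Cminus_diag Cmod_0 /ball /= /AbsRing_ball /= /minus /plus /opp /abs /=.
  by rewrite Rabs_right; have := Cmod_ge_0 (H y - H x)%C; lra.
have [[r hr] Hr] := filter_and _ _ (near F hF) (near G hG).
exists r; split => // y hy; have [h1 h2] := Hr y hy.
have -> : (F y * G y - F x * G x
  = (F y - F x) * (G y - G x) + ((F y - F x) * G x + F x * (G y - G x)))%C by ring.
apply: Rle_lt_trans (Cmod_triangle _ _) _.
have := Cmod_triangle ((F y - F x) * G x) (F x * (G y - G x)).
rewrite !Cmod_mult.
move: h1 h2; set u := Cmod (F y - F x)%C; set w := Cmod (G y - G x)%C => h1 h2.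
have pu : 0 <= u by exact: Cmod_ge_0.
have pw : 0 <= w by exact: Cmod_ge_0.
have d1 : d <= 1 by exact: Rmin_l.
have d2 : d * (2 * (Cmod (F x) + Cmod (G x) + 1)) <= eps.
  apply: Rle_trans (_ : eps / (2 * (Cmod (F x) + Cmod (G x) + 1)) * (2 * (Cmod (F x) + Cmod (G x) + 1)) <= _).
    by apply: Rmult_le_compat_r; [lra | exact: Rmin_r].
  by right; field; lra.
nra.
Qed.

(** Testing against every continuous weight makes the class linear and serves all [t] at once, since
    the integrand of [K] carries the weight [k t (g x) * curve_deriv g x]. *)
Definition curve_integrable (g : R -> C) (v : C -> C) : Prop :=
  forall q : R -> C, (forall x, continuous q x) ->
    @ex_RInt C_R_NormedModule (fun x => q x * v (g x))%C 0 (2 * PI).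

Definition curve_bounded (g : R -> C) (V : R) (v : C -> C) : Prop :=
  forall t, on_curve g t -> Cmod (v t) <= V.

Section Operator.
Variables (g : R -> C) (k : C -> C -> C) (mu : R).
Hypotheses (hg : contour g) (hmu : 0 < mu) (hk : kernel_regular g mu k).

Let K := int_op g k.

Lemma curve_integrable_ext v v' : (forall t, on_curve g t -> v t = v' t) ->
  curve_integrable g v -> curve_integrable g v'.
Proof.
move=> e H q hq; apply: ex_RInt_ext (H q hq) => x _.
by rewrite e //; exists x.
Qed.

Lemma curve_integrable_plus v v' : curve_integrable g v -> curve_integrable g v' ->
  curve_integrable g (fun t => v t + v' t)%C.
Proof.
move=> H H' q hq.
apply: ex_RInt_ext (ex_RInt_plus _ _ _ _ (H q hq) (H' q hq)) => x _.
by rewrite -[LHS]/(q x * v (g x) + q x * v' (g x))%C; carrier_ring.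
Qed.

Lemma curve_integrable_scal (c : C) v : curve_integrable g v ->
  curve_integrable g (fun t => c * v t)%C.
Proof.
move=> H q hq; have [l hl] := H q hq.
exists (c * l)%C; apply: is_RInt_ext (is_RInt_Cmult _ c _ _ _ hl) => x _; carrier_ring.
Qed.

Lemma curve_integrable_continuous v : (forall x, continuous (fun y => v (g y)) x) ->
  curve_integrable g v.
Proof.
move=> H q hq; apply: (@ex_RInt_continuous C_R_CompleteNormedModule) => x _.
exact: continuous_Cmult.
Qed.

Lemma curve_integrable_sum (a : nat -> C) (w : nat -> C -> C) n1 n2 :
  (forall j, (n1 <= j <= n2)%nat -> curve_integrable g (w j)) ->
  curve_integrable g (fun t => sum_n_m (fun j => a j * w j t)%C n1 n2).
Proof.
elim: n2 => [|n IH] H.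
- case: n1 H => [|n1] H.
    apply: (curve_integrable_ext (fun t => a O * w O t)%C).
      by move=> t _; rewrite sum_n_n.
    by apply: curve_integrable_scal; apply: H; lia.
  apply: (curve_integrable_ext (fun t => 0 * 0)%C).
    by move=> t _; rewrite sum_n_m_zero; [rewrite Cmult_0_r | lia].
  by apply: curve_integrable_continuous => x; apply: continuous_const.
- case: (le_lt_dec n1 (S n)) => h.
    apply: (curve_integrable_ext
      (fun t => sum_n_m (fun j => a j * w j t)%C n1 n + a (S n) * w (S n) t)%C).
      by move=> t _; rewrite sum_n_Sm.
    apply: curve_integrable_plus; first by apply: IH => j hj; apply: H; lia.
    by apply: curve_integrable_scal; apply: H; lia.
  apply: (curve_integrable_ext (fun t => 0 * 0)%C).
    by move=> t _; rewrite sum_n_m_zero; [rewrite Cmult_0_r | lia].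
  by apply: curve_integrable_continuous => x; apply: continuous_const.
Qed.

Let q (t : C) (x : R) : C := (k t (g x) * curve_deriv g x)%C.

Lemma kernel_continuous t : on_curve g t -> forall x, continuous (q t) x.
Proof.
move=> ht x; apply: (continuous_Cmult (fun y => k t (g y))); last exact: curve_deriv_continuous.
have [M0 [Mmu [om [_ [_ [hom Hom]]]]]] := hk.
apply: continuous_Cmod_eps => eps he.
move: hom => /filterlim_locally /(_ (mkposreal eps he)) [[d hd] Hd].
have [L [hL HL]] := curve_lipschitz g hg.
exists (d / L); split; first exact: Rdiv_lt_0_compat.
move=> y hy.
(* Where [g y = g x] the modulus gives nothing: [omega] is controlled only to the right of 0. *)
case: (Req_dec (Cmod (g y - g x)%C) 0) => [e|n].
  by rewrite (Cmod_minus_eq_0 _ _ e) Cminus_diag Cmod_0.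
apply: Rle_lt_trans (Hom t (g y) (g x) ht (on_curve_param g y) (on_curve_param g x)) _.
have p : 0 < Cmod (g y - g x)%C by have := Cmod_ge_0 (g y - g x)%C; lra.
have := Hd (Cmod (g y - g x)%C).
rewrite /ball /= /AbsRing_ball /= /minus /plus /opp /abs /= Ropp_0 !Rplus_0_r => H.
apply: Rle_lt_trans (Rle_abs _) (H _ p).
rewrite Rabs_right; last lra.
apply: Rle_lt_trans (HL x y) _.
have -> : d = L * (d / L) by field; lra.
exact: Rmult_lt_compat_l.
Qed.

(** [RInt] is total, so [int_op] is an integral only once integrability is known; linearity of [K]
    is read off this relational form. *)
Lemma int_op_correct v t : curve_integrable g v -> on_curve g t ->
  @is_RInt C_R_NormedModule (fun x => q t x * v (g x))%C 0 (2 * PI) (K v t).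
Proof.
move=> hv ht; have H := hv _ (kernel_continuous t ht).
have := RInt_correct (V := C_R_CompleteNormedModule) _ _ _ H.
rewrite (RInt_ext (V := C_R_CompleteNormedModule) _
  (fun x => k t (g x) * v (g x) * curve_deriv g x)%C) // => x _.
rewrite /q; carrier_ring.
Qed.

Lemma is_RInt_C_unique (F : R -> C) a b (l l' : C) :
  @is_RInt C_R_NormedModule F a b l -> @is_RInt C_R_NormedModule F a b l' -> l = l'.
Proof.
move=> h h'.
by rewrite -(is_RInt_unique (V := C_R_CompleteNormedModule) _ _ _ _ h)
           -(is_RInt_unique (V := C_R_CompleteNormedModule) _ _ _ _ h').
Qed.

Lemma int_op_ext v v' t : (forall t, on_curve g t -> v t = v' t) -> K v t = K v' t.
Proof.
move=> e; apply: (RInt_ext (V := C_R_CompleteNormedModule)) => x _.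
by rewrite e //; exists x.
Qed.

Lemma int_op_plus v v' t : curve_integrable g v -> curve_integrable g v' ->
  on_curve g t -> K (fun t => v t + v' t)%C t = (K v t + K v' t)%C.
Proof.
move=> hv hv' ht.
have h1 := int_op_correct _ _ hv ht; have h2 := int_op_correct _ _ hv' ht.
apply: is_RInt_C_unique (int_op_correct _ _ (curve_integrable_plus _ _ hv hv') ht) _.
apply: is_RInt_ext (is_RInt_plus _ _ _ _ _ _ h1 h2) => x _.
by rewrite -[LHS]/(q t x * v (g x) + q t x * v' (g x))%C; carrier_ring.
Qed.

Lemma int_op_scal (c : C) v t : curve_integrable g v ->
  on_curve g t -> K (fun t => c * v t)%C t = (c * K v t)%C.
Proof.
move=> hv ht.
apply: is_RInt_C_unique (int_op_correct _ _ (curve_integrable_scal c _ hv) ht) _.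
apply: is_RInt_ext (is_RInt_Cmult _ c _ _ _ (int_op_correct _ _ hv ht)) => x _.
carrier_ring.
Qed.

Lemma int_op_minus v v' t : curve_integrable g v -> curve_integrable g v' ->
  on_curve g t -> K (fun t => v t - v' t)%C t = (K v t - K v' t)%C.
Proof.
move=> hv hv' ht.
rewrite (int_op_ext _ (fun t => v t + (- (1)) * v' t)%C); last by move=> s _; ring.
rewrite int_op_plus // ?int_op_scal //; first carrier_ring.
exact: curve_integrable_scal.
Qed.

Lemma curve_integrable_minus v v' : curve_integrable g v -> curve_integrable g v' ->
  curve_integrable g (fun t => v t - v' t)%C.
Proof.
move=> hv hv'.
apply: (curve_integrable_ext (fun t => v t + (- (1)) * v' t)%C); first by move=> s _; ring.
by apply: curve_integrable_plus => //; apply: curve_integrable_scal.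
Qed.

(** Smoothing by [K]: the regularity of the kernel in [t] passes under the integral, so a sup bound
    on [v] alone gives a [mu]-Hoelder bound, linear in [V]. *)
Lemma int_op_bounds : exists M, 0 < M /\ forall V v, 0 <= V ->
  curve_integrable g v -> curve_bounded g V v ->
  curve_bounded g (M * V) (K v) /\ holder (M * V) mu (fun x => K v (g x)).
Proof.
have hp := PI_RGT_0.
have [M0 [Mmu [om [hM0 [hMmu _]]]]] := hk.
have [|D [hD HD]] := continuous_bounded (curve_deriv g) 0 (2 * PI) _ (curve_deriv_continuous g hg).
  lra.
have [L [hL HL]] := curve_lipschitz g hg.
pose A := Rabs M0 + Rabs Mmu * Rpower L mu + 1.
have pL := Rpower_pos L mu.
have a1 : Rabs M0 <= A /\ Rabs Mmu * Rpower L mu <= A /\ 0 < A.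
  have := Rabs_pos M0; have := Rabs_pos Mmu.
  have := Rmult_le_pos _ _ (Rabs_pos Mmu) (Rlt_le _ _ pL); rewrite /A; lra.
have pA : 0 < A * D by apply: Rmult_lt_0_compat; lra.
exists (A * D * (2 * PI)); split; first by apply: Rmult_lt_0_compat; lra.
move=> V v hV hv hvb; split.
- move=> t ht.
  have := Cmod_RInt_le _ _ (A * D * V) 0 (2 * PI) _ _ (int_op_correct v t hv ht).
  rewrite Rminus_0_r => /(_ ltac:(lra)) H.
  apply: Rle_trans (H _) _; last by right; ring.
  move=> x hx; rewrite !Cmod_mult.
  apply: Rmult_le_compat; [| exact: Cmod_ge_0 | | exact: hvb (on_curve_param g x)].
    by apply: Rmult_le_pos; apply: Cmod_ge_0.
  apply: Rmult_le_compat; [exact: Cmod_ge_0 | exact: Cmod_ge_0 | | exact: HD].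
  apply: Rle_trans (hM0 _ _ ht (on_curve_param g x)) _.
  have := Rle_abs M0; lra.
- move=> x y hxy.
  have h1 := int_op_correct v (g x) hv (on_curve_param g x).
  have h2 := int_op_correct v (g y) hv (on_curve_param g y).
  have h3 := @is_RInt_minus C_R_NormedModule _ _ _ _ _ _ h2 h1.
  have pr := Rpower_pos (y - x) mu.
  have := Cmod_RInt_le _ _ (A * Rpower (y - x) mu * D * V) 0 (2 * PI) _ _ h3.
  rewrite Rminus_0_r => /(_ ltac:(lra)) H.
  apply: Rle_trans (H _) _; last by right; ring.
  move=> z hz.
  rewrite -[minus _ _]/(q (g y) z * v (g z) - q (g x) z * v (g z))%C.
  have -> : (q (g y) z * v (g z) - q (g x) z * v (g z)
    = (k (g y) (g z) - k (g x) (g z)) * curve_deriv g z * v (g z))%C by rewrite /q; ring.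
  rewrite !Cmod_mult.
  apply: Rmult_le_compat; [| exact: Cmod_ge_0 | | exact: hvb (on_curve_param g z)].
    by apply: Rmult_le_pos; apply: Cmod_ge_0.
  apply: Rmult_le_compat; [exact: Cmod_ge_0 | exact: Cmod_ge_0 | | exact: HD].
  (* The points coincide when [y - x] is a multiple of the period, a case that the kernel hypothesis
     excludes. *)
  case: (Req_dec (Cmod (g y - g x)%C) 0) => [e|n].
    by rewrite (Cmod_minus_eq_0 _ _ e) Cminus_diag Cmod_0; apply: Rmult_le_pos; lra.
  have ne : g y <> g x by move=> e; apply: n; rewrite e Cminus_diag Cmod_0.
  apply: Rle_trans (hMmu _ _ _ (on_curve_param g y) (on_curve_param g x) (on_curve_param g z) ne) _.
  have p : 0 < Cmod (g y - g x)%C by have := Cmod_ge_0 (g y - g x)%C; lra.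
  have hr : Rpower (Cmod (g y - g x)%C) mu <= Rpower L mu * Rpower (y - x) mu.
    rewrite Rpower_mult_distr; try lra.
    apply: Rpower_le_l; first lra.
    split => //; have := HL x y; rewrite Rabs_right; lra.
  apply: Rle_trans (_ : Rabs Mmu * Rpower (Cmod (g y - g x)%C) mu <= _).
    by apply: Rmult_le_compat_r; [exact/Rlt_le/Rpower_pos | exact: Rle_abs].
  apply: Rle_trans (_ : Rabs Mmu * (Rpower L mu * Rpower (y - x) mu) <= _).
    by apply: Rmult_le_compat_l => //; exact: Rabs_pos.
  rewrite -Rmult_assoc; apply: Rmult_le_compat_r; lra.
Qed.

End Operator.

(** * Compactness and the bounded inverse *)

(** Subsequences are encoded as infinite sets of indices: refining one is passing to an infinite
    subset. *)
Definition infinite (P : nat -> Prop) : Prop := forall n, exists p, (n <= p)%nat /\ P p.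

Lemma infinite_split (P Q R : nat -> Prop) : infinite P ->
  (forall p, P p -> Q p \/ R p) ->
  infinite (fun p => P p /\ Q p) \/ infinite (fun p => P p /\ R p).
Proof.
move=> hP hQR; apply: NNPP => hn.
have [h1 h2] := not_or_and _ _ hn.
have [n1 H1] := not_all_ex_not _ _ h1; have [n2 H2] := not_all_ex_not _ _ h2.
have [p [hp Pp]] := hP (max n1 n2).
case: (hQR p Pp) => h; [apply: H1 | apply: H2]; exists p; split=> //; lia.
Qed.

(** Bolzano-Weierstrass at a fixed precision: the range is covered by [M] slabs of width [eps], and
    either the lowest slab catches infinitely many indices or the remaining ones do. *)
Lemma infinite_close_R (a : nat -> R) B eps P : 0 < eps -> infinite P ->
  (forall p, P p -> Rabs (a p) <= B) ->
  exists P', infinite P' /\ (forall p, P' p -> P p) /\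
    forall p q, P' p -> P' q -> Rabs (a p - a q) <= eps.
Proof.
move=> he hP hB.
have [M hM] := INR_unbounded (2 * B / eps).
have : forall p, P p -> - B <= a p <= - B + INR M * eps.
  move=> p hp; have := hB p hp => /Rabs_le_between h.
  have : 2 * B = 2 * B / eps * eps by field; lra.
  nra.
move: (- B) P hP {hB hM} => lo P hP.
elim: M lo P hP => [|M IH] lo P hP hlo.
  exists P; split=> //; split=> // p q hp hq.
  have := hlo p hp; have := hlo q hq; rewrite /= => h1 h2.
  have -> : a p - a q = 0 by lra.
  by rewrite Rabs_R0; lra.
case: (infinite_split P (fun p => a p <= lo + eps) (fun p => lo + eps <= a p) hP) => [p _|h|h].
- by case: (Rle_dec (a p) (lo + eps)) => h; [left | right; lra].
- exists (fun p => P p /\ a p <= lo + eps); split=> //; split; first by move=> p [].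
  move=> p q [hp hp'] [hq hq']; apply: Rabs_le.
  have := hlo p hp; have := hlo q hq; lra.
- have [|P' [h1 [h2 h3]]] := IH (lo + eps) _ h.
    by move=> p [hp hp']; have := hlo p hp; rewrite S_INR; lra.
  by exists P'; split=> //; split=> // p hp; case: (h2 p hp).
Qed.

Lemma Cmod_le_components (a : C) eps :
  Rabs (fst a) <= eps / 2 -> Rabs (snd a) <= eps / 2 -> Cmod a <= eps.
Proof.
move=> h1 h2; apply: Rle_trans (Cmod_2Rmax _) _.
have hs : sqrt 2 <= 2.
  by rewrite -{2}(sqrt_square 2); [apply: sqrt_le_1_alt; lra | lra].
have hm := Rmax_lub _ _ _ h1 h2.
have : 0 <= Rmax (Rabs (fst a)) (Rabs (snd a)).
  by apply: Rle_trans (Rmax_l _ _); exact: Rabs_pos.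
have := sqrt_pos 2; nra.
Qed.

Lemma infinite_close_C (a : nat -> C) B eps P : 0 < eps -> infinite P ->
  (forall p, P p -> Cmod (a p) <= B) ->
  exists P', infinite P' /\ (forall p, P' p -> P p) /\
    forall p q, P' p -> P' q -> Cmod (a p - a q)%C <= eps.
Proof.
move=> he hP hB.
have [||P1 [h1 [s1 c1]]] := infinite_close_R (fun p => fst (a p)) B (eps / 2) P _ hP.
- lra.
- move=> p hp; apply: Rle_trans (hB p hp); apply: Rle_trans (Rmax_Cmod _); exact: Rmax_l.
have [||P2 [h2 [s2 c2]]] := infinite_close_R (fun p => snd (a p)) B (eps / 2) P1 _ h1.
- lra.
- move=> p hp; apply: Rle_trans (hB p (s1 p hp)); apply: Rle_trans (Rmax_Cmod _); exact: Rmax_r.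
exists P2; split=> //; split; first by move=> p hp; apply/s1/s2.
move=> p q hp hq; apply: Cmod_le_components; last exact: c2.
exact: c1 (s2 p hp) (s2 q hq).
Qed.

Lemma infinite_close_grid (F : nat -> nat -> C) B eps n P : 0 < eps -> infinite P ->
  (forall p i, Cmod (F p i) <= B) ->
  exists P', infinite P' /\ (forall p, P' p -> P p) /\
    forall p q i, P' p -> P' q -> (i < n)%nat -> Cmod (F p i - F q i)%C <= eps.
Proof.
move=> he hP hB; elim: n => [|n [P1 [h1 [s1 c1]]]].
  by exists P; split=> //; split=> // p q i _ _; lia.
have [|P2 [h2 [s2 c2]]] := infinite_close_C (fun p => F p n) B eps P1 he h1.
  by move=> p _.
exists P2; split=> //; split; first by move=> p hp; apply/s1/s2.
move=> p q i hp hq hi; case: (Nat.eq_dec i n) => [->|ne]; first exact: c2.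
by apply: c1; [exact: s2 | exact: s2 | lia].
Qed.

(** The usual [eps / 3] argument: the common Hoelder constant gives a grid step that serves all [p],
    and closeness at finitely many grid points extends to [[0, T]]. *)
Lemma infinite_close_holder (F : nat -> R -> C) A B s T eps P :
  0 <= A -> 0 < s -> 0 < eps -> infinite P ->
  (forall p, holder A s (F p)) -> (forall p x, Cmod (F p x) <= B) ->
  exists P', infinite P' /\ (forall p, P' p -> P p) /\
    forall p q x, P' p -> P' q -> 0 <= x <= T -> Cmod (F p x - F q x)%C <= eps.
Proof.
move=> hA hs he hP hF hB.
have [d [hd Hd]] := Rpower_small A s (eps / 3) hA hs ltac:(lra).
have [n hn] := INR_unbounded (T / d).
have [|P' [h1 [h2 h3]]] :=
  infinite_close_grid (fun p i => F p (INR i * d)%R) B (eps / 3) (S n) P _ hP (fun p i => hB p _).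
  lra.
exists P'; split=> //; split=> // p q x hp hq hx.
have hT : T = T / d * d by field; lra.
have [i [hi hi']] : exists i, (i < S n)%nat /\ INR i * d <= x < INR i * d + d.
  have hxn : x < INR n * d by nra.
  move: (n) hxn (proj1 hx) {h3 hn} => j; elim: j => [|j IH] hj hx0; first by move: hj; rewrite /=; lra.
  case: (Rlt_dec x (INR j * d)) => h.
    by have [i [? ?]] := IH h hx0; exists i; split; [lia | lra].
  by exists j; split; [lia | move: hj; rewrite S_INR; lra].
have near r : Cmod (F r x - F r (INR i * d)%R)%C <= eps / 3.
  case: (Req_dec x (INR i * d)) => [->|ne]; first by rewrite Cminus_diag Cmod_0; lra.
  apply: Rle_trans (hF r _ _ _) _; first lra.
  by apply/Rlt_le/Hd; lra.
have := near p; have := near q; have := h3 p q i hp hq hi.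
have := Cmod_minus_triangle (F p x) (F p (INR i * d)%R) (F q x).
have := Cmod_minus_triangle (F p (INR i * d)%R) (F q (INR i * d)%R) (F q x).
rewrite (Cmod_minus_sym (F q (INR i * d)%R)); lra.
Qed.

(** The sets chosen for [j = 0, 1, ...] are nested, and [phi j] is an element of the [j]-th one that
    is at least [j]; from index [j] on, all values lie in the [j]-th set. *)
Lemma diagonal_subsequence (R : nat -> nat -> nat -> Prop) :
  (forall j P, infinite P -> exists P', infinite P' /\ (forall p, P' p -> P p) /\
     forall p q, P' p -> P' q -> R j p q) ->
  exists phi : nat -> nat, (forall j, (j <= phi j)%nat) /\
    forall j i i', (j <= i)%nat -> (j <= i')%nat -> R j (phi i) (phi i').
Proof.
move=> H.
pose T := {P : nat -> Prop | infinite P}.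
have [nxt Hn] : exists nxt : nat * T -> T, forall jP,
    (forall p, proj1_sig (nxt jP) p -> proj1_sig (snd jP) p) /\
    forall p q, proj1_sig (nxt jP) p -> proj1_sig (nxt jP) q -> R (fst jP) p q.
  apply: (ClassicalEpsilon.choice (fun (jP : nat * T) (P' : T) =>
    (forall p, proj1_sig P' p -> proj1_sig (snd jP) p) /\
    forall p q, proj1_sig P' p -> proj1_sig P' q -> R (fst jP) p q)).
  move=> [j [P hP]] /=; have [P' [h1 h2]] := H j P hP.
  by exists (exist _ P' h1).
have hT : infinite (fun _ => True) by move=> n; exists n.
pose S := fix S j : T := match j with O => nxt (O, exist _ _ hT) | Datatypes.S i => nxt (Datatypes.S i, S i) end.
have mono : forall j i p, (j <= i)%nat -> proj1_sig (S i) p -> proj1_sig (S j) p.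
  move=> j; elim=> [|i IH] p hji hp; first by have -> : j = O by lia.
  case: (Nat.eq_dec j (Datatypes.S i)) => [->|ne] //.
  apply: IH; first lia.
  exact: (proj1 (Hn (Datatypes.S i, S i))).
have close : forall j p q, proj1_sig (S j) p -> proj1_sig (S j) q -> R j p q.
  case=> [|j] p q; [exact: (proj2 (Hn (O, exist _ _ hT))) | exact: (proj2 (Hn (Datatypes.S j, S j)))].
have [phi Hphi] := ClassicalEpsilon.choice (fun j p => (j <= p)%nat /\ proj1_sig (S j) p)
  (fun j => proj2_sig (S j) j).
exists phi; split; first by move=> j; case: (Hphi j).
move=> j i i' hi hi'; apply: close.
- exact: mono hi (proj2 (Hphi i)).
- exact: mono hi' (proj2 (Hphi i')).
Qed.

Lemma inv_INR_pos n : 0 < / INR (S n).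
Proof. apply/Rinv_0_lt_compat/lt_0_INR; lia. Qed.

Lemma inv_INR_le n p : (n <= p)%nat -> / INR (S p) <= / INR (S n).
Proof.
move=> h; apply: Rinv_le_contravar; first by apply: lt_0_INR; lia.
by apply: le_INR; lia.
Qed.

Lemma inv_INR_small eps : 0 < eps -> exists n, / INR (S n) < eps.
Proof.
move=> he; have [n hn] := INR_unbounded (/ eps); exists n.
rewrite -(Rinv_inv eps); apply: Rinv_lt_contravar.
  by apply: Rmult_lt_0_compat; [exact: Rinv_0_lt_compat | apply: lt_0_INR; lia].
rewrite S_INR; lra.
Qed.

Lemma le_of_le_plus_inv a b c : 0 <= c -> (forall n, a <= b + c * / INR (S n)) -> a <= b.
Proof.
move=> hc H; apply: le_epsilon => eps he.
have [|n hn] := inv_INR_small (eps / (c + 1)); first by apply: Rdiv_lt_0_compat; lra.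
apply: Rle_trans (H n) _; apply: Rplus_le_compat_l.
have -> : eps = (c + 1) * (eps / (c + 1)) by field; lra.
have := inv_INR_pos n; nra.
Qed.

Lemma C_cauchy_limit (u : nat -> C) :
  (forall j i i', (j <= i)%nat -> (j <= i')%nat -> Cmod (u i - u i')%C <= / INR (S j)) ->
  exists l, forall j, Cmod (u j - l)%C <= / INR (S j).
Proof.
move=> H.
have crit (p : C -> R) : (forall c, Rabs (p c) <= Cmod c) ->
    (forall a b, p (a - b)%C = p a - p b) -> exists l : R, is_lim_seq (fun n => p (u n)) l.
  move=> hp hpm.
  have [|l Hl] := (proj2 (ex_lim_seq_cauchy_corr (fun n => p (u n)))); last by exists l.
  move=> [eps he]; have [N hN] := inv_INR_small eps he; exists N => n m hn hm /=.
  rewrite -hpm; apply: Rle_lt_trans (hp _) _; apply: Rle_lt_trans (H N n m hn hm) hN.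
have [|//|l1 h1] := crit fst.
  by move=> c; apply: Rle_trans (Rmax_Cmod _); exact: Rmax_l.
have [|//|l2 h2] := crit snd.
  by move=> c; apply: Rle_trans (Rmax_Cmod _); exact: Rmax_r.
exists (l1, l2) => j; apply: le_epsilon => eps he.
move: h1 h2 => /is_lim_seq_spec /(_ (mkposreal (eps / 2) ltac:(lra))) [N1 H1].
move=> /is_lim_seq_spec /(_ (mkposreal (eps / 2) ltac:(lra))) [N2 H2].
pose N := max j (max N1 N2).
have a1 := H1 N ltac:(lia); have a2 := H2 N ltac:(lia).
have a3 := H j j N ltac:(lia) ltac:(lia).
apply: Rle_trans (Cmod_minus_triangle _ (u N) _) _.
suff : Cmod (u N - (l1, l2))%C <= eps by lra.
apply: Cmod_le_components; apply: Rlt_le; [exact: a1 | exact: a2].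
Qed.

(* Arzela-Ascoli *)
Lemma holder_compact (F : nat -> R -> C) A B s T :
  0 <= A -> 0 < s ->
  (forall p, holder A s (F p)) -> (forall p x, Cmod (F p x) <= B) ->
  exists (phi : nat -> nat) (G : R -> C), (forall j, (j <= phi j)%nat) /\
    forall j x, 0 <= x <= T -> Cmod (F (phi j) x - G x)%C <= / INR (S j).
Proof.
move=> hA hs hF hB.
have [|phi [h1 h2]] := diagonal_subsequence (fun j p q =>
    forall x, 0 <= x <= T -> Cmod (F p x - F q x)%C <= / INR (S j)).
  move=> j P hP.
  have [P' [a [b c]]] := infinite_close_holder F A B s T (/ INR (S j)) P hA hs (inv_INR_pos j) hP hF hB.
  by exists P'; split=> //; split=> // p q hp hq x; apply: c.
have [G HG] : exists G : R -> C, forall x, 0 <= x <= T ->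
    forall j, Cmod (F (phi j) x - G x)%C <= / INR (S j).
  apply: (ClassicalEpsilon.choice (fun x l => 0 <= x <= T ->
    forall j, Cmod (F (phi j) x - l)%C <= / INR (S j))) => x.
  case: (classic (0 <= x <= T)) => hx; last by exists (RtoC 0) => h; case: (hx h).
  have [|l hl] := C_cauchy_limit (fun j => F (phi j) x).
    by move=> j i i' hi hi'; apply: h2.
  by exists l.
by exists phi, G; split=> // j x hx; apply: HG.
Qed.

Section Inverse.
Variables (g : R -> C) (k : C -> C -> C) (mu : R) (lam : C).
Hypotheses (hg : contour g) (hmu : 0 < mu) (hk : kernel_regular g mu k).
Hypothesis hker : forall (A : R) (v : C -> C), 0 <= A -> holder A mu (fun x => v (g x)) ->
  (forall t, on_curve g t -> id_minus g k lam v t = RtoC 0) ->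
  forall t, on_curve g t -> v t = RtoC 0.

(** Failure of the bound for [C0 = p + 1] gives some [v] whose supremum [s] exceeds
    [(p + 1) * delta]; dividing by [s] yields [w]. The a priori bound [V] makes [s] finite. The
    supremum need not be attained, hence the value 1/2. *)
Lemma normalized_counterexample :
  ~ (exists C0, 0 < C0 /\ forall v V delta,
      curve_integrable g v -> curve_bounded g V v ->
      curve_bounded g delta (id_minus g k lam v) -> curve_bounded g (C0 * delta) v) ->
  forall p : nat, exists w : C -> C, curve_integrable g w /\ curve_bounded g 1 w /\
    curve_bounded g (/ INR (S p)) (id_minus g k lam w) /\
    exists t, on_curve g t /\ 1 / 2 <= Cmod (w t).
Proof.
move=> Hn p; apply: NNPP => hp; apply: Hn.
have hS : 0 < INR (S p) by apply: lt_0_INR; lia.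
exists (INR (S p)); split=> // v V delta hv hV hd t ht.
apply: Rnot_lt_le => hlt; apply: hp.
have hdelta : 0 <= delta by apply: Rle_trans (hd t ht); exact: Cmod_ge_0.
pose E r := exists t, on_curve g t /\ r = Cmod (v t).
have [||s [hs1 hs2]] := completeness E.
- by exists V => r [t' [ht' ->]]; exact: hV.
- by exists (Cmod (v t)), t.
have hsv t' : on_curve g t' -> Cmod (v t') <= s by move=> ht'; apply: hs1; exists t'.
have hs : INR (S p) * delta < s by apply: Rlt_le_trans hlt (hsv t ht).
have hs0 : 0 < s by nra.
have [t0 [ht0 h0]] : exists t0, on_curve g t0 /\ s / 2 <= Cmod (v t0).
  apply: NNPP => hno; have : s <= s / 2; last lra.
  apply: hs2 => r [t' [ht' ->]]; apply: Rnot_lt_le => h; apply: hno.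
  by exists t'; split=> //; lra.
have mod_s : Cmod (RtoC (/ s)) = / s.
  by rewrite Cmod_R Rabs_right //; apply/Rle_ge/Rlt_le/Rinv_0_lt_compat.
have his : 0 < / s by exact: Rinv_0_lt_compat.
have hss : / s * s = 1 by field; lra.
exists (fun t => RtoC (/ s) * v t)%C; split; first exact: curve_integrable_scal.
split; first by move=> t' ht'; rewrite Cmod_mult mod_s; have := hsv t' ht'; nra.
split; last first.
  by exists t0; split=> //; rewrite Cmod_mult mod_s; nra.
move=> t' ht'; rewrite /id_minus (int_op_scal g k mu) //.
have -> : (RtoC (/ s) * v t' - lam * (RtoC (/ s) * int_op g k v t')
    = RtoC (/ s) * id_minus g k lam v t')%C by rewrite /id_minus; ring.
rewrite Cmod_mult mod_s.
have h1 := hd t' ht'.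
apply: Rle_trans (_ : / s * delta <= _); first by apply: Rmult_le_compat_l; lra.
have -> : / INR (S p) = / s * (s * / INR (S p)) by field; lra.
apply: Rmult_le_compat_l; first lra.
have -> : delta = INR (S p) * delta * / INR (S p) by field; lra.
by apply: Rmult_le_compat_r; [exact/Rlt_le/Rinv_0_lt_compat | lra].
Qed.

(* Injectivity of [I - lam K] on Hoelder functions gives a bounded inverse in
   the sup norm, because [K] maps bounded sets to equi-Hoelder ones. *)
Lemma inverse_bound :
  exists C0, 0 < C0 /\ forall v V delta,
      curve_integrable g v -> curve_bounded g V v ->
      curve_bounded g delta (id_minus g k lam v) -> curve_bounded g (C0 * delta) v.
Proof.
apply: NNPP => /normalized_counterexample /ClassicalEpsilon.choice [w Hw].
have hp := PI_RGT_0.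
have [M [hM HM]] := int_op_bounds g k mu hg hmu hk.
have HF p : curve_bounded g M (int_op g k (w p)) /\ holder M mu (fun x => int_op g k (w p) (g x)).
  have [h1 [h2 _]] := Hw p.
  by have := HM 1 (w p) ltac:(lra) h1 h2; rewrite Rmult_1_r.
have [|phi [G [hphi HG]]] := holder_compact (fun p x => int_op g k (w p) (g x)) M M mu (2 * PI)
  (Rlt_le _ _ hM) hmu (fun p => proj2 (HF p)).
  by move=> p x; apply: (proj1 (HF p)); exists x.
(* Along the subsequence, [w = (w - lam K w) + lam K w] tends uniformly to [lam * G], since the
   residual tends to 0. *)
pose e t := (lam * G (param g t))%C.
pose c := 1 + Cmod lam.
have pl := Cmod_ge_0 lam.
have He t i : on_curve g t -> Cmod (w (phi i) t - e t)%C <= c * / INR (S i).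
  move=> ht; have [hx ex] := param_on_curve g hg t ht.
  have [_ [_ [h3 _]]] := Hw (phi i).
  apply: Rle_trans (Cmod_minus_triangle _ (lam * int_op g k (w (phi i)) t)%C _) _.
  have -> : (lam * int_op g k (w (phi i)) t - e t
    = lam * (int_op g k (w (phi i)) (g (param g t)) - G (param g t)))%C.
    by rewrite ex /e; ring.
  rewrite Cmod_mult.
  have := h3 t ht; rewrite /id_minus.
  have := inv_INR_le _ _ (hphi i); have := HG i (param g t) ltac:(lra).
  set a := Cmod (int_op g k _ _ - _)%C => h1 h2 h4.
  have : Cmod lam * a <= Cmod lam * / INR (S i) by apply: Rmult_le_compat_l.
  rewrite /c; lra.
have hlM : 0 <= Cmod lam * M by apply: Rmult_le_pos; lra.
(* [param] jumps at the cut, so regularity of [G] would not suffice; the bound is inherited from the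
   functions [K (w (phi i))], which are Hoelder across the cut. *)
have He_holder : holder (Cmod lam * M) mu (fun x => e (g x)).
  move=> x y hxy.
  apply: (le_of_le_plus_inv _ _ (2 * Cmod lam)); first lra.
  move=> i; have hF := proj2 (HF (phi i)) x y hxy.
  have hn z : Cmod (int_op g k (w (phi i)) (g z) - G (param g (g z)))%C <= / INR (S i).
    have [hz ez] := param_on_curve g hg (g z) (on_curve_param g z).
    by have := HG i (param g (g z)) ltac:(lra); rewrite ez.
  rewrite /e; have -> : (lam * G (param g (g y)) - lam * G (param g (g x))
    = lam * (G (param g (g y)) - G (param g (g x))))%C by ring.
  rewrite Cmod_mult !Rmult_assoc (Rmult_comm 2) !Rmult_assoc -Rmult_plus_distr_l.
  apply: Rmult_le_compat_l => //.
  have := hn x; have := hn y; rewrite (Cmod_minus_sym _ (G (param g (g y)))).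
  have := Cmod_minus_triangle (G (param g (g y))) (int_op g k (w (phi i)) (g y)) (G (param g (g x))).
  have := Cmod_minus_triangle (int_op g k (w (phi i)) (g y)) (int_op g k (w (phi i)) (g x)) (G (param g (g x))).
  lra.
have hei : curve_integrable g e.
  apply: curve_integrable_continuous => x.
  exact: (holder_continuous _ mu _ x hlM hmu He_holder).
(* [K] is bounded in the sup norm and so commutes with the uniform limit: [e] solves the homogeneous
   equation and vanishes by [hker]. *)
have e0 : forall t, on_curve g t -> e t = RtoC 0.
  apply: (hker _ e hlM He_holder) => t ht; apply: Cmod_eq_0.
  apply: Rle_antisym; last exact: Cmod_ge_0.
  apply: (le_of_le_plus_inv _ _ (c + 1 + Cmod lam * (M * c))).
    by have : 0 <= Cmod lam * (M * c); [apply: Rmult_le_pos => //; apply: Rmult_le_pos | ]; rewrite /c; lra.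
  move=> i; have [h1 [h2 [h3 _]]] := Hw (phi i).
  have pi := inv_INR_pos i.
  have pc : 0 <= c * / INR (S i) by apply: Rmult_le_pos; rewrite /c; lra.
  have [hb _] := HM _ (fun t => w (phi i) t - e t)%C pc
     (curve_integrable_minus g _ _ h1 hei) (fun t ht => He t i ht).
  have hbt := hb t ht; rewrite (int_op_minus g k mu) // in hbt.
  have h3t := h3 t ht; have h4 := inv_INR_le _ _ (hphi i).
  have h5 := He t i ht.
  have -> : (id_minus g k lam e t = id_minus g k lam (w (phi i)) t - (w (phi i) t - e t)
     + lam * (int_op g k (w (phi i)) t - int_op g k e t))%C by rewrite /id_minus; ring.
  apply: Rle_trans (Cmod_triangle _ _) _; rewrite Cmod_mult.
  have := Cmod_minus_le (id_minus g k lam (w (phi i)) t) (w (phi i) t - e t)%C.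
  have : Cmod lam * Cmod (int_op g k (w (phi i)) t - int_op g k e t)%C
     <= Cmod lam * (M * (c * / INR (S i))) by apply: Rmult_le_compat_l.
  lra.
have [|i hi] := inv_INR_small (1 / (2 * c)); first by apply: Rdiv_lt_0_compat; rewrite /c; lra.
have [_ [_ [_ [t [ht h]]]]] := Hw (phi i).
have := He t i ht; rewrite e0 // => h'.
have : Cmod (w (phi i) t - 0)%C = Cmod (w (phi i) t) by congr Cmod; ring.
have pc : 0 < c by rewrite /c; lra.
have : c * (1 / (2 * c)) = 1 / 2 by field; lra.
have := inv_INR_pos i; nra.
Qed.

End Inverse.

(** * Piecewise Hoelder functions *)

Lemma sum_C_Sm (a : nat -> C) n m : (n <= S m)%nat ->
  sum_n_m a n (S m) = (sum_n_m a n m + a (S m))%C.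
Proof. exact: sum_n_Sm. Qed.

Lemma sum_C_empty (a : nat -> C) n m : (m < n)%nat -> sum_n_m a n m = RtoC 0.
Proof. exact: sum_n_m_zero. Qed.

Lemma Cmod_sum_le (a : nat -> C) (b : nat -> R) n m :
  (forall i, (n <= i <= m)%nat -> Cmod (a i) <= b i) ->
  Cmod (sum_n_m a n m) <= sum_n_m b n m.
Proof.
case: (le_lt_dec n m) => hnm; last first.
  by move=> _; rewrite !sum_n_m_zero // Cmod_0; right.
elim: m hnm => [|m IH] hnm H.
  have -> : n = O by lia.
  by rewrite !sum_n_n; apply: H; lia.
rewrite !sum_n_Sm //.
apply: Rle_trans (Cmod_triangle _ _) _.
apply: Rplus_le_compat; last by apply: H; lia.
case: (Nat.eq_dec n (S m)) => [->|ne].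
  by rewrite !sum_n_m_zero; try lia; rewrite Cmod_0; right.
by apply: IH; [lia | move=> i hi; apply: H; lia].
Qed.

Lemma sum_C_ext (a b : nat -> C) n m : (forall i, (n <= i <= m)%nat -> a i = b i) ->
  sum_n_m a n m = sum_n_m b n m.
Proof. exact: sum_n_m_ext_loc. Qed.

Lemma sum_C_plus (a b : nat -> C) n m :
  sum_n_m (fun i => a i + b i)%C n m = (sum_n_m a n m + sum_n_m b n m)%C.
Proof. exact: (@sum_n_m_plus C_AbelianMonoid a b n m). Qed.

Lemma sum_C_mult_l (c : C) (a : nat -> C) n m :
  sum_n_m (fun i => c * a i)%C n m = (c * sum_n_m a n m)%C.
Proof. exact: (@sum_n_m_mult_l C_Ring c a n m). Qed.

Lemma sum_C_minus (a b : nat -> C) n m :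
  sum_n_m (fun i => a i - b i)%C n m = (sum_n_m a n m - sum_n_m b n m)%C.
Proof.
rewrite (sum_C_ext _ (fun i => a i + (- (1)) * b i)%C); last by move=> i _; carrier_ring.
by rewrite sum_C_plus sum_C_mult_l; carrier_ring.
Qed.

Lemma sum_C_single (a : nat -> C) n m j : (n <= j <= m)%nat ->
  (forall i, (n <= i <= m)%nat -> i <> j -> a i = RtoC 0) -> sum_n_m a n m = a j.
Proof.
elim: m => [|m IH] hj H.
  have -> : n = O by lia. have -> : j = O by lia.
  exact: sum_n_n.
rewrite sum_C_Sm; last lia.
case: (Nat.eq_dec j (S m)) => [e|ne].
  rewrite e; case: (le_lt_dec n m) => h; last by rewrite sum_C_empty //; carrier_ring.
  rewrite (sum_C_ext _ (fun _ => 0 * 0)%C); last first.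
    by move=> i hi; have -> : a i = RtoC 0; [apply: H; lia | carrier_ring].
  by rewrite sum_C_mult_l; carrier_ring.
rewrite IH; [| lia | by move=> i hi; apply: H; lia].
by have -> : a (S m) = RtoC 0; [apply: H; lia | carrier_ring].
Qed.

Section PiecewiseHolder.
Variables (g : R -> C) (nd : nat) (thd : nat -> R).
Hypotheses (hg : contour g) (hthd : jump_parameters nd thd).

Lemma thd_lt i j : (1 <= i)%nat -> (i < j)%nat -> (j <= nd)%nat -> thd i < thd j.
Proof.
case: hthd => _ [_ [_ H]] hi; elim: j => [|j IH] hij hj; first lia.
have hjj := H j ltac:(lia).
case: (Nat.eq_dec i j) => [->//|ne].
apply: Rlt_trans hjj; apply: IH; lia.
Qed.

Lemma thd_le i j : (1 <= i)%nat -> (i <= j)%nat -> (j <= nd)%nat -> thd i <= thd j.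
Proof.
move=> hi hij hj; case: (Nat.eq_dec i j) => [->|ne]; first lra.
apply/Rlt_le/thd_lt => //; lia.
Qed.

Lemma thd_range j : (1 <= j <= nd)%nat -> 0 < thd j < 2 * PI.
Proof.
case: hthd => h1 [h2 [h3 _]] hj; split.
- apply: Rlt_le_trans h2 _; apply: thd_le; lia.
- apply: Rle_lt_trans _ h3; apply: thd_le; lia.
Qed.

Lemma arc_end_last : arc_end nd thd nd = thd 1%nat + 2 * PI.
Proof. by rewrite /arc_end Nat.eqb_refl. Qed.

Lemma arc_end_lt j : (j < nd)%nat -> arc_end nd thd j = thd (S j).
Proof. by rewrite /arc_end => h; have -> : Nat.eqb j nd = false by apply/Nat.eqb_neq; lia. Qed.

Lemma nd_pos : (1 <= nd)%nat.
Proof. by case: hthd. Qed.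

Lemma arc_bounds j : (1 <= j <= nd)%nat ->
  thd 1%nat <= thd j /\ thd j < arc_end nd thd j /\ arc_end nd thd j <= thd 1%nat + 2 * PI.
Proof.
move=> hj; have hp := PI_RGT_0; have hn := nd_pos.
have h1 := thd_range 1 ltac:(lia); have h2 := thd_range j hj.
split; first by apply: thd_le; lia.
case: (Nat.eq_dec j nd) => [e|ne].
  by rewrite e arc_end_last -e; lra.
rewrite arc_end_lt; last lia.
have := thd_lt j (S j) ltac:(lia) ltac:(lia) ltac:(lia).
have := thd_range (S j) ltac:(lia); lra.
Qed.

Lemma arc_dist_sym x y : arc_dist g nd x y = arc_dist g nd y x.
Proof.
rewrite /arc_dist; case: Nat.eqb; last exact: Cmod_minus_sym.
by rewrite -(opp_RInt_swap (V := R_CompleteNormedModule)) ?Rabs_Ropp //;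
  apply: (ex_RInt_continuous (V := R_CompleteNormedModule)) => z _; apply: continuous_Cmod;
  exact: curve_deriv_continuous.
Qed.

(** For one arc, arc length is squeezed between the extrema of the speed. For several arcs, each
    leaves out at least [delta] of the period, which is what the chord-arc inequality asks for. *)
Lemma arc_dist_bounds : exists c L, 0 < c /\ 0 < L /\
  forall j x y, (1 <= j <= nd)%nat -> in_arc nd thd j x -> in_arc nd thd j y -> x < y ->
    c * (y - x) <= arc_dist g nd x y <= L * (y - x).
Proof.
have hp := PI_RGT_0; have hn := nd_pos.
have h1 := thd_range 1 ltac:(lia).
case E : (Nat.eqb nd 1).
- have [|L [hL HL]] := continuous_bounded (curve_deriv g) 0 (4 * PI) _ (curve_deriv_continuous g hg).
    lra.
  have [||c [hc Hc]] := continuous_bounded_below (curve_deriv g) 0 (4 * PI) _ (curve_deriv_continuous g hg).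
  + lra.
  + exact: (contour_regular hg).
  exists c, L; split=> //; split=> // j x y hj [hx hx'] [hy hy'] hxy.
  have hb := arc_bounds j hj.
  have hi : @is_RInt R_NormedModule (fun s => Cmod (curve_deriv g s)) x y
      (RInt (fun s => Cmod (curve_deriv g s)) x y).
    apply: (RInt_correct (V := R_CompleteNormedModule)).
    apply: (ex_RInt_continuous (V := R_CompleteNormedModule)) => z _; apply: continuous_Cmod.
    exact: curve_deriv_continuous.
  have lo := is_RInt_le _ _ _ _ _ _ (Rlt_le _ _ hxy) (@is_RInt_const R_NormedModule x y c) hi
    (fun z hz => Hc z ltac:(lra)).
  have up := is_RInt_le _ _ _ _ _ _ (Rlt_le _ _ hxy) hi (@is_RInt_const R_NormedModule x y L)
    (fun z hz => HL z ltac:(lra)).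
  move: lo up; rewrite /scal /= /mult /= => lo up.
  rewrite /arc_dist E Rabs_right; first lra.
  by apply/Rle_ge; apply: Rle_trans lo; apply: Rmult_le_pos; lra.
- have hnd : (2 <= nd)%nat by move/Nat.eqb_neq: E; lia.
  have [L [hL HL]] := curve_lipschitz g hg.
  have h1n := thd_lt 1 nd ltac:(lia) ltac:(lia) ltac:(lia).
  (* The last arc leaves out [thd nd - thd 1]; every other arc lies between [thd 1] and [2 * PI], so
     it leaves out at least [thd 1]. *)
  pose delta := Rmin (thd 1%nat) (thd nd - thd 1%nat).
  have hd : 0 < delta by apply: Rmin_glb_lt; lra.
  have hd1 : delta <= thd 1%nat by exact: Rmin_l.
  have hd2 : delta <= thd nd - thd 1%nat by exact: Rmin_r.
  have [c [hc Hc]] := curve_chord_lower g hg delta hd.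
  exists c, L; split=> //; split=> // j x y hj [hx hx'] [hy hy'] hxy.
  rewrite /arc_dist E Cmod_minus_sym; split.
    apply: Hc => //.
    case: (Nat.eq_dec j nd) => [e|ne].
      by move: hx hy'; rewrite e arc_end_last; lra.
    move: hy'; rewrite arc_end_lt; last lia.
    have := thd_range (S j) ltac:(lia); have := thd_le 1 j ltac:(lia) ltac:(lia) ltac:(lia); lra.
  by have := HL x y; rewrite Rabs_right; lra.
Qed.

Lemma arc_endpoints j : (1 <= j <= nd)%nat ->
  in_arc nd thd j (thd j) /\ in_arc nd thd j (arc_end nd thd j).
Proof. move=> /arc_bounds h; rewrite /in_arc; lra. Qed.

(** The endpoints of an arc are two distinct parameters in it, so both suprema range over nonempty
    sets and are at least 0. This excludes [m_infty], and [real] then returns the true norm. *)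
Lemma PH_norm_le sigma v a b :
  (forall j x, (1 <= j <= nd)%nat -> in_arc nd thd j x ->
     Cmod (arc_value g nd thd v j x) <= a) ->
  (forall j x y, (1 <= j <= nd)%nat -> in_arc nd thd j x -> in_arc nd thd j y -> x <> y ->
     Cmod (arc_value g nd thd v j x - arc_value g nd thd v j y)%C
       / Rpower (arc_dist g nd x y) sigma <= b) ->
  is_finite (PH_norm_bar g nd thd sigma v) /\ PH_norm g nd thd sigma v <= a + b.
Proof.
move=> Ha Hb; have hn := nd_pos.
have Hs j : (1 <= j <= nd)%nat -> exists r, 0 <= r <= a + b /\
    Rbar_plus (arc_sup g nd thd v j) (arc_holder g nd thd sigma v j) = Finite r.
  move=> hj; have hb := arc_bounds j hj.
  have [e1 e2] := arc_endpoints j hj.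
  have [u1 l1] : is_lub_Rbar _ (arc_sup g nd thd v j) := Lub_Rbar_correct _.
  have [u2 l2] : is_lub_Rbar _ (arc_holder g nd thd sigma v j) := Lub_Rbar_correct _.
  have a1 : Rbar_le (arc_sup g nd thd v j) a.
    by apply: l1 => r [x [hx ->]]; apply: Ha.
  have a2 : Rbar_le (arc_holder g nd thd sigma v j) b.
    by apply: l2 => r [x [y [hx [hy [hxy ->]]]]]; apply: Hb.
  have b1 : Rbar_le 0 (arc_sup g nd thd v j).
    apply: Rbar_le_trans (u1 _ (ex_intro _ (thd j) (conj e1 eq_refl))); exact: Cmod_ge_0.
  have b2 : Rbar_le 0 (arc_holder g nd thd sigma v j).
    have ne : thd j <> arc_end nd thd j by lra.
    apply: Rbar_le_trans (u2 _ (ex_intro _ (thd j) (ex_intro _ (arc_end nd thd j)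
      (conj e1 (conj e2 (conj ne eq_refl)))))).
    by apply: Rdiv_le_0_compat; [exact: Cmod_ge_0 | exact: Rpower_pos].
  move: a1 a2 b1 b2; case: (arc_sup _ _ _ _ _) => [r1||] //; case: (arc_holder _ _ _ _ _ _) => [r2||] //=.
  by move=> *; exists (r1 + r2); split=> //; lra.
have [ub lub] : Rbar_is_lub _ (PH_norm_bar g nd thd sigma v) := proj2_sig (Rbar_ex_lub _).
have h1 : Rbar_le (PH_norm_bar g nd thd sigma v) (a + b).
  by apply: lub => r [j [hj ->]]; have [s [hs ->]] := Hs j hj; apply: (proj2 hs).
have h2 : Rbar_le 0 (PH_norm_bar g nd thd sigma v).
  have [s [hs e]] := Hs 1%nat ltac:(lia).
  apply: Rbar_le_trans (ub _ (ex_intro _ 1%nat (conj _ eq_refl))); last lia.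
  by rewrite e; apply: (proj1 hs).
rewrite /PH_norm; move: h1 h2; by case: (PH_norm_bar _ _ _ _ _).
Qed.

Lemma PH_norm_bounds sigma v : is_finite (PH_norm_bar g nd thd sigma v) ->
  0 <= PH_norm g nd thd sigma v /\ forall j, (1 <= j <= nd)%nat ->
  (forall x, in_arc nd thd j x ->
     Cmod (arc_value g nd thd v j x) <= PH_norm g nd thd sigma v) /\
  (forall x y, in_arc nd thd j x -> in_arc nd thd j y -> x <> y ->
     Cmod (arc_value g nd thd v j x - arc_value g nd thd v j y)%C
       <= PH_norm g nd thd sigma v * Rpower (arc_dist g nd x y) sigma).
Proof.
move=> hfin; have hn := nd_pos.
have Hs j : (1 <= j <= nd)%nat -> exists r1 r2, 0 <= r1 /\ 0 <= r2 /\
    arc_sup g nd thd v j = Finite r1 /\ arc_holder g nd thd sigma v j = Finite r2 /\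
    r1 + r2 <= PH_norm g nd thd sigma v.
  move=> hj; have hb := arc_bounds j hj.
  have [e1 e2] := arc_endpoints j hj.
  have [u1 _] : is_lub_Rbar _ (arc_sup g nd thd v j) := Lub_Rbar_correct _.
  have [u2 _] : is_lub_Rbar _ (arc_holder g nd thd sigma v j) := Lub_Rbar_correct _.
  have b1 : Rbar_le 0 (arc_sup g nd thd v j).
    apply: Rbar_le_trans (u1 _ (ex_intro _ (thd j) (conj e1 eq_refl))); exact: Cmod_ge_0.
  have b2 : Rbar_le 0 (arc_holder g nd thd sigma v j).
    have ne : thd j <> arc_end nd thd j by lra.
    apply: Rbar_le_trans (u2 _ (ex_intro _ (thd j) (ex_intro _ (arc_end nd thd j)
      (conj e1 (conj e2 (conj ne eq_refl)))))).
    by apply: Rdiv_le_0_compat; [exact: Cmod_ge_0 | exact: Rpower_pos].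
  have [ub _] : Rbar_is_lub _ (PH_norm_bar g nd thd sigma v) := proj2_sig (Rbar_ex_lub _).
  have := ub _ (ex_intro _ j (conj hj eq_refl)); rewrite -hfin -/(PH_norm g nd thd sigma v).
  move: b1 b2; case: (arc_sup _ _ _ _ _) => [r1||] //; case: (arc_holder _ _ _ _ _ _) => [r2||] //=.
  by move=> *; exists r1, r2.
split.
  by have [r1 [r2 [? [? [_ [_ ?]]]]]] := Hs 1%nat ltac:(lia); lra.
move=> j hj; have [r1 [r2 [p1 [p2 [e1 [e2 hr]]]]]] := Hs j hj.
have [u1 _] : is_lub_Rbar _ (arc_sup g nd thd v j) := Lub_Rbar_correct _.
have [u2 _] : is_lub_Rbar _ (arc_holder g nd thd sigma v j) := Lub_Rbar_correct _.
split.
- move=> x hx; have := u1 _ (ex_intro _ x (conj hx eq_refl)); rewrite e1 /=; lra.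
- move=> x y hx hy hxy.
  have := u2 _ (ex_intro _ x (ex_intro _ y (conj hx (conj hy (conj hxy eq_refl))))).
  rewrite e2 /= => h; apply/Rle_div_l; first exact: Rpower_pos.
  lra.
Qed.

Lemma left_limit_eq v x l : left_limit_is g v x l -> left_limit g v x = l.
Proof.
exact (@iota_filterlim_locally R_AbsRing C_R_CompleteNormedModule R (at_left x)
  (Proper_StrongProper _ (at_left_proper_filter x)) (fun y => v (g y)) l).
Qed.

Lemma right_limit_eq v x l : right_limit_is g v x l -> right_limit g v x = l.
Proof.
exact (@iota_filterlim_locally R_AbsRing C_R_CompleteNormedModule R (at_right x)
  (Proper_StrongProper _ (at_right_proper_filter x)) (fun y => v (g y)) l).
Qed.

Lemma left_limit_period v x l : left_limit_is g v x l -> left_limit_is g v (x + 2 * PI) l.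
Proof.
move=> H; rewrite /left_limit_is.
apply: (filterlim_ext (fun y => v (g (y - 2 * PI)))).
  by move=> y; rewrite -(curve_periodic g hg (y - _)); congr (v (g _)); ring.
apply: (filterlim_comp _ _ _ (fun y => y - 2 * PI) (fun y => v (g y)) _ _ _ _ H).
move=> P [d Hd]; exists d => y hy hlt; apply: Hd; last lra.
move: hy; rewrite /ball /= /AbsRing_ball /= /minus /plus /opp /abs /=.
have -> : y - 2 * PI + - x = y + - (x + 2 * PI) by ring.
by [].
Qed.

Lemma continuous_left_limit v x : continuous (fun y => v (g y)) x -> left_limit_is g v x (v (g x)).
Proof. move=> H; apply: filterlim_filter_le_1 H; exact: filter_le_within. Qed.

Lemma continuous_right_limit v x : continuous (fun y => v (g y)) x -> right_limit_is g v x (v (g x)).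
Proof. move=> H; apply: filterlim_filter_le_1 H; exact: filter_le_within. Qed.

(** A globally Hoelder function has no jumps, so its lateral values are its values, and [arc_dist]
    is at least a fixed multiple of the parameter increment. The final norm estimate reduces to the
    parameter here. *)
Lemma PH_of_holder sigma : 0 < sigma -> exists c, 0 < c /\
  forall A B v, 0 <= A -> holder A sigma (fun x => v (g x)) -> curve_bounded g B v ->
  PH g nd thd sigma v /\ PH_norm g nd thd sigma v <= B + c * A.
Proof.
move=> hs.
have [c [L [hc [hL H]]]] := arc_dist_bounds.
have pc := Rpower_pos c sigma.
exists (/ Rpower c sigma); split; first exact: Rinv_0_lt_compat.
move=> A B v hA hv hB.
have hcont x : continuous (fun y => v (g y)) x by exact: (holder_continuous A sigma).
have hav j x : arc_value g nd thd v j x = v (g x).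
  rewrite /arc_value; case: Req_EM_T => _; first by apply/right_limit_eq/continuous_right_limit.
  by case: Req_EM_T => _ //; apply/left_limit_eq/continuous_left_limit.
have [||h1 h2] := PH_norm_le sigma v B (/ Rpower c sigma * A).
- by move=> j x _ _; rewrite hav; apply: hB; exists x.
- have Hlt j x y : (1 <= j <= nd)%nat -> in_arc nd thd j x -> in_arc nd thd j y -> x < y ->
     Cmod (v (g x) - v (g y))%C / Rpower (arc_dist g nd x y) sigma <= / Rpower c sigma * A.
    move=> hj hx hy hxy.
    have [d1 _] := H j x y hj hx hy hxy.
    have pd : 0 < c * (y - x) by apply: Rmult_lt_0_compat; lra.
    apply/Rle_div_l; first exact: Rpower_pos.
    rewrite Cmod_minus_sym; apply: Rle_trans (hv x y hxy) _.
    apply: Rle_trans (_ : / Rpower c sigma * A * Rpower (c * (y - x)) sigma <= _); last first.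
      apply: Rmult_le_compat_l; first by apply: Rmult_le_pos => //; exact/Rlt_le/Rinv_0_lt_compat.
      by apply: Rpower_le_l; lra.
    rewrite -Rpower_mult_distr; try lra.
    by right; field; lra.
  move=> j x y hj hx hy hxy; rewrite !hav.
  case: (Rtotal_order x y) => [h|[h|h]]; [exact: (Hlt j) | by case: hxy |].
  by rewrite Cmod_minus_sym arc_dist_sym; apply: (Hlt j).
split => //; split => // j hj; split; first exact: continuous_left_limit.
by exists (v (g (thd j))); apply: continuous_right_limit.
Qed.

Lemma arc_cover x : thd 1%nat < x <= thd 1%nat + 2 * PI ->
  exists j, (1 <= j <= nd)%nat /\ thd j < x <= arc_end nd thd j.
Proof.
move=> hx.
have : forall n, (1 <= n <= nd)%nat -> thd 1%nat < x <= arc_end nd thd n ->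
    exists j, (1 <= j <= nd)%nat /\ thd j < x <= arc_end nd thd j.
  elim=> [|n IH] hn h; first lia.
  case: (Rlt_dec (thd (S n)) x) => hlt; first by exists (S n); split; [exact: hn | lra].
  have : (n <> 0)%nat by move=> e; move: hlt; rewrite e; lra.
  move=> n0; apply: IH; first lia.
  by rewrite arc_end_lt; [lra | lia].
move=> /(_ nd); apply; first by have := nd_pos; lia.
by rewrite arc_end_last.
Qed.

(** * Splitting a piecewise Hoelder function into its jumps and a Hoelder part *)

Section Decomposition.
Variables (sigma : R) (f : C -> C).
Hypotheses (hsigma : 0 < sigma <= 1) (hf : PH g nd thd sigma f).
Let N := PH_norm g nd thd sigma f.

Lemma PH_left_limit j : (1 <= j <= nd)%nat -> left_limit g f (thd j) = f (g (thd j)).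
Proof. move=> hj; apply: left_limit_eq; by case: hf => /(_ j hj) [h _] _. Qed.

Lemma PH_arc_value_end j : (1 <= j <= nd)%nat ->
  arc_value g nd thd f j (arc_end nd thd j) = f (g (arc_end nd thd j)).
Proof.
move=> hj; have hb := arc_bounds j hj.
rewrite /arc_value; case: Req_EM_T => [|_]; first lra.
case: Req_EM_T => [_|] //.
case: (Nat.eq_dec j nd) => [e|ne].
  rewrite e arc_end_last (curve_periodic g hg).
  apply/left_limit_eq/left_limit_period.
  have hn := nd_pos; by case: hf => /(_ 1%nat ltac:(lia)) [h _] _.
rewrite arc_end_lt; last lia.
apply: PH_left_limit; lia.
Qed.

Lemma PH_arc_value j x : (1 <= j <= nd)%nat -> thd j < x <= arc_end nd thd j ->
  arc_value g nd thd f j x = f (g x).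
Proof.
move=> hj hx; case: (Req_dec x (arc_end nd thd j)) => [->|ne]; first exact: PH_arc_value_end.
by rewrite /arc_value; case: Req_EM_T => [|_]; [lra | case: Req_EM_T].
Qed.

Lemma PH_norm_ge0 : 0 <= N.
Proof. by case: hf => _ /PH_norm_bounds []. Qed.

Lemma PH_bounded : curve_bounded g N f.
Proof.
move=> t ht; have [x [hx e]] := on_curve_reduce g hg (thd 1%nat) t ht.
(* The value at [thd 1] is an incoming one, so that point is read as the right end of the last arc,
   one period later. *)
have [y [hy <-]] : exists y, thd 1%nat < y <= thd 1%nat + 2 * PI /\ g y = t.
  case: (Req_dec x (thd 1%nat)) => [ex|ne]; last by exists x; split => //; lra.
  by exists (x + 2 * PI); rewrite (curve_periodic g hg); split => //; have := PI_RGT_0; lra.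
have [j [hj hjy]] := arc_cover y hy.
rewrite -(PH_arc_value j y hj hjy).
have [_ /(_ j hj) [H _]] := PH_norm_bounds sigma f (proj2 hf).
by apply: H; rewrite /in_arc; lra.
Qed.

Lemma PH_jump_le j : (1 <= j <= nd)%nat -> Cmod (jump g f (thd j)) <= 2 * N.
Proof.
move=> hj; rewrite /jump PH_left_limit //.
apply: Rle_trans (Cmod_minus_le _ _) _.
have h1 := PH_bounded (g (thd j)) (on_curve_param _ _).
have [_ /(_ j hj) [H _]] := PH_norm_bounds sigma f (proj2 hf).
have := H (thd j) (proj1 (arc_endpoints j hj)).
rewrite {1}/arc_value; case: Req_EM_T => // _; rewrite -/N; lra.
Qed.

(* Valid on the last arc too: beyond the cut the parameter drops by [2 * PI], which
   the step lost at the cut compensates. *)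
Lemma generator_arc i j x : (1 <= i <= nd)%nat -> (1 <= j <= nd)%nat ->
  thd j < x <= arc_end nd thd j ->
  generator g thd i (g x) = (if Nat.leb i j then 1 else 0) - x / (2 * PI).
Proof.
move=> hi hj hx; have hp := PI_RGT_0; have hn := nd_pos.
have hb := arc_bounds j hj; have hi' := thd_range i hi; have hj' := thd_range j hj.
rewrite /generator /step_gen /ramp_gen.
case: (Rlt_dec x (2 * PI)) => h2.
  rewrite (param_curve g hg x); last lra.
  case: Rle_dec => h; case E : (Nat.leb i j) => //.
  - have hij : (i <= j)%nat by apply/Nat.leb_le.
    have := thd_le i j ltac:(lia) hij ltac:(lia); lra.
  - have hij : (j < i)%nat by move/Nat.leb_gt: E.
    case: h; move: hx; rewrite arc_end_lt; last lia.
    have := thd_le (S j) i ltac:(lia) ltac:(lia) ltac:(lia); lra.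
have ej : j = nd.
  case: (Nat.eq_dec j nd) => // ne; move: hx; rewrite arc_end_lt; last lia.
  have := thd_range (S j) ltac:(lia); lra.
have -> : Nat.leb i j = true by apply/Nat.leb_le; lia.
have e : param g (g x) = x - 2 * PI.
  have -> : g x = g (x - 2 * PI) by rewrite -(curve_periodic g hg (x - _)); congr g; ring.
  by apply: param_curve => //; have := thd_range 1 ltac:(lia); lra.
have := thd_le 1 i ltac:(lia) ltac:(lia) ltac:(lia).
rewrite e; case: Rle_dec => h; last by move: h; rewrite ej arc_end_last in hx hb; lra.
by move=> _; field; lra.
Qed.

(** At a jump point its own step has not yet been taken: compared with [generator_arc], [Nat.ltb]
    drops exactly the term [i = j]. *)
Lemma generator_left i j : (1 <= i <= nd)%nat -> (1 <= j <= nd)%nat ->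
  generator g thd i (g (thd j)) = (if Nat.ltb i j then 1 else 0) - thd j / (2 * PI).
Proof.
move=> hi hj; have hj' := thd_range j hj.
rewrite /generator /step_gen /ramp_gen (param_curve g hg); last lra.
case: Rle_dec => h; case E : (Nat.ltb i j) => //.
- have hij : (i < j)%nat by apply/Nat.ltb_lt.
  have := thd_lt i j ltac:(lia) hij ltac:(lia); lra.
- have hij : (j <= i)%nat by move/Nat.ltb_ge: E.
  have := thd_le j i ltac:(lia) ltac:(lia) ltac:(lia); lra.
Qed.

(** Along an arc the jump part is affine in [x]. The formula includes the left end, where [f_C] is
    evaluated from the incoming side while the arc value is the outgoing limit: this expresses the
    continuity of [f_C] at the jump. *)
Lemma cont_part_arc j x : (1 <= j <= nd)%nat -> in_arc nd thd j x ->
  cont_part g nd thd f (g x) =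
  (arc_value g nd thd f j x
   + (- sum_n_m (fun i => jump g f (thd i) * RtoC (if Nat.leb i j then 1 else 0)) 1 nd
   + sum_n_m (fun i => jump g f (thd i)) 1 nd * RtoC (/ (2 * PI)) * RtoC x))%C.
Proof.
move=> hj hx; have hp := PI_RGT_0; have hb := arc_bounds j hj.
rewrite /cont_part.
have split_sum (b : nat -> bool) (z : R) :
    (forall i, (1 <= i <= nd)%nat -> generator g thd i (g x) = (if b i then 1 else 0) - z / (2 * PI)) ->
    jump_part g nd thd f (g x)
    = (sum_n_m (fun i => jump g f (thd i) * RtoC (if b i then 1 else 0)) 1 nd
       - RtoC (/ (2 * PI)) * RtoC z * sum_n_m (fun i => jump g f (thd i)) 1 nd)%C.
  move=> H; rewrite /jump_part -sum_C_mult_l -sum_C_minus.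
  apply: sum_C_ext => i hi; rewrite H // RtoC_minus /Rdiv RtoC_mult; ring.
case: (Req_dec x (thd j)) => [ex|ne].
- rewrite (split_sum (fun i => Nat.ltb i j) x); last by move=> i hi; rewrite ex; exact: generator_left.
  have -> : arc_value g nd thd f j x = (f (g x) + jump g f (thd j))%C.
    rewrite /arc_value; case: Req_EM_T => // _.
    by rewrite /jump PH_left_limit // ex; ring.
  (* The two step sums differ by the single jump that separates the lateral value from [f (g x)]. *)
  have : (sum_n_m (fun i => jump g f (thd i) * RtoC (if Nat.leb i j then 1 else 0)) 1 nd
     - sum_n_m (fun i => jump g f (thd i) * RtoC (if Nat.ltb i j then 1 else 0)) 1 nd
     = jump g f (thd j))%C.
    rewrite -sum_C_minus (sum_C_single _ _ _ j hj).
      by rewrite Nat.leb_refl Nat.ltb_irrefl; ring.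
    move=> i hi hij.
    have -> : Nat.ltb i j = Nat.leb i j.
      apply: Bool.eq_true_iff_eq; rewrite Nat.ltb_lt Nat.leb_le; lia.
    ring.
  by move=> <-; ring.
- have hx' : thd j < x <= arc_end nd thd j by move: hx; rewrite /in_arc; lra.
  rewrite (split_sum (fun i => Nat.leb i j) x); last by move=> i hi; exact: generator_arc.
  by rewrite PH_arc_value //; ring.
Qed.

End Decomposition.

(** Adjacent closed arcs share the value of [f_C] at their common end, so the [nd] local estimates
    are glued along the period that starts and ends at the first jump point; [holder_periodic]
    doubles the result. *)
Lemma cont_part_holder sigma : 0 < sigma <= 1 -> exists c, 0 < c /\
  forall f, PH g nd thd sigma f ->
    holder (c * PH_norm g nd thd sigma f) sigma (fun x => cont_part g nd thd f (g x)).
Proof.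
move=> hs; have hp := PI_RGT_0; have hn := nd_pos.
have [c0 [L [hc0 [hL H]]]] := arc_dist_bounds.
have pL := Rpower_pos L sigma.
have pn : 0 < INR nd by apply: lt_0_INR; lia.
have p2 := Rpower_pos (2 * PI) (1 - sigma).
(* The first term comes from [f] through [arc_dist <= L * (y - x)]. The second comes from the linear
   part, whose slope is the sum of the jumps, each at most [2 * N], over [2 * PI]. *)
pose c1 := Rpower L sigma + 2 * INR nd * / (2 * PI) * Rpower (2 * PI) (1 - sigma).
have ip : 0 < / (2 * PI) by apply: Rinv_0_lt_compat; lra.
have hc1 : 0 < c1.
  have : 0 < 2 * INR nd * / (2 * PI) * Rpower (2 * PI) (1 - sigma).
    by repeat apply: Rmult_lt_0_compat => //; lra.
  rewrite /c1; lra.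
exists (2 * (INR nd * c1)); split; first by have := Rmult_lt_0_compat _ _ pn hc1; lra.
move=> f hf; set N := PH_norm g nd thd sigma f.
have hN : 0 <= N := PH_norm_ge0 sigma f hf.
have hper : periodic (fun x => cont_part g nd thd f (g x)).
  by move=> x; rewrite (curve_periodic g hg).
have hA : 0 <= c1 * N by apply: Rmult_le_pos; lra.
have hj j : (1 <= j <= nd)%nat ->
    holder_on (thd j) (arc_end nd thd j) (c1 * N) sigma (fun x => cont_part g nd thd f (g x)).
  move=> hj; have hb := arc_bounds j hj.
  have -> : c1 * N = Rpower L sigma * N + 2 * N * INR nd * / (2 * PI) * Rpower (2 * PI) (1 - sigma).
    by rewrite /c1; ring.
  apply: holder_on_ext (fun x hx => eq_sym (cont_part_arc sigma f hf j x hj hx)) _.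
  apply: holder_on_plus.
    move=> x y hx hxy hy.
    have hxa : in_arc nd thd j x by rewrite /in_arc; lra.
    have hya : in_arc nd thd j y by rewrite /in_arc; lra.
    have [_ /(_ j hj) [_ Hh]] := PH_norm_bounds sigma f (proj2 hf).
    have [d1 d2] := H j x y hj hxa hya hxy.
    have pd : 0 < c0 * (y - x) by apply: Rmult_lt_0_compat; lra.
    rewrite Cmod_minus_sym; apply: Rle_trans (Hh x y hxa hya _) _; first lra.
    rewrite (Rmult_comm _ N) Rmult_assoc; apply: Rmult_le_compat_l => //.
    rewrite Rpower_mult_distr; try lra.
    by apply: Rpower_le_l; lra.
  set S1 := sum_n_m _ 1 nd; set S2 := sum_n_m _ 1 nd.
  have hS2 : Cmod S2 <= 2 * N * INR nd.
    have := Cmod_sum_le (fun i => jump g f (thd i)) (fun _ => 2 * N) 1 nd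
      (fun i hi => PH_jump_le sigma f hf i hi).
    by rewrite sum_n_m_const -/S2 Nat.sub_succ Nat.sub_0_r Rmult_comm.
  move=> x y hx hxy hy.
  have -> : (- S1 + S2 * RtoC (/ (2 * PI)) * RtoC y - (- S1 + S2 * RtoC (/ (2 * PI)) * RtoC x)
     = S2 * RtoC (/ (2 * PI)) * RtoC (y - x))%C by rewrite RtoC_minus; ring.
  rewrite !Cmod_mult !Cmod_R !Rabs_right; try lra.
  have h1 : y - x <= Rpower (2 * PI) (1 - sigma) * Rpower (y - x) sigma.
    rewrite -{1}(Rpower_1 (y - x)); last lra.
    rewrite (Rpower_split (y - x) 1 sigma) Rmult_comm.
    apply: Rmult_le_compat_r; first exact/Rlt_le/Rpower_pos.
    apply: Rpower_le_l; lra.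
  have h2 := Cmod_ge_0 S2.
  rewrite (Rmult_assoc _ (Rpower _ _)).
  apply: Rmult_le_compat => //; [by apply: Rmult_le_pos; lra | lra |].
  by apply: Rmult_le_compat_r; lra.
have -> : 2 * (INR nd * c1) * N = 2 * (INR nd * (c1 * N)) by ring.
apply: (holder_periodic (thd 1%nat)) => //; [lra | by apply: Rmult_le_pos; lra |].
rewrite -arc_end_last.
have : forall n, (1 <= n <= nd)%nat ->
   holder_on (thd 1%nat) (arc_end nd thd n) (INR n * (c1 * N)) sigma (fun x => cont_part g nd thd f (g x)).
  elim=> [|[|n] IH] hn'; first lia.
    by rewrite Rmult_1_l; apply: hj.
  rewrite S_INR Rmult_plus_distr_r Rmult_1_l.
  apply: (holder_on_glue _ (thd (S (S n)))) => //; [lra | by apply: Rmult_le_pos => //; exact: pos_INR | | exact: hj].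
  by rewrite -(arc_end_lt (S n)); [apply: IH; lia | lia].
by apply; lia.
Qed.

(** Inside [(0, 2 * PI)] the only discontinuity is at [thd i], and on each side the generator is
    affine in the parameter; values at interval endpoints do not affect integrability. *)
Lemma generator_integrable i : (1 <= i <= nd)%nat ->
  curve_integrable g (fun t => RtoC (generator g thd i t)).
Proof.
move=> hi q hq; have hp := PI_RGT_0; have ht := thd_range i hi.
have hlin a x : continuous (fun y => q y * RtoC (a - y / (2 * PI)))%C x.
  apply: continuous_Cmult; first exact: hq.
  apply: (continuous_comp (fun y => a - y / (2 * PI)) RtoC).
    apply: (continuous_minus (fun _ => a) (fun y => y / (2 * PI))); first exact: continuous_const.
    by apply: (continuous_mult (fun y => y) (fun _ => / (2 * PI))); [exact: continuous_id | exact: continuous_const].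
  apply: continuous_Cmod_eps => eps he; exists eps; split=> // y.
  by rewrite -RtoC_minus Cmod_R.
apply: (ex_RInt_Chasles _ _ (thd i)).
- apply: (ex_RInt_ext (fun y => q y * RtoC (0 - y / (2 * PI)))%C).
    move=> x; rewrite Rmin_left ?Rmax_right; try lra.
    move=> hx; rewrite /generator /step_gen /ramp_gen (param_curve g hg); last lra.
    by case: Rle_dec => // h; lra.
  by apply: (@ex_RInt_continuous C_R_CompleteNormedModule) => x _; apply: hlin.
- apply: (ex_RInt_ext (fun y => q y * RtoC (1 - y / (2 * PI)))%C).
    move=> x; rewrite Rmin_left ?Rmax_right; try lra.
    move=> hx; rewrite /generator /step_gen /ramp_gen (param_curve g hg); last lra.
    by case: Rle_dec => // h; lra.
  by apply: (@ex_RInt_continuous C_R_CompleteNormedModule) => x _; apply: hlin.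
Qed.

Lemma jump_part_integrable f : curve_integrable g (jump_part g nd thd f).
Proof. apply: curve_integrable_sum => j hj; exact: generator_integrable. Qed.

Lemma PH_integrable sigma f : 0 < sigma <= 1 -> PH g nd thd sigma f -> curve_integrable g f.
Proof.
move=> hs hf; have [c [hc H]] := cont_part_holder sigma hs.
apply: (curve_integrable_ext g (fun t => cont_part g nd thd f t + jump_part g nd thd f t)%C).
  by move=> t _; rewrite /cont_part; ring.
apply: curve_integrable_plus; last exact: jump_part_integrable.
apply: curve_integrable_continuous => x; apply: holder_continuous (H f hf); last lra.
apply: Rmult_le_pos; first lra; exact: PH_norm_ge0 hf.
Qed.

End PiecewiseHolder.

(** * Cardinal B-splines *)

Lemma sum_R_Sm (a : nat -> R) n m : (n <= S m)%nat ->
  sum_n_m a n (S m) = sum_n_m a n m + a (S m).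
Proof. exact: sum_n_Sm. Qed.

Lemma sum_R_le (a b : nat -> R) n m : (forall i, (n <= i <= m)%nat -> a i <= b i) ->
  sum_n_m a n m <= sum_n_m b n m.
Proof.
case: (le_lt_dec n m) => hnm; last by move=> _; rewrite !sum_n_m_zero //; right.
elim: m hnm => [|m IH] hnm H.
  have -> : n = O by lia.
  by rewrite !sum_n_n; apply: H; lia.
rewrite !sum_R_Sm //; apply: Rplus_le_compat; last by apply: H; lia.
case: (Nat.eq_dec n (S m)) => [->|ne].
  by rewrite !sum_n_m_zero; try lia; right.
by apply: IH; [lia | move=> i hi; apply: H; lia].
Qed.

Lemma sum_R_plus (a b : nat -> R) n m :
  sum_n_m (fun i => a i + b i) n m = sum_n_m a n m + sum_n_m b n m.
Proof. exact: (@sum_n_m_plus R_AbelianMonoid a b n m). Qed.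

Lemma sum_R_mult_l (c : R) (a : nat -> R) n m :
  sum_n_m (fun i => c * a i) n m = c * sum_n_m a n m.
Proof. exact: (@sum_n_m_mult_l R_Ring c a n m). Qed.

Lemma RtoC_sum (a : nat -> R) n m : sum_n_m (fun i => RtoC (a i)) n m = RtoC (sum_n_m a n m).
Proof.
case: (le_lt_dec n m) => hnm; last by rewrite !sum_n_m_zero.
elim: m hnm => [|m IH] hnm.
  have -> : n = O by lia.
  by rewrite !sum_n_n.
rewrite sum_C_Sm // sum_R_Sm // RtoC_plus.
case: (Nat.eq_dec n (S m)) => [->|ne].
  by rewrite !sum_n_m_zero; try lia.
by rewrite IH //; lia.
Qed.

Lemma sum_C_shift (a : nat -> C) p n m :
  sum_n_m (fun i => a (i + p)%nat) n m = sum_n_m a (n + p) (m + p).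
Proof.
case: (le_lt_dec n m) => hnm; last by rewrite !sum_C_empty //; lia.
elim: m hnm => [|m IH] hnm.
  have -> : n = O by lia.
  by rewrite !sum_n_n.
rewrite sum_C_Sm // Nat.add_succ_l sum_C_Sm; last lia.
case: (Nat.eq_dec n (S m)) => [->|ne].
  by rewrite !sum_C_empty; try lia.
by rewrite IH //; lia.
Qed.

Lemma sum_C_zero (a : nat -> C) n m : (forall i, (n <= i <= m)%nat -> a i = RtoC 0) ->
  sum_n_m a n m = RtoC 0.
Proof.
move=> H; rewrite (sum_C_ext _ (fun _ => 0 * 0)%C); last first.
  by move=> i hi; rewrite H //; carrier_ring.
by rewrite sum_C_mult_l; carrier_ring.
Qed.

Lemma sum_C_split (a : nat -> C) n p m : (n <= S p)%nat -> (p <= m)%nat ->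
  sum_n_m a n m = (sum_n_m a n p + sum_n_m a (S p) m)%C.
Proof. exact: sum_n_m_Chasles. Qed.

Lemma argmax_Cmod (c : nat -> C) n : (1 <= n)%nat ->
  exists j0, (1 <= j0 <= n)%nat /\ forall j, (1 <= j <= n)%nat -> Cmod (c j) <= Cmod (c j0).
Proof.
elim: n => [|[|n] IH] h; first lia.
  exists 1%nat; split; first lia.
  by move=> j hj; rewrite (_ : j = 1%nat); [right | lia].
have [j0 [h0 H]] := IH ltac:(lia).
case: (Rle_dec (Cmod (c (S (S n)))) (Cmod (c j0))) => hle.
  exists j0; split; [lia|] => j hj; case: (Nat.eq_dec j (S (S n))) => [->//|ne]; apply: H; lia.
exists (S (S n)); split; [lia|] => j hj; case: (Nat.eq_dec j (S (S n))) => [->|ne]; first by right.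
by have := H j ltac:(lia); lra.
Qed.

Lemma bspline_SS p x : bspline (S (S p)) x =
  ((INR (S (S p)) / 2 + x) * bspline (S p) (x + 1 / 2)
   + (INR (S (S p)) / 2 - x) * bspline (S p) (x - 1 / 2)) / INR (S p).
Proof. by []. Qed.

(** The inequality is strict because the spline of order 1 equals 1 at [- (1 / 2)]. *)
Lemma bspline_support_open p x : INR (S p) / 2 < Rabs x -> bspline (S p) x = 0.
Proof.
elim: p x => [|p IH] x hx.
  rewrite /=; case: Rle_dec => // h1; case: Rlt_dec => // h2.
  by move: hx; rewrite /=; case: (Rcase_abs x) => h; [rewrite Rabs_left // | rewrite Rabs_right //]; lra.
rewrite bspline_SS !IH; first by field; apply: not_0_INR.
all: move: hx; rewrite (S_INR (S p)) => hx.
- case: (Rcase_abs x) => h; [rewrite (Rabs_left x) // in hx | rewrite (Rabs_right x) // in hx];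
  case: (Rcase_abs (x - 1 / 2)) => h'; [rewrite Rabs_left // | rewrite Rabs_right // |
    rewrite Rabs_left // | rewrite Rabs_right //]; lra.
- case: (Rcase_abs x) => h; [rewrite (Rabs_left x) // in hx | rewrite (Rabs_right x) // in hx];
  case: (Rcase_abs (x + 1 / 2)) => h'; [rewrite Rabs_left // | rewrite Rabs_right // |
    rewrite Rabs_left // | rewrite Rabs_right //]; lra.
Qed.

(** From order 2 on the boundary is included: there one linear factor of the recurrence vanishes and
    the other term lies outside its support. *)
Lemma bspline_support p x : INR (S (S p)) / 2 <= Rabs x -> bspline (S (S p)) x = 0.
Proof.
move=> hx; case: (Req_dec (INR (S (S p)) / 2) (Rabs x)) => [e|ne]; last first.
  by apply: bspline_support_open; lra.
have hp : 0 < INR (S p) by apply: lt_0_INR; lia.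
move: e; rewrite bspline_SS; case: (Rcase_abs x) => h; [rewrite Rabs_left // | rewrite Rabs_right //] => e.
- rewrite (bspline_support_open p (x - 1 / 2)).
    by rewrite (_ : INR (S (S p)) / 2 + x = 0); [field; lra | lra].
  by rewrite Rabs_left; move: e; rewrite (S_INR (S p)); lra.
- rewrite (bspline_support_open p (x + 1 / 2)).
    by rewrite (_ : INR (S (S p)) / 2 - x = 0); [field; lra | lra].
  by rewrite Rabs_right; move: e; rewrite (S_INR (S p)); lra.
Qed.

Lemma bspline_ge0 p x : 0 <= bspline (S p) x.
Proof.
elim: p x => [|p IH] x.
  by rewrite /=; case: Rle_dec => h1; [case: Rlt_dec => h2 |]; lra.
have hp : 0 < INR (S p) by apply: lt_0_INR; lia.
case: (Rlt_dec (INR (S (S p)) / 2) (Rabs x)) => h; first by rewrite bspline_support_open //; right.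
have /Rabs_le_between hx : Rabs x <= INR (S (S p)) / 2 by lra.
rewrite bspline_SS; apply: Rdiv_le_0_compat => //.
by apply: Rplus_le_le_0_compat; apply: Rmult_le_pos; try exact: IH; lra.
Qed.

(** Telescoping of the recurrence: the first term at index [i + 1] and the second at [i] contain the
    same spline of lower order, and their linear factors add up to [INR (S p)]. The range of [y]
    kills the two terms left over at the ends of the sum. *)
Lemma bspline_unity p M y : INR (S p) / 2 <= y <= INR M - INR (S p) / 2 ->
  sum_n_m (fun i => bspline (S p) (y - INR i)) 0 M = 1.
Proof.
elim: p M y => [|p IH] M y hy.
  have -> : sum_n_m (fun i => bspline 1 (y - INR i)) 0 M = if Rlt_dec y (INR M + 1 / 2) is left _ then 1 else 0.
    move: hy => [h _]; rewrite /= in h.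
    elim: M => [|M IH].
      rewrite sum_n_n /= Rminus_0_r Rplus_0_l; case: Rle_dec => h1; last lra.
      by [].
    rewrite sum_R_Sm ?IH; last lia.
    rewrite S_INR /bspline; case: Rlt_dec => h1; case: Rle_dec => h2; case: Rlt_dec => h3; try lra;
    case: Rlt_dec; lra.
  by rewrite /= in hy; case: Rlt_dec => h //; lra.
have hp : 0 < INR (S p) by apply: lt_0_INR; lia.
have hp2 : INR (S (S p)) = INR (S p) + 1 by exact: S_INR.
pose a i := (INR (S (S p)) / 2 + (y - INR i)) * bspline (S p) (y - INR i + 1 / 2).
pose b i := (INR (S (S p)) / 2 - (y - INR i)) * bspline (S p) (y - INR i - 1 / 2).
have tele : sum_n_m (fun i => a i + b i) 0 M
   = a O - a (S M) + sum_n_m (fun i => a (S i) + b i) 0 M.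
  elim: (M) => [|K IHK]; first by rewrite !sum_n_n; carrier_ring.
  by rewrite !sum_R_Sm ?IHK; try lia; carrier_ring.
have a0 : a O = 0.
  rewrite /a bspline_support_open; first carrier_ring.
  by rewrite /= -/(INR (S p)) Rabs_right; lra.
have aM : a (S M) = 0.
  rewrite /a bspline_support_open; first carrier_ring.
  by rewrite (S_INR M) Rabs_left; lra.
have ab i : a (S i) + b i = INR (S p) * bspline (S p) (y - 1 / 2 - INR i).
  rewrite /a /b (S_INR i) hp2.
  have -> : y - (INR i + 1) + 1 / 2 = y - 1 / 2 - INR i by lra.
  have -> : y - INR i - 1 / 2 = y - 1 / 2 - INR i by lra.
  by field.
rewrite (sum_n_m_ext_loc _ (fun i => / INR (S p) * (a i + b i))); last first.
  by move=> i _; rewrite bspline_SS /a /b /Rdiv Rmult_comm.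
rewrite sum_R_mult_l tele a0 aM (sum_n_m_ext _ _ _ _ ab) sum_R_mult_l IH; first by change (/ INR (S p) * (0 - 0 + INR (S p) * 1) = 1); field; lra.
by lra.
Qed.

Lemma bspline_lipschitz p : exists L, 0 < L /\
  forall x y, Rabs (bspline (S (S p)) x - bspline (S (S p)) y) <= L * Rabs (x - y).
Proof.
elim: p => [|p [L [hL HL]]].
  exists 1; split; first lra.
  move=> x y; rewrite Rmult_1_l.
  have hat z : bspline 2 z = Rmax 0 (1 - Rabs z).
    rewrite /=; have -> : (1 + 1) / 2 = 1 by field.
    case: (Rcase_abs z) => h; [rewrite (Rabs_left z) // | rewrite (Rabs_right z) //];
    rewrite /Rmax; case: Rle_dec => h0;
    repeat (case: Rle_dec => ?); repeat (case: Rlt_dec => ?); lra.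
  rewrite !hat.
  have h1 : Rabs (Rabs x - Rabs y) <= Rabs (x - y) := Rabs_triang_inv2 x y.
  move: h1; set u := Rabs x; set v := Rabs y; set d := Rabs (x - y) => /Rabs_le_between h1.
  apply: Rabs_le; rewrite /Rmax; case: Rle_dec => h; case: Rle_dec => h'; lra.
have hq : 0 < INR (S (S p)) by apply: lt_0_INR; lia.
have hR : INR (S (S (S p))) = INR (S (S p)) + 1 by exact: S_INR.
pose R0 := INR (S (S (S p))).
(* The linear factor is bounded on the support of the spline it multiplies. *)
have prod (s t : R) : Rabs s = 1 -> Rabs t <= 1 / 2 -> forall x y,
   Rabs ((R0 / 2 + s * x) * bspline (S (S p)) (x + t) - (R0 / 2 + s * y) * bspline (S (S p)) (y + t))
   <= (2 * R0 * L + 1) * Rabs (x - y).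
  move=> hs ht.
  (* A single value is one term of a nonnegative family summing to 1; the shift by [K] places [z]
     where the partition of unity is complete. *)
  have le1 z : Rabs (bspline (S (S p)) z) <= 1.
    have [K hK] := INR_unbounded (R0 + Rabs z).
    have /Rabs_le_between hz := Rle_refl (Rabs z).
    have hy : INR (S (S p)) / 2 <= z + INR K <= INR (K + K) - INR (S (S p)) / 2.
      rewrite plus_INR; rewrite /R0 in hK; lra.
    have u1 := bspline_unity (S p) (K + K) (z + INR K) hy.
    rewrite Rabs_right; last by apply/Rle_ge/bspline_ge0.
    rewrite -u1.
    have -> : bspline (S (S p)) z = sum_n_m (fun i => if Nat.eqb i K then bspline (S (S p)) z else 0) 0 (K + K).
      have := sum_C_single (fun i => RtoC (if Nat.eqb i K then bspline (S (S p)) z else 0)) 0 (K + K) K ltac:(lia).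
      rewrite RtoC_sum Nat.eqb_refl => H; apply: RtoC_inj; rewrite H // => i _ ne.
      by have -> : Nat.eqb i K = false by apply/Nat.eqb_neq.
    apply: sum_R_le => i _; case: Nat.eqb_spec => [->|_]; last exact: bspline_ge0.
    by right; congr bspline; ring.
  have main x y : Rabs (x + t) < INR (S (S p)) / 2 -> 
     Rabs ((R0 / 2 + s * x) * bspline (S (S p)) (x + t) - (R0 / 2 + s * y) * bspline (S (S p)) (y + t))
     <= (2 * R0 * L + 1) * Rabs (x - y).
    move=> hx.
    have h1 := HL (x + t) (y + t); have h2 := le1 (y + t).
    rewrite (_ : x + t - (y + t) = x - y) in h1; last ring.
    move: h1 h2; move: (bspline (S (S p)) (x + t)) (bspline (S (S p)) (y + t)) => u w h1 h2.
    have -> : (R0 / 2 + s * x) * u - (R0 / 2 + s * y) * w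
      = (R0 / 2 + s * x) * (u - w) + s * (x - y) * w by ring.
    apply: Rle_trans (Rabs_triang _ _) _; rewrite !Rabs_mult hs Rmult_1_l.
    have h3 : Rabs (R0 / 2 + s * x) <= 2 * R0.
      apply: Rle_trans (Rabs_triang _ _) _; rewrite Rabs_mult hs Rmult_1_l.
      rewrite (Rabs_right (R0 / 2)); last by rewrite /R0; lra.
      have : Rabs x <= Rabs (x + t) + Rabs t.
        have {1}-> : x = (x + t) + - t by ring.
        by apply: Rle_trans (Rabs_triang _ _) _; rewrite Rabs_Ropp; lra.
      rewrite /R0 in hx *; lra.
    have p1 := Rabs_pos (x - y); have p2 := Rabs_pos (R0 / 2 + s * x).
    have : Rabs (R0 / 2 + s * x) * Rabs (u - w) <= 2 * R0 * (L * Rabs (x - y)).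
      by apply: Rmult_le_compat => //; exact: Rabs_pos.
    have : Rabs (x - y) * Rabs w <= Rabs (x - y) * 1 by apply: Rmult_le_compat_l.
    lra.
  move=> x y.
  case: (Rlt_dec (Rabs (x + t)) (INR (S (S p)) / 2)) => hx; first exact: main.
  case: (Rlt_dec (Rabs (y + t)) (INR (S (S p)) / 2)) => hy.
    by rewrite Rabs_minus_sym (Rabs_minus_sym x); exact: main.
  rewrite !bspline_support; try lra.
  rewrite !Rmult_0_r Rminus_0_r Rabs_R0; apply: Rmult_le_pos; last exact: Rabs_pos.
  by have : 0 <= R0 * L; [apply: Rmult_le_pos; rewrite /R0; lra | lra].
have pR : 0 < R0 * L by apply: Rmult_lt_0_compat; rewrite /R0; lra.
exists (2 * (2 * R0 * L + 1) / INR (S (S p))); split; first by apply: Rdiv_lt_0_compat; lra.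
move=> x y; rewrite !(bspline_SS (S p)) -/R0.
have h1 := prod 1 (1 / 2) ltac:(by rewrite Rabs_R1) ltac:(rewrite Rabs_right; lra) x y.
have h2 := prod (-1) (- (1 / 2)) ltac:(by rewrite Rabs_left; lra) ltac:(rewrite Rabs_left; lra) x y.
have dq (a b : R) : Rabs (a / INR (S (S p)) - b / INR (S (S p))) = Rabs (a - b) / INR (S (S p)).
  rewrite -(Rabs_right (INR (S (S p)))) -?Rabs_div; try lra.
  rewrite (Rabs_right (INR (S (S p)))); last lra.
  by congr Rabs; field; lra.
rewrite dq.
have -> : 2 * (2 * R0 * L + 1) / INR (S (S p)) * Rabs (x - y)
  = 2 * (2 * R0 * L + 1) * Rabs (x - y) / INR (S (S p)) by field; lra.
apply: Rmult_le_compat_r; first exact/Rlt_le/Rinv_0_lt_compat.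
move: h1 h2.
have -> : R0 / 2 + 1 * x = R0 / 2 + x by ring.
have -> : R0 / 2 + 1 * y = R0 / 2 + y by ring.
have -> : R0 / 2 + -1 * x = R0 / 2 - x by ring.
have -> : R0 / 2 + -1 * y = R0 / 2 - y by ring.
have -> : x + - (1 / 2) = x - 1 / 2 by ring.
have -> : y + - (1 / 2) = y - 1 / 2 by ring.
set a := _ * _; set b := _ * _; set a' := (_ - x) * _; set b' := (_ - y) * _ => h1 h2.
have -> : a + a' - (b + b') = (a - b) + (a' - b') by ring.
apply: Rle_trans (Rabs_triang _ _) _; lra.
Qed.

(** The values are 1, 3/4 and 2/3. Diagonal dominance in [coefficient_bound] rests on their
    exceeding 1/2. *)
Lemma bspline_center m : m = 2%nat \/ m = 3%nat \/ m = 4%nat -> 2 / 3 <= bspline m 0.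
Proof.
by case=> [->|[->|->]]; rewrite /=; repeat (case: Rle_dec => ?); repeat (case: Rlt_dec => ?); lra.
Qed.

(** The true count is at most 4; the value 5 is what the linear invariant [INR M - y + 3] on partial
    sums yields. *)
Lemma window_count y M :
  sum_n_m (fun i => if Rlt_dec (Rabs (y - INR i)) 2 is left _ then 1 else 0) 0 M <= 5.
Proof.
suff : sum_n_m (fun i => if Rlt_dec (Rabs (y - INR i)) 2 is left _ then 1 else 0) 0 M <= 5 /\
  (INR M <= y - 3 -> sum_n_m (fun i => if Rlt_dec (Rabs (y - INR i)) 2 is left _ then 1 else 0) 0 M <= 0) /\
  (y - 3 <= INR M -> sum_n_m (fun i => if Rlt_dec (Rabs (y - INR i)) 2 is left _ then 1 else 0) 0 M <= INR M - y + 3)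
  by case.
elim: M => [|M [h1 [h2 h3]]].
  rewrite sum_n_n /= Rminus_0_r; case: Rlt_dec => h.
    by move/Rabs_def2: h; lra.
  by split; [lra | split; lra].
rewrite sum_R_Sm; last lia.
move: h1 h2 h3; set s := sum_n_m _ 0 M => h1 h2 h3; rewrite S_INR.
case: Rlt_dec => h.
  move/Rabs_def2: h => h.
  by have := h3 ltac:(lra); lra.
case: (Rle_dec (INR M) (y - 3)) => h4.
  by have := h2 h4; lra.
have : ~ (INR M < y + 1) by move=> h5; apply: h; apply: Rabs_def1; lra.
have := h3 ltac:(lra); lra.
Qed.

(** * Periodic splines on the contour *)

Lemma Series_two (a : nat -> R) : (forall l, (2 <= l)%nat -> a l = 0) ->
  Series a = a 0%nat + a 1%nat.
Proof.
move=> H; apply: is_series_unique.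
have E n : (1 <= n)%nat -> sum_n a n = a 0%nat + a 1%nat.
  elim: n => [|[|n] IH] hn; first lia.
    by rewrite sum_Sn sum_O.
  rewrite sum_Sn IH ?(H (S (S n))); try lia; exact: Rplus_0_r.
apply: (filterlim_ext_loc (fun _ => a 0%nat + a 1%nat)).
  by exists 1%nat => n hn; rewrite E.
exact: filterlim_const.
Qed.

Lemma sumZ_three (a : Z -> R) : (forall l, (Z.abs l >= 2)%Z -> a l = 0) ->
  sumZ a = a (-1)%Z + a 0%Z + a 1%Z.
Proof.
move=> H; rewrite /sumZ Series_two; last by move=> l hl; apply: H; lia.
rewrite Series_two; last by move=> l hl; apply: H; lia.
rewrite (H (- Z.of_nat 2)%Z); last by rewrite /=; lia.
rewrite /=; ring.
Qed.

Section Spline.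
Variables (g : R -> C) (m n : nat) (rho : R).
Hypotheses (hn : (4 <= n)%nat) (hrho : 0 <= rho < mesh n).

Let h := mesh n.
Let N := bspline m.

(* One period of coefficients, repeated three times, suffices to evaluate the
   periodized splines on [0, 2 pi] by a single cardinal sum. *)
Definition spline_index (i : nat) : nat := S (i mod n).
Definition cardinal_spline (c : nat -> C) (y : R) : C :=
  sum_n_m (fun i => c (spline_index i) * RtoC (bspline m (y - INR i)))%C 0 (3 * n - 1).
(** The shift by [n] places a parameter of [[0, 2 * PI]] around the middle copy of the coefficients,
    at distance at least 2 from both ends of the sum, where the partition of unity holds. *)
Definition spline_arg (x : R) : R := (x - rho) / mesh n + INR n.
Definition spline_sum (c : nat -> C) (t : C) : C :=
  sum_n_m (fun j => c j * RtoC (periodic_bspline g m n rho j t))%C 1 n.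

Lemma nodes_pos : 0 < INR n.
Proof. apply: lt_0_INR; lia. Qed.

Lemma nodes_ge4 : 4 <= INR n.
Proof. by have := le_INR _ _ hn; rewrite /=; lra. Qed.

Lemma mesh_pos : 0 < h.
Proof. have := PI_RGT_0; have := nodes_pos => *; apply: Rdiv_lt_0_compat; lra. Qed.

Lemma mesh_total : h * INR n = 2 * PI.
Proof. rewrite /h /mesh; field; have := nodes_pos; lra. Qed.

Lemma last_index : INR (3 * n - 1) = 3 * INR n - 1.
Proof. rewrite minus_INR; last lia; rewrite mult_INR /=; lra. Qed.

Lemma spline_arg_range x : 0 <= x <= 2 * PI -> INR n - 1 < spline_arg x <= 2 * INR n.
Proof.
move=> hx; have hh := mesh_pos; have ht := mesh_total; have hr := hrho.
rewrite /spline_arg -/h.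
have e : (x - rho) / h * h = x - rho by field; lra.
move: hr; rewrite -/h => hr.
set q := _ / h in e *; split; nra.
Qed.

Lemma spline_arg_unity x : 0 <= x <= 2 * PI -> 2 <= spline_arg x <= INR (3 * n - 1) - 2.
Proof. move=> /spline_arg_range; rewrite last_index; have := nodes_ge4; lra. Qed.

Lemma spline_arg_minus x i : spline_arg x - INR i = (x - (rho + (INR i - INR n) * h)) / h.
Proof. rewrite /spline_arg -/h; field; have := mesh_pos; lra. Qed.

Lemma spline_index_range i : (1 <= spline_index i <= n)%nat.
Proof. rewrite /spline_index; have := Nat.mod_upper_bound i n; lia. Qed.

Lemma spline_index_node (i : nat) : exists l : Z,
  rho + (INR i - INR n) * h = node n rho (spline_index i) + 2 * PI * IZR l.
Proof.
exists (Z.of_nat (i / n) - 1)%Z.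
have e : INR i = INR n * INR (i / n) + INR (i mod n).
  by rewrite -mult_INR -plus_INR; congr INR; apply: Nat.div_mod_eq.
rewrite /node /spline_index Nat.sub_succ Nat.sub_0_r minus_IZR -INR_IZR_INZ -/h -mesh_total e; ring.
Qed.

Lemma node_range i : (1 <= i <= n)%nat -> 0 <= node n rho i < 2 * PI.
Proof.
move=> hi; rewrite /node -/h -mesh_total; have := mesh_pos; have := pos_INR (i - 1).
have : INR (i - 1) <= INR n - 1 by rewrite minus_INR /=; [apply: Rplus_le_compat_r; apply: le_INR; lia | lia].
move: hrho; rewrite -/h; nra.
Qed.

Lemma spline_index_add i : spline_index (i + n) = spline_index i.
Proof. rewrite /spline_index; congr S; rewrite -{1}(Nat.mul_1_l n); apply: Nat.Div0.mod_add. Qed.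

Lemma near_grid_point x i : Rabs (spline_arg x - INR i) < 2 ->
  Rabs (x - (rho + (INR i - INR n) * h)) < 2 * h.
Proof.
have hh := mesh_pos; rewrite spline_arg_minus Rabs_div; last lra.
rewrite (Rabs_right h); last lra.
by move=> hi; apply/(Rlt_div_l _ _ _ hh).
Qed.

Hypotheses (hg : contour g) (hm : m = 2%nat \/ m = 3%nat \/ m = 4%nat).

Lemma low_order_support z : 2 <= Rabs z -> N z = 0.
Proof.
move=> hz; case: hm => [e|[e|e]]; rewrite /N e; apply: bspline_support;
  rewrite /=; lra.
Qed.

Lemma low_order_ge0 z : 0 <= N z.
Proof. case: hm => [e|[e|e]]; rewrite /N e; exact: bspline_ge0. Qed.

Lemma low_order_lipschitz : exists L, 0 < L /\ forall x y, Rabs (N x - N y) <= L * Rabs (x - y).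
Proof. case: hm => [e|[e|e]]; rewrite /N e; exact: bspline_lipschitz. Qed.

Lemma low_order_unity M y : 2 <= y <= INR M - 2 -> sum_n_m (fun i => N (y - INR i)) 0 M = 1.
Proof.
move=> hy; case: hm => [e|[e|e]]; rewrite /N e; apply: bspline_unity;
  rewrite /=; lra.
Qed.

(** Only the shifts -1, 0 and 1 can meet the support: the argument lies strictly between [- INR n]
    and [INR n], and any further shift takes it to a distance above [n >= 4]. These three match the
    three copies of the coefficients. *)
Lemma periodic_bspline_cardinal x j : 0 <= x < 2 * PI -> (1 <= j <= n)%nat ->
  periodic_bspline g m n rho j (g x) =
  N (spline_arg x - INR (j - 1)) + N (spline_arg x - INR (j - 1 + n))
  + N (spline_arg x - INR (j - 1 + n + n)).
Proof.
move=> hx hj; have hh := mesh_pos; have ht := mesh_total; have h4 := nodes_ge4.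
have hnode := node_range j hj.
rewrite /periodic_bspline (param_curve g hg x hx) -/h -/N.
have hq : - INR n < (x - node n rho j) / h < INR n.
  split; [apply/Rlt_div_r | apply/Rlt_div_l] => //; nra.
rewrite sumZ_three; last first.
  move=> l hl; apply: low_order_support.
  have [hl'|hl'] : (2 <= l \/ l <= -2)%Z by lia.
  - have := IZR_le _ _ hl' => hl2.
    by rewrite Rabs_left; nra.
  - have := IZR_le _ _ hl' => hl2.
    by rewrite Rabs_right; nra.
have e : (x - node n rho j) / h = spline_arg x - INR (j - 1) - INR n.
  by rewrite spline_arg_minus /node -/h; field; lra.
rewrite e !plus_INR.
have -> : spline_arg x - INR (j - 1) - INR n - -1 * INR n = spline_arg x - INR (j - 1) by ring.
have -> : spline_arg x - INR (j - 1) - INR n - 0 * INR n = spline_arg x - (INR (j - 1) + INR n) by ring.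
by have -> : spline_arg x - INR (j - 1) - INR n - 1 * INR n = spline_arg x - (INR (j - 1) + INR n + INR n) by ring.
Qed.

Lemma spline_sum_cardinal_open c x : 0 <= x < 2 * PI ->
  spline_sum c (g x) = cardinal_spline c (spline_arg x).
Proof.
move=> hx; rewrite /spline_sum /cardinal_spline.
pose b i := (c (spline_index i) * RtoC (N (spline_arg x - INR i)))%C.
rewrite -/N -/b (sum_C_ext _ (fun j => b (j - 1)%nat + b (j - 1 + n)%nat + b (j - 1 + n + n)%nat)%C); last first.
  move=> j hj; rewrite periodic_bspline_cardinal // /b !spline_index_add.
  have -> : spline_index (j - 1) = j by rewrite /spline_index Nat.mod_small; lia.
  rewrite !RtoC_plus; ring.
have sh F : sum_n_m (fun j => F (j - 1)%nat) 1 n = sum_n_m F 0 (n - 1) :> C.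
  rewrite -[in LHS](Nat.sub_add 1 n); last lia.
  rewrite -(sum_C_shift (fun j => F (j - 1)%nat) 1 0); apply: sum_C_ext => i _.
  by congr F; lia.
rewrite (sh (fun i => b i + b (i + n)%nat + b (i + n + n)%nat)%C).
rewrite !sum_C_plus (sum_C_shift b n) (sum_C_ext (fun i => b (i + n + n)%nat) (fun i => b (i + (n + n))%nat)); last first.
  by move=> i _; congr b; lia.
rewrite (sum_C_shift b (n + n)).
rewrite [RHS](sum_C_split b 0 (n - 1)); [| lia | lia].
rewrite (sum_C_split b (S (n - 1)) (n - 1 + n)); [| lia | lia].
rewrite (_ : (0 + n = S (n - 1))%nat); last lia.
rewrite (_ : (0 + (n + n) = S (n - 1 + n))%nat); last lia.
rewrite (_ : (n - 1 + (n + n) = 3 * n - 1)%nat); last lia.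
carrier_ring.
Qed.

(** [param] has returned to 0 at [2 * PI], so the closed end of the interval needs periodicity:
    shifting by [n] turns one sum into the other, up to an outer copy whose splines vanish there. *)
Lemma cardinal_spline_period c : cardinal_spline c (spline_arg (2 * PI)) = cardinal_spline c (spline_arg 0).
Proof.
have hp := PI_RGT_0; have h4 := nodes_ge4.
have r0 := spline_arg_range 0 ltac:(lra).
have e : spline_arg (2 * PI) = spline_arg 0 + INR n.
  by rewrite /spline_arg -mesh_total -/h; field; have := mesh_pos; lra.
have r1 := spline_arg_range (2 * PI) ltac:(lra); rewrite e in r1.
rewrite e /cardinal_spline -/N; move: (spline_arg 0) r0 r1 => y r0 r1.
rewrite (sum_C_split _ 0 (n - 1)); [| lia | lia].
rewrite (sum_C_zero _ 0); last first.
  move=> i hi; rewrite low_order_support; first ring.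
  have := le_INR _ _ (proj2 hi); rewrite minus_INR /=; last lia.
  by move=> hi'; rewrite Rabs_right; lra.
rewrite [RHS](sum_C_split _ 0 (n + n - 1)); [| lia | lia].
rewrite (sum_C_zero _ (S (n + n - 1))); last first.
  move=> i hi; rewrite low_order_support; first ring.
  have hi' : INR (n + n) <= INR i by apply: le_INR; lia.
  by rewrite plus_INR in hi'; rewrite Rabs_left; lra.
rewrite (_ : S (n - 1) = (0 + n)%nat); last lia.
rewrite (_ : (3 * n - 1)%nat = (n + n - 1 + n)%nat); last lia.
rewrite -(sum_C_shift (fun i => c (spline_index i) * RtoC (N (y + INR n - INR i)))%C).
rewrite (sum_C_ext _ (fun i => c (spline_index i) * RtoC (N (y - INR i)))%C); first carrier_ring.
move=> i _; rewrite spline_index_add plus_INR; congr (_ * RtoC (N _))%C; ring.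
Qed.

Lemma spline_sum_cardinal c x : 0 <= x <= 2 * PI ->
  spline_sum c (g x) = cardinal_spline c (spline_arg x).
Proof.
move=> hx; have hp := PI_RGT_0.
case: (Req_dec x (2 * PI)) => [->|ne]; last by apply: spline_sum_cardinal_open; lra.
rewrite cardinal_spline_period -spline_sum_cardinal_open; last lra.
by congr spline_sum; rewrite -(curve_periodic g hg 0); congr g; ring.
Qed.

Lemma cardinal_spline_minus c w y : 2 <= y <= INR (3 * n - 1) - 2 ->
  (cardinal_spline c y - w
   = sum_n_m (fun i => (c (spline_index i) - w) * RtoC (N (y - INR i)))%C 0 (3 * n - 1))%C.
Proof.
move=> hy; have u := low_order_unity _ y hy.
rewrite (sum_C_ext _ (fun i => c (spline_index i) * RtoC (N (y - INR i)) - w * RtoC (N (y - INR i)))%C);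
  last by move=> i _; carrier_ring.
by rewrite sum_C_minus sum_C_mult_l RtoC_sum u /cardinal_spline -/N; ring.
Qed.

Lemma cardinal_spline_near c w B y : 2 <= y <= INR (3 * n - 1) - 2 ->
  (forall i, Rabs (y - INR i) < 2 -> Cmod (c (spline_index i) - w)%C <= B) ->
  Cmod (cardinal_spline c y - w)%C <= B.
Proof.
move=> hy H; rewrite cardinal_spline_minus //.
have u := low_order_unity _ y hy.
apply: Rle_trans (Cmod_sum_le _ (fun i => B * N (y - INR i)) _ _ _) _; last first.
  by rewrite sum_R_mult_l u; right; ring.
move=> i _; rewrite Cmod_mult Cmod_R Rabs_right; last exact/Rle_ge/low_order_ge0.
case: (Rlt_dec (Rabs (y - INR i)) 2) => hi; last by rewrite low_order_support; lra.
by apply: Rmult_le_compat_r; [exact: low_order_ge0 | exact: H].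
Qed.

(** Subtracting [w] leaves the increment unchanged, so only the deviation [B] of the active
    coefficients matters. [window_count] allows 5 active indices at each of [y] and [y'], hence the
    10. *)
Lemma cardinal_spline_increment L c w B y y' : 0 < L ->
  (forall x y, Rabs (N x - N y) <= L * Rabs (x - y)) ->
  2 <= y <= INR (3 * n - 1) - 2 -> 2 <= y' <= INR (3 * n - 1) - 2 ->
  0 <= B ->
  (forall i, Rabs (y - INR i) < 2 \/ Rabs (y' - INR i) < 2 -> Cmod (c (spline_index i) - w)%C <= B) ->
  Cmod (cardinal_spline c y' - cardinal_spline c y)%C <= 10 * L * B * Rabs (y' - y).
Proof.
move=> hL HL hy hy' hB H.
have -> : (cardinal_spline c y' - cardinal_spline c y
  = (cardinal_spline c y' - w) - (cardinal_spline c y - w))%C by ring.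
rewrite !cardinal_spline_minus // -sum_C_minus.
pose chi z i : R := if Rlt_dec (Rabs (z - INR i)) 2 is left _ then 1 else 0.
have pd := Rabs_pos (y' - y).
have pK : 0 <= B * (L * Rabs (y' - y)) by apply: Rmult_le_pos => //; apply: Rmult_le_pos; lra.
apply: Rle_trans (Cmod_sum_le _ (fun i => B * (L * Rabs (y' - y)) * (chi y i + chi y' i)) _ _ _) _; last first.
  rewrite sum_R_mult_l sum_R_plus.
  have := window_count y (3 * n - 1); have := window_count y' (3 * n - 1).
  rewrite -/(chi y) -/(chi y') => h1 h2.
  apply: Rle_trans (Rmult_le_compat_l _ _ _ pK (Rplus_le_compat _ _ _ _ h2 h1)) _.
  by right; ring.
move=> i _.
have -> : ((c (spline_index i) - w) * RtoC (N (y' - INR i)) - (c (spline_index i) - w) * RtoC (N (y - INR i))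
  = (c (spline_index i) - w) * RtoC (N (y' - INR i) - N (y - INR i)))%C by rewrite RtoC_minus; ring.
rewrite Cmod_mult Cmod_R.
have hNL := HL (y' - INR i) (y - INR i).
rewrite (_ : y' - INR i - (y - INR i) = y' - y) in hNL; last ring.
case: (classic (Rabs (y - INR i) < 2 \/ Rabs (y' - INR i) < 2)) => hi.
  apply: Rle_trans (_ : B * (L * Rabs (y' - y)) * 1 <= _).
    by rewrite Rmult_1_r; apply: Rmult_le_compat; [exact: Cmod_ge_0 | exact: Rabs_pos | exact: H |].
  apply: Rmult_le_compat_l => //; rewrite /chi.
  by case: hi => hi; case: Rlt_dec => a; case: Rlt_dec => b; lra.
rewrite !low_order_support; try by apply: Rnot_lt_le => a; apply: hi; tauto.
rewrite Rminus_0_r Rabs_R0 Rmult_0_r; apply: Rmult_le_pos => //.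
by rewrite /chi; case: Rlt_dec => a; case: Rlt_dec => b; lra.
Qed.

(* Diagonal dominance: at its own node a spline has weight at least 2/3, so the
   other weights sum to at most 1/3. *)
Lemma coefficient_bound c r : (forall i, (1 <= i <= n)%nat -> Cmod (spline_sum c (g (node n rho i))) <= r) ->
  forall j, (1 <= j <= n)%nat -> Cmod (c j) <= 3 * r.
Proof.
move=> H; have hh := mesh_pos; have h4 := nodes_ge4.
have [j0 [hj0 Hmax]] := argmax_Cmod c n ltac:(lia).
set s := Cmod (c j0) in Hmax.
suff hs : s <= 3 * r by move=> j hj; have := Hmax j hj; lra.
have hnode := node_range j0 hj0.
have := H j0 hj0; rewrite spline_sum_cardinal; last lra.
have uarg := spline_arg_unity (node n rho j0) ltac:(lra).
have earg : spline_arg (node n rho j0) = INR (j0 - 1 + n).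
  by rewrite /spline_arg /node -/h plus_INR; field; lra.
rewrite earg in uarg *; set p := (j0 - 1 + n)%nat in uarg *.
have ip : spline_index p = j0 by rewrite /p spline_index_add /spline_index Nat.mod_small; lia.
have u := low_order_unity _ _ uarg.
have hc : 2 / 3 <= N 0 := bspline_center m hm.
have s0 : 0 <= s by exact: Cmod_ge_0.
(* The other coefficients differ from [c j0] by at most [2 * s] and carry total weight [1 - N 0];
   with [N 0 >= 2 / 3] this leaves [s / 3 <= r]. *)
suff hd : Cmod (cardinal_spline c (INR p) - c j0)%C <= 2 * s - 2 * s * N 0.
  move=> hr; have := Cmod_le_minus (c j0) (cardinal_spline c (INR p)).
  rewrite Cmod_minus_sym -/s; nra.
rewrite cardinal_spline_minus //.
pose w i : R := if Nat.eqb i p then 2 * s * N 0 else 0.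
apply: Rle_trans (Cmod_sum_le _ (fun i => 2 * s * N (INR p - INR i) + (-1) * w i) _ _ _) _.
  move=> i _; rewrite Cmod_mult Cmod_R Rabs_right; last exact/Rle_ge/low_order_ge0.
  rewrite /w; case: Nat.eqb_spec => [->|ne].
    by rewrite ip Cminus_diag Cmod_0 Rminus_diag; lra.
  rewrite Rmult_0_r Rplus_0_r; apply: Rmult_le_compat_r; first exact: low_order_ge0.
  have := Cmod_minus_le (c (spline_index i)) (c j0).
  have := Hmax _ (spline_index_range i); rewrite -/s; lra.
rewrite sum_R_plus !sum_R_mult_l u.
have -> : sum_n_m w 0 (3 * n - 1) = 2 * s * N 0; last by right; ring.
apply: RtoC_inj; rewrite -RtoC_sum (sum_C_single _ _ _ p).
- by rewrite /w Nat.eqb_refl.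
- by rewrite /p; lia.
- by move=> i _ ne; rewrite /w; have -> : Nat.eqb i p = false by apply/Nat.eqb_neq.
Qed.

(* For [B = 0] the spline is the Schoenberg quasi-interpolant of [W]. *)
Lemma spline_error L al A B c (W : R -> C) : 0 < L ->
  (forall x y, Rabs (N x - N y) <= L * Rabs (x - y)) ->
  0 < al -> 0 <= A -> 0 <= B -> periodic W -> holder A al W ->
  (forall j, (1 <= j <= n)%nat -> Cmod (c j - W (node n rho j))%C <= B) ->
  (forall x, 0 <= x <= 2 * PI -> Cmod (spline_sum c (g x) - W x)%C <= B + A * Rpower (2 * h) al) /\
  (forall x y, 0 <= x -> x < y -> y <= 2 * PI -> y - x <= h ->
     Cmod (spline_sum c (g y) - spline_sum c (g x))%C
     <= 10 * L * (B + A * Rpower (3 * h) al) * ((y - x) / h)).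
Proof.
move=> hL HL hal hA hB hper hW hc; have hh := mesh_pos.
(* A coefficient is compared with [W x] through its own node. The radius [r] is [2 * h] for splines
   active at [x], and [3 * h] when they may instead be active at a point [y] up to [h] away. *)
have key x r i : 0 < r -> Rabs (x - (rho + (INR i - INR n) * h)) <= r ->
    Cmod (c (spline_index i) - W x)%C <= B + A * Rpower r al.
  move=> hr hx; have [l el] := spline_index_node i.
  apply: Rle_trans (Cmod_minus_triangle _ (W (node n rho (spline_index i))) _) _.
  apply: Rplus_le_compat; first by apply: hc; exact: spline_index_range.
  have <- : W (rho + (INR i - INR n) * h) = W (node n rho (spline_index i)).
    by rewrite el periodic_IZR.
  move: hx; set z := rho + _ => hx.
  have pr := Rpower_pos r al.
  case: (Rtotal_order x z) => [hlt|[->|hlt]].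
  - apply: Rle_trans (hW _ _ hlt) _; apply: Rmult_le_compat_l => //.
    by apply: Rpower_le_l; [lra | move: hx; rewrite Rabs_left; lra].
  - by rewrite Cminus_diag Cmod_0; apply: Rmult_le_pos; lra.
  - rewrite Cmod_minus_sym; apply: Rle_trans (hW _ _ hlt) _; apply: Rmult_le_compat_l => //.
    by apply: Rpower_le_l; [lra | move: hx; rewrite Rabs_right; lra].
split.
- move=> x hx; rewrite spline_sum_cardinal //.
  apply: cardinal_spline_near; first exact: spline_arg_unity.
  move=> i /near_grid_point hi; apply: key; lra.
- move=> x y hx hxy hy hd; rewrite !spline_sum_cardinal; try lra.
  have earg : spline_arg y - spline_arg x = (y - x) / h by rewrite /spline_arg -/h; field; lra.
  have pq : 0 <= (y - x) / h by apply: Rdiv_le_0_compat; lra.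
  have := cardinal_spline_increment L c (W x) (B + A * Rpower (3 * h) al) (spline_arg x) (spline_arg y) hL HL.
  rewrite earg (Rabs_right ((y - x) / h)); last lra.
  apply.
  + by apply: spline_arg_unity; lra.
  + by apply: spline_arg_unity; lra.
  + by apply: Rplus_le_le_0_compat => //; apply: Rmult_le_pos => //; exact/Rlt_le/Rpower_pos.
  + move=> i [] /near_grid_point hi; apply: key; try lra.
    have := Rabs_triang (x - y) (y - (rho + (INR i - INR n) * h)).
    rewrite (_ : x - y + (y - (rho + (INR i - INR n) * h)) = x - (rho + (INR i - INR n) * h)); last ring.
    rewrite (Rabs_left (x - y)); lra.
Qed.

Lemma spline_sum_holder c : exists A, 0 <= A /\ holder A 1 (fun x => spline_sum c (g x)).
Proof.
have hh := mesh_pos; have [L [hL HL]] := low_order_lipschitz.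
have [j0 [hj0 Hmax]] := argmax_Cmod c n ltac:(lia).
have p0 := Cmod_ge_0 (c j0); have ih := Rinv_0_lt_compat _ hh.
have pA : 0 <= 10 * L * Cmod (c j0) * / h by repeat apply: Rmult_le_pos; lra.
exists (2 * (10 * L * Cmod (c j0) * / h)); split; first lra.
apply: (holder_periodic 0); [lra | exact: pA | by move=> x; rewrite (curve_periodic g hg) |].
move=> x y hx hxy hy; rewrite !spline_sum_cardinal; try lra.
rewrite Rpower_1; last lra.
apply: Rle_trans (cardinal_spline_increment L c 0 (Cmod (c j0)) (spline_arg x) (spline_arg y) hL HL _ _ _ _) _.
- by apply: spline_arg_unity; lra.
- by apply: spline_arg_unity; lra.
- by [].
- move=> i _; have -> : (c (spline_index i) - 0 = c (spline_index i))%C by ring.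
  exact: Hmax (spline_index_range i).
- have -> : spline_arg y - spline_arg x = (y - x) * / h by rewrite /spline_arg -/h; field; lra.
  rewrite Rabs_right; first by right; ring.
  by apply/Rle_ge/Rmult_le_pos; lra.
Qed.

Lemma spline_sum_bounded c B : (forall j, (1 <= j <= n)%nat -> Cmod (c j) <= B) ->
  curve_bounded g B (spline_sum c).
Proof.
move=> H t ht; have [x [hx <-]] := on_curve_reduce g hg 0 t ht.
rewrite spline_sum_cardinal; last lra.
have -> : cardinal_spline c (spline_arg x) = (cardinal_spline c (spline_arg x) - 0)%C by ring.
apply: cardinal_spline_near; first by apply: spline_arg_unity; lra.
move=> i _; have -> : (c (spline_index i) - 0 = c (spline_index i))%C by ring.
exact: H (spline_index_range i).
Qed.

Lemma spline_sum_integrable c : curve_integrable g (spline_sum c).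
Proof.
have [A [hA H]] := spline_sum_holder c.
apply: curve_integrable_continuous => x; apply: holder_continuous H; lra.
Qed.

End Spline.

(** * Square linear systems *)

Lemma Cdiv_mult_cancel (a b : C) : b <> RtoC 0 -> (a / b * b)%C = a.
Proof. by move=> hb; field. Qed.

(** Gaussian elimination, removing one unknown and one equation at a time. The index [j] numbers the
    [n + 1] unknowns, [i] the [n] equations. *)
Lemma underdetermined_system n (e : nat -> nat -> C) :
  exists c : nat -> C, (exists j, (j <= n)%nat /\ c j <> RtoC 0) /\
    forall i, (i < n)%nat -> sum_n_m (fun j => c j * e j i)%C 0 n = RtoC 0.
Proof.
elim: n e => [|n IH] e.
  exists (fun _ => RtoC 1); split; last by move=> i; lia.
  by exists O; split=> //; exact: C1_nz.
(* With a nonzero pivot the last equation expresses the last unknown, [- s], through the others;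
   substitution leaves a system covered by the induction hypothesis. *)
have pivot (f : nat -> nat -> C) : f (S n) n <> RtoC 0 ->
    exists c : nat -> C, (exists j, (j <= S n)%nat /\ c j <> RtoC 0) /\
    forall i, (i < S n)%nat -> sum_n_m (fun j => c j * f j i)%C 0 (S n) = RtoC 0.
  move=> hp.
  have [c [[j0 [hj0 hc0]] Hc]] := IH (fun j i => f j i - f j n / f (S n) n * f (S n) i)%C.
  pose s := sum_n_m (fun j => c j * (f j n / f (S n) n))%C 0 n.
  pose d j := if Nat.eqb j (S n) then (- s)%C else c j.
  have dc j : (j <= n)%nat -> d j = c j.
    by rewrite /d => h; have -> : Nat.eqb j (S n) = false by apply/Nat.eqb_neq; lia.
  have dS : d (S n) = (- s)%C by rewrite /d Nat.eqb_refl.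
  exists d; split; first by exists j0; split; [lia | rewrite dc].
  move=> i hi; rewrite sum_C_Sm; last lia.
  have -> : sum_n_m (fun j => d j * f j i)%C 0 n
     = (sum_n_m (fun j => c j * (f j i - f j n / f (S n) n * f (S n) i)) 0 n + f (S n) i * s)%C.
    rewrite /s -sum_C_mult_l -sum_C_plus; apply: sum_C_ext => j hj; rewrite dc; last lia.
    carrier_ring.
  rewrite dS; case: (Nat.eq_dec i n) => [->|ne]; last by rewrite Hc; [carrier_ring | lia].
  rewrite (sum_C_zero (fun j => c j * (f j n - f j n / f (S n) n * f (S n) n))%C); first carrier_ring.
  by move=> j _; rewrite Cdiv_mult_cancel //; carrier_ring.
case: (classic (e (S n) n = RtoC 0)) => h0; last exact: pivot.
case: (classic (exists k, (k <= n)%nat /\ e k n <> RtoC 0)) => [[k [hk hek]]|hno].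
(* Adding the coefficients of unknown [k] to those of the last one creates a pivot. A solution is
   carried back by adding [c (S n)] to coordinate [k], and it stays nonzero. *)
- pose f j i := if Nat.eqb j (S n) then (e (S n) i + e k i)%C else e j i.
  have fe j i : (j <= n)%nat -> f j i = e j i.
    by rewrite /f => h; have -> : Nat.eqb j (S n) = false by apply/Nat.eqb_neq; lia.
  have fS i : f (S n) i = (e (S n) i + e k i)%C by rewrite /f Nat.eqb_refl.
  have [|c [[j0 [hj0 hc0]] Hc]] := pivot f.
    by rewrite fS h0; have -> : (0 + e k n = e k n)%C by ring.
  pose d j := (c j + if Nat.eqb j k then c (S n) else 0)%C.
  have dS : d (S n) = c (S n).
    by rewrite /d; have -> : Nat.eqb (S n) k = false; [apply/Nat.eqb_neq; lia | ring].
  exists d; split.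
    case: (classic (c (S n) = RtoC 0)) => hS; last by exists (S n); rewrite dS.
    have e0 : d j0 = c j0 by rewrite /d hS; case: Nat.eqb; ring.
    by exists j0; rewrite e0.
  move=> i hi; rewrite -(Hc i hi) !sum_C_Sm; try lia.
  rewrite dS fS.
  have -> : sum_n_m (fun j => d j * e j i)%C 0 n
     = (sum_n_m (fun j => c j * f j i) 0 n + c (S n) * e k i)%C.
    have <- : sum_n_m (fun j => if Nat.eqb j k then c (S n) * e k i else 0)%C 0 n = (c (S n) * e k i)%C.
      rewrite (sum_C_single _ _ _ k); first by rewrite Nat.eqb_refl.
      - by lia.
      - by move=> j _ ne; have -> : Nat.eqb j k = false by apply/Nat.eqb_neq.
    rewrite -sum_C_plus; apply: sum_C_ext => j hj; rewrite fe; last lia.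
    by rewrite /d; case: Nat.eqb_spec => [->|_]; carrier_ring.
  carrier_ring.
(* All coefficients of the last equation vanish, so the last unknown is set to 0 and the others
   solve the remaining equations. *)
- have [c [[j0 [hj0 hc0]] Hc]] := IH e.
  pose d j := if Nat.eqb j (S n) then RtoC 0 else c j.
  have dc j : (j <= n)%nat -> d j = c j.
    by rewrite /d => h; have -> : Nat.eqb j (S n) = false by apply/Nat.eqb_neq; lia.
  have dS : d (S n) = RtoC 0 by rewrite /d Nat.eqb_refl.
  exists d; split; first by exists j0; split; [lia | rewrite dc].
  move=> i hi; rewrite sum_C_Sm; last lia.
  rewrite dS (sum_C_ext _ (fun j => c j * e j i)%C); last by move=> j hj; rewrite dc //; lia.
  case: (Nat.eq_dec i n) => [->|ne]; last by rewrite Hc; [carrier_ring | lia].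
  rewrite sum_C_zero; first carrier_ring.
  move=> j hj; have -> : e j n = RtoC 0; last by carrier_ring.
  by apply: NNPP => h; apply: hno; exists j; split; [lia |].
Qed.

(** The right-hand side joins as an extra unknown with coefficients [- b]. Injectivity forces its
    coordinate in a nontrivial solution to be nonzero, and dividing by it gives the solution.
    Zero-based unknowns account for the shift [j - 1]. *)
Lemma square_system_solvable n (a : nat -> nat -> C) : (1 <= n)%nat ->
  (forall c : nat -> C,
     (forall i, (1 <= i <= n)%nat -> sum_n_m (fun j => c j * a i j)%C 1 n = RtoC 0) ->
     forall j, (1 <= j <= n)%nat -> c j = RtoC 0) ->
  forall b : nat -> C, exists c : nat -> C,
    forall i, (1 <= i <= n)%nat -> sum_n_m (fun j => c j * a i j)%C 1 n = b i.
Proof.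
move=> hn Hinj b.
pose e j i := if Nat.eqb j n then (- b (S i))%C else a (S i) (S j).
have [c [[j0 [hj0 hc0]] Hc]] := underdetermined_system n e.
have Hsum i : (1 <= i <= n)%nat ->
    sum_n_m (fun j => c (j - 1)%nat * a i j)%C 1 n = (c n * b i)%C.
  move=> hi; have := Hc (i - 1)%nat ltac:(lia).
  rewrite [in X in X -> _](_ : n = S (n - 1)); last lia.
  rewrite sum_C_Sm; last lia.
  rewrite (_ : S (n - 1) = n); last lia.
  have -> : sum_n_m (fun j => c j * e j (i - 1)%nat)%C 0 (n - 1)
     = sum_n_m (fun j => c (j - 1)%nat * a i j)%C 1 n.
    rewrite -[in RHS](Nat.sub_add 1 n); last lia.
    rewrite -(sum_C_shift (fun j => c (j - 1)%nat * a i j)%C 1 0); apply: sum_C_ext => j hj.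
    rewrite /e; have -> : Nat.eqb j n = false by apply/Nat.eqb_neq; lia.
    by congr (c _ * a _ _)%C; lia.
  rewrite /e Nat.eqb_refl (_ : S (i - 1) = i); last lia.
  set s := sum_n_m _ _ _ => h.
  have cancel (x y z : C) : (x + y * - z = 0 -> x = y * z)%C.
    by move=> h'; have -> : x = (x + y * - z + y * z)%C; [ring | rewrite h'; ring].
  exact: cancel.
case: (classic (c n = RtoC 0)) => h0.
- case: hc0; case: (Nat.eq_dec j0 n) => [->|ne] //.
  have := Hinj (fun j => c (j - 1)%nat) _ (S j0) ltac:(lia).
  rewrite Nat.sub_succ Nat.sub_0_r; apply => i hi.
  by rewrite Hsum // h0; carrier_ring.
- exists (fun j => c (j - 1)%nat / c n)%C => i hi.
  rewrite (sum_C_ext _ (fun j => / c n * (c (j - 1)%nat * a i j))%C); last by move=> j _; rewrite /Cdiv; carrier_ring.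
  by rewrite sum_C_mult_l Hsum //; change (/ c n * (c n * b i) = b i)%C; field.
Qed.

(** * Collocation *)

Lemma holder_lower_exponent A s s' F : 0 <= A -> 0 <= s' <= s -> periodic F -> holder A s F ->
  holder (2 * (A * Rpower (2 * PI) (s - s'))) s' F.
Proof.
move=> hA hs hF H.
apply: (holder_periodic 0) => //; first lra.
  by apply: Rmult_le_pos => //; exact/Rlt_le/Rpower_pos.
rewrite -{2}(Rminus_0_r (2 * PI)) Rplus_0_l.
apply: holder_on_exponent => //; first lra.
exact: holder_on_holder.
Qed.

Section Collocation.
Variables (g : R -> C) (nd : nat) (thd : nat -> R) (alpha beta mu : R).
Variables (k : C -> C -> C) (lam : C) (m : nat).
Hypotheses (hg : contour g) (hthd : jump_parameters nd thd).
Hypotheses (hbeta : 0 < beta) (hba : beta < alpha) (ham : alpha < mu) (hmu : mu <= 1).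
Hypothesis hk : kernel_regular g mu k.
Hypothesis hker : forall v : C -> C, PH g nd thd beta v ->
     (forall t, on_curve g t -> id_minus g k lam v t = RtoC 0) ->
     forall t, on_curve g t -> v t = RtoC 0.
Hypothesis hm : m = 2%nat \/ m = 3%nat \/ m = 4%nat.

Let hmu0 : 0 < mu.
Proof. lra. Qed.

(** Turns the kernel hypothesis on [PH] into the form that [inverse_bound] uses: the limit functions
    there are [mu]-Hoelder, hence also [beta]-Hoelder. *)
Lemma holder_kernel_trivial A v : 0 <= A -> holder A mu (fun x => v (g x)) ->
  (forall t, on_curve g t -> id_minus g k lam v t = RtoC 0) ->
  forall t, on_curve g t -> v t = RtoC 0.
Proof.
move=> hA hv; apply: hker.
have [c [_ H]] := PH_of_holder g nd thd hg hthd beta hbeta.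
have hper : periodic (fun x => v (g x)) by move=> x; rewrite (curve_periodic g hg).
have hv' := holder_lower_exponent A mu beta _ hA ltac:(lra) hper hv.
have hcont x : continuous (fun y => v (g y)) x by exact: (holder_continuous A mu).
have [|B [_ HB]] := continuous_bounded (fun x => v (g x)) 0 (2 * PI) _ hcont.
  have := PI_RGT_0; lra.
have hb : curve_bounded g B v.
  move=> t ht; have [x [hx <-]] := on_curve_reduce g hg 0 t ht; apply: HB; lra.
apply: (proj1 (H _ B v _ hv' hb)).
have := Rpower_pos (2 * PI) (mu - beta) => hp.
by have := Rmult_le_pos _ _ hA (Rlt_le _ _ hp); lra.
Qed.

Lemma id_minus_bound : exists M, 0 < M /\ forall V v, 0 <= V ->
  curve_integrable g v -> curve_bounded g V v ->
  curve_bounded g (M * V) (id_minus g k lam v).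
Proof.
have [M [hM H]] := int_op_bounds g k mu hg hmu0 hk.
have pl := Cmod_ge_0 lam.
have plM : 0 <= Cmod lam * M by apply: Rmult_le_pos; lra.
exists (1 + Cmod lam * M); split; first lra.
move=> V v hV hv hvb t ht.
have [h _] := H V v hV hv hvb.
apply: Rle_trans (Cmod_minus_le _ _) _; rewrite Cmod_mult.
have := hvb t ht; have := Rmult_le_compat_l _ _ _ pl (h t ht); lra.
Qed.

Lemma id_minus_minus v v' t : curve_integrable g v -> curve_integrable g v' ->
  on_curve g t ->
  id_minus g k lam (fun t => v t - v' t)%C t = (id_minus g k lam v t - id_minus g k lam v' t)%C.
Proof.
move=> hv hv' ht; rewrite /id_minus (int_op_minus g k mu) //; ring.
Qed.

Lemma id_minus_sum (a : nat -> C) (w : nat -> C -> C) n t : (1 <= n)%nat ->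
  (forall j, (1 <= j <= n)%nat -> curve_integrable g (w j)) -> on_curve g t ->
  id_minus g k lam (fun t => sum_n_m (fun j => a j * w j t)%C 1 n) t
  = sum_n_m (fun j => a j * id_minus g k lam (w j) t)%C 1 n.
Proof.
move=> hn Hw ht.
suff H : int_op g k (fun t => sum_n_m (fun j => a j * w j t)%C 1 n) t
  = sum_n_m (fun j => a j * int_op g k (w j) t)%C 1 n.
  rewrite /id_minus H -sum_C_mult_l -sum_C_minus; apply: sum_C_ext => j _; carrier_ring.
elim: n hn Hw => [|[|n] IH] hn Hw; first lia.
  rewrite sum_n_n -(int_op_scal g k mu) //; last by apply: Hw; lia.
  by apply: int_op_ext => s _; rewrite sum_n_n.
rewrite sum_C_Sm; last lia.
rewrite -IH; [| lia | by move=> j hj; apply: Hw; lia].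
rewrite -(int_op_scal g k mu) //; last by apply: Hw; lia.
rewrite -(int_op_plus g k mu) //.
- by apply: int_op_ext => s _; rewrite sum_C_Sm; last lia.
- by apply: curve_integrable_sum => j hj; apply: Hw; lia.
- by apply: curve_integrable_scal; apply: Hw; lia.
Qed.

(* [D - Q (lam K D)], with [Q] the Schoenberg quasi-interpolant, is a spline whose node
   values are the residuals up to [O(h ^ mu)]; hence [D - lam K D] is as small on the
   whole curve, and the sup-norm inverse bound applies to [D]. *)
Lemma collocation_stability : exists S h0, 0 < S /\ 0 < h0 /\
  forall n rho c r, (4 <= n)%nat -> 0 <= rho < mesh n -> mesh n < h0 ->
    (forall i, (1 <= i <= n)%nat ->
       Cmod (id_minus g k lam (spline_sum g m n rho c) (g (node n rho i))) <= r) ->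
    forall j, (1 <= j <= n)%nat -> Cmod (c j) <= S * r.
Proof.
have [C0 [hC0 Hinv]] := inverse_bound g k mu lam hg hmu0 hk holder_kernel_trivial.
have [M [hM HM]] := int_op_bounds g k mu hg hmu0 hk.
have [L [hL HL]] := low_order_lipschitz m hm.
have pl := Cmod_ge_0 lam.
have plM : 0 <= Cmod lam * M by apply: Rmult_le_pos; lra.
(* The estimate below ends in [s <= 9 * C0 * r + 12 * C0 * q]; this threshold makes the last term at
   most [s / 2], whence the 18. It is applied to [2 * mesh n], hence [d / 2]. *)
have [|d [hd Hd]] := Rpower_small (12 * C0 * (Cmod lam * M)) mu (1 / 2) _ hmu0 ltac:(lra).
  by apply: Rmult_le_pos => //; lra.
exists (18 * C0), (d / 2); split; first lra; split; first lra.
move=> n rho c r hn hrho hh Hr.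
have ph := mesh_pos n hn.
have [j0 [hj0 Hmax]] := argmax_Cmod c n ltac:(lia).
set s := Cmod (c j0) in Hmax.
suff hs : s <= 18 * C0 * r by move=> j hj; have := Hmax j hj; lra.
have s0 : 0 <= s by exact: Cmod_ge_0.
have r0 : 0 <= r by apply: Rle_trans (Hr 1%nat ltac:(lia)); exact: Cmod_ge_0.
pose D := spline_sum g m n rho c.
have Dint : curve_integrable g D := spline_sum_integrable g m n rho hn hrho hg hm c.
have Db : curve_bounded g s D := spline_sum_bounded g m n rho hn hrho hg hm c s Hmax.
have [_ KD] := HM s D s0 Dint Db.
pose Z x := (lam * int_op g k D (g x))%C.
have hZ : holder (Cmod lam * (M * s)) mu Z.
  move=> x y hxy; rewrite /Z.
  have -> : (lam * int_op g k D (g y) - lam * int_op g k D (g x)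
    = lam * (int_op g k D (g y) - int_op g k D (g x)))%C by ring.
  rewrite Cmod_mult Rmult_assoc; apply: Rmult_le_compat_l => //; exact: KD.
have Zper : periodic Z by move=> x; rewrite /Z (curve_periodic g hg).
have pA : 0 <= Cmod lam * (M * s) by apply: Rmult_le_pos => //; apply: Rmult_le_pos; lra.
set A := Cmod lam * (M * s) in hZ pA.
set q := A * Rpower (2 * mesh n) mu.
have q0 : 0 <= q by apply: Rmult_le_pos => //; exact/Rlt_le/Rpower_pos.
pose z j := Z (node n rho j).
have [HV _] := spline_error g m n rho hn hrho hg hm L mu A 0 z Z hL HL hmu0 pA ltac:(lra) Zper hZ
  (fun j _ => ltac:(rewrite Cminus_diag Cmod_0; lra)).
(* At a node, [D - Q Z] is the residual plus [Z - Q Z], so at most [r + q]; diagonal dominance gives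
   the factor 3. *)
have Hc j : (1 <= j <= n)%nat -> Cmod (c j - z j)%C <= 3 * (r + q).
  move: j; apply: (coefficient_bound g m n rho hn hrho hg hm (fun j => c j - z j)%C) => i hi.
  have hnode := node_range n rho hn hrho i hi.
  have -> : spline_sum g m n rho (fun j => c j - z j)%C (g (node n rho i))
    = (D (g (node n rho i)) - spline_sum g m n rho z (g (node n rho i)))%C.
    rewrite /D /spline_sum -sum_C_minus; apply: sum_C_ext => j _; carrier_ring.
  apply: Rle_trans (Cmod_minus_triangle _ (Z (node n rho i)) _) _.
  apply: Rplus_le_compat; first exact: Hr.
  rewrite Cmod_minus_sym; have := HV (node n rho i) ltac:(lra); rewrite -/q; lra.
(* The coefficients of [D] are within [3 * (r + q)] of the node values of [Z], and [spline_error]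
   adds one more [q]: the total on the whole curve is [3 * r + 4 * q]. *)
have [HD _] := spline_error g m n rho hn hrho hg hm L mu A (3 * (r + q)) c Z hL HL hmu0 pA
  ltac:(lra) Zper hZ Hc.
have Dres : curve_bounded g (3 * r + 4 * q) (id_minus g k lam D).
  move=> t ht; have [x [hx <-]] := on_curve_reduce g hg 0 t ht.
  by have := HD x ltac:(lra); rewrite -/q /id_minus -/(Z x) -/D; lra.
have Hsup := Hinv D s _ Dint Db Dres.
have := coefficient_bound g m n rho hn hrho hg hm c _
  (fun i _ => Hsup _ (on_curve_param g (node n rho i))) j0 hj0; rewrite -/s => Hs.
have := Hd (2 * mesh n) ltac:(lra) => Hsmall.
have : 12 * C0 * q <= 1 / 2 * s.
  have -> : 12 * C0 * q = 12 * C0 * (Cmod lam * M) * Rpower (2 * mesh n) mu * s by rewrite /q /A; ring.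
  by apply: Rmult_le_compat_r; lra.
lra.
Qed.

(** The equation gives [phi - J_f = f_C + lam K phi]. The inverse bound controls [phi] in the sup
    norm by the norm of [f], and [K] turns this into a Hoelder bound; the [PH] norm of [phi] itself
    stays out of the constant. *)
Lemma solution_holder : exists c, 0 < c /\ forall f phi,
  PH g nd thd alpha f -> PH g nd thd beta phi ->
  (forall t, on_curve g t -> id_minus g k lam phi t = f t) ->
  holder (c * PH_norm g nd thd alpha f) alpha
    (fun x => phi (g x) - jump_part g nd thd f (g x))%C.
Proof.
have [C0 [hC0 Hinv]] := inverse_bound g k mu lam hg hmu0 hk holder_kernel_trivial.
have [M [hM HM]] := int_op_bounds g k mu hg hmu0 hk.
have [c1 [hc1 H1]] := cont_part_holder g nd thd hg hthd alpha ltac:(lra).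
have pl := Cmod_ge_0 lam; have pp := Rpower_pos (2 * PI) (mu - alpha).
pose c2 := 2 * (M * C0 * Rpower (2 * PI) (mu - alpha)).
have hc2 : 0 < c2.
  by have := Rmult_lt_0_compat _ _ (Rmult_lt_0_compat _ _ hM hC0) pp; rewrite /c2; lra.
have hlc2 : 0 <= Cmod lam * c2 by apply: Rmult_le_pos; lra.
exists (c1 + Cmod lam * c2); split; first lra.
move=> f phi hf hphi Heq; set Nf := PH_norm g nd thd alpha f.
have hN : 0 <= Nf := PH_norm_ge0 g nd thd hthd alpha f hf.
have pint := PH_integrable g nd thd hg hthd beta phi ltac:(lra) hphi.
have pb0 := PH_bounded g nd thd hg hthd beta phi hphi.
have pb : curve_bounded g (C0 * Nf) phi.
  apply: Hinv pint pb0 _ => t ht; rewrite Heq //.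
  exact: (PH_bounded g nd thd hg hthd alpha f hf).
have pCN : 0 <= C0 * Nf by apply: Rmult_le_pos; lra.
have [_ HK] := HM _ phi pCN pint pb.
have HK' := holder_lower_exponent _ mu alpha _ (Rmult_le_pos _ _ (Rlt_le _ _ hM) pCN) ltac:(lra)
  (fun x => f_equal (int_op g k phi) (curve_periodic g hg x)) HK.
move=> x y hxy.
have e z : (phi (g z) - jump_part g nd thd f (g z)
   = cont_part g nd thd f (g z) + lam * int_op g k phi (g z))%C.
  rewrite /cont_part -(Heq (g z)); last by exists z.
  rewrite /id_minus; ring.
rewrite !e.
have -> : (cont_part g nd thd f (g y) + lam * int_op g k phi (g y)
   - (cont_part g nd thd f (g x) + lam * int_op g k phi (g x))
   = (cont_part g nd thd f (g y) - cont_part g nd thd f (g x))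
     + lam * (int_op g k phi (g y) - int_op g k phi (g x)))%C by ring.
apply: Rle_trans (Cmod_triangle _ _) _; rewrite Cmod_mult.
have h1 := H1 f hf x y hxy; have h2 := Rmult_le_compat_l _ _ _ pl (HK' x y hxy).
rewrite -/Nf in h1; rewrite /c2; lra.
Qed.

Lemma periodic_bspline_integrable n rho j : (4 <= n)%nat -> 0 <= rho < mesh n ->
  (1 <= j <= n)%nat -> curve_integrable g (fun t => RtoC (periodic_bspline g m n rho j t)).
Proof.
move=> hn hrho hj.
apply: (curve_integrable_ext g (spline_sum g m n rho (fun i => if Nat.eqb i j then RtoC 1 else RtoC 0))).
  move=> t _; rewrite /spline_sum (sum_C_single _ _ _ j hj); first by rewrite Nat.eqb_refl; carrier_ring.
  by move=> i _ ne; have -> : Nat.eqb i j = false by [apply/Nat.eqb_neq]; ring.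
exact: spline_sum_integrable.
Qed.

Lemma id_minus_ext v v' t : on_curve g t -> (forall s, on_curve g s -> v s = v' s) ->
  id_minus g k lam v t = id_minus g k lam v' t.
Proof. by move=> ht e; rewrite /id_minus e // (int_op_ext g k v v'). Qed.

(** Stability with [r = 0] is injectivity of the square collocation matrix, which yields both
    solvability and uniqueness of the coefficients. *)
Lemma collocation_unisolvent : exists h0, 0 < h0 /\
  forall n rho (b : nat -> C), (4 <= n)%nat -> 0 <= rho < mesh n -> mesh n < h0 ->
    exists c,
      (forall i, (1 <= i <= n)%nat ->
         id_minus g k lam (spline_sum g m n rho c) (g (node n rho i)) = b i) /\
      forall c', (forall i, (1 <= i <= n)%nat ->
         id_minus g k lam (spline_sum g m n rho c') (g (node n rho i)) = b i) ->
      forall j, (1 <= j <= n)%nat -> c' j = c j.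
Proof.
have [S [h0 [hS [hh0 Hstab]]]] := collocation_stability.
exists h0; split=> // n rho b hn hrho hh.
have zero c : (forall i, (1 <= i <= n)%nat ->
    id_minus g k lam (spline_sum g m n rho c) (g (node n rho i)) = RtoC 0) ->
    forall j, (1 <= j <= n)%nat -> c j = RtoC 0.
  move=> Hc j hj; apply: Cmod_eq_0; apply: Rle_antisym; last exact: Cmod_ge_0.
  have := Hstab n rho c 0 hn hrho hh; rewrite Rmult_0_r; apply=> // i hi.
  by rewrite Hc // Cmod_0; right.
pose a i j := id_minus g k lam (fun t => RtoC (periodic_bspline g m n rho j t)) (g (node n rho i)).
have Hlin c i : id_minus g k lam (spline_sum g m n rho c) (g (node n rho i))
    = sum_n_m (fun j => c j * a i j)%C 1 n.
  apply: id_minus_sum; [lia | | exact: on_curve_param].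
  by move=> j hj; apply: periodic_bspline_integrable.
have [||c Hc] := square_system_solvable n a _ _ b; first lia.
  by move=> c Hc; apply: zero => i hi; rewrite Hlin Hc.
exists c; split; first by move=> i hi; rewrite Hlin Hc.
move=> c' Hc' j hj.
have : (c' j - c j)%C = RtoC 0.
  apply: (zero (fun j => c' j - c j)%C) => // i hi.
  rewrite (id_minus_ext _ (fun t => spline_sum g m n rho c' t - spline_sum g m n rho c t)%C).
  - rewrite id_minus_minus ?Hc' ?Hlin ?Hc //; first ring.
    + exact: spline_sum_integrable.
    + exact: spline_sum_integrable.
    + exact: on_curve_param.
  - exact: on_curve_param.
  - move=> t _; rewrite /spline_sum -sum_C_minus; apply: sum_C_ext => l _; carrier_ring.
move=> e; have -> : c' j = (c' j - c j + c j)%C by ring.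
by rewrite e; ring.
Qed.

(** The spline with coefficients [z - c], where [z] samples [w], has the node residuals of
    [Q w - w], of size [O(A h^alpha)]. Stability bounds [z - c], and [spline_error] with this [B]
    yields both inputs of [holder_on_interpolate]. *)
Lemma collocation_error : exists kappa h0, 0 < kappa /\ 0 < h0 /\
  forall n rho c A w, (4 <= n)%nat -> 0 <= rho < mesh n -> mesh n < h0 ->
    0 <= A -> curve_integrable g w -> holder A alpha (fun x => w (g x)) ->
    (forall i, (1 <= i <= n)%nat ->
       id_minus g k lam (spline_sum g m n rho c) (g (node n rho i))
       = id_minus g k lam w (g (node n rho i))) ->
    curve_bounded g (kappa * A * Rpower (mesh n) alpha) (fun t => w t - spline_sum g m n rho c t)%C /\
    holder (kappa * A * Rpower (mesh n) (alpha - beta)) beta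
      (fun x => w (g x) - spline_sum g m n rho c (g x))%C.
Proof.
have [S [h0 [hS [hh0 Hstab]]]] := collocation_stability.
have [M [hM HM]] := id_minus_bound.
have [L [hL HL]] := low_order_lipschitz m hm.
have hSM : 0 < S * M by apply: Rmult_lt_0_compat.
(* Dominates both the sup constant [2 S M + 2] and the slope constant [10 L (2 S M + 3)]. *)
pose b := (1 + 10 * L) * (2 * (S * M) + 3).
have hb : 2 * (S * M) + 2 <= b /\ 10 * L * (2 * (S * M) + 3) <= b.
  have : 0 <= L * (2 * (S * M) + 3) by apply: Rmult_le_pos; lra.
  rewrite /b; lra.
(* [1 + 2 * b] comes from the interpolation between exponents, the outer 2 from
   [holder_periodic]. *)
exists (2 * (1 + 2 * b)), h0; split; first lra; split=> //.
move=> n rho c A w hn hrho hh hA wint hw Hcol.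
have ph := mesh_pos n hn; set h := mesh n in hh ph *.
pose W x := w (g x).
have Wper : periodic W by move=> x; rewrite /W (curve_periodic g hg).
have pr := Rpower_pos h alpha.
have rescale r : 1 <= r -> Rpower (r * h) alpha <= r * Rpower h alpha.
  move=> hr; rewrite -Rpower_mult_distr; try lra.
  apply: Rmult_le_compat_r; first lra.
  rewrite -{2}(Rpower_1 r); last lra.
  by apply: Rle_Rpower; lra.
pose z j := W (node n rho j).
have pAr : 0 <= A * Rpower h alpha by apply: Rmult_le_pos; lra.
have r2 : A * Rpower (2 * h) alpha <= 2 * (A * Rpower h alpha).
  by have := Rmult_le_compat_l _ _ _ hA (rescale 2 ltac:(lra)); lra.
have r3 : A * Rpower (3 * h) alpha <= 3 * (A * Rpower h alpha).
  by have := Rmult_le_compat_l _ _ _ hA (rescale 3 ltac:(lra)); lra.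
have [HV _] := spline_error g m n rho hn hrho hg hm L alpha A 0 z W hL HL ltac:(lra) hA ltac:(lra) Wper hw
  (fun j _ => ltac:(rewrite Cminus_diag Cmod_0; lra)).
have zint := spline_sum_integrable g m n rho hn hrho hg hm z.
have cint := spline_sum_integrable g m n rho hn hrho hg hm c.
have Hd j : (1 <= j <= n)%nat -> Cmod (z j - c j)%C <= S * (M * (2 * (A * Rpower h alpha))).
  move: j; apply: (Hstab n rho (fun j => z j - c j)%C) => // i hi.
  have ht := on_curve_param g (node n rho i).
  rewrite (id_minus_ext _ (fun t => spline_sum g m n rho z t - spline_sum g m n rho c t)%C) //; last first.
    move=> t _; rewrite /spline_sum -sum_C_minus; apply: sum_C_ext => l _; carrier_ring.
  rewrite id_minus_minus // Hcol // -id_minus_minus //.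
  apply: HM => //; [lra | exact: curve_integrable_minus |].
  move=> t' ht'; have [x [hx <-]] := on_curve_reduce g hg 0 t' ht'.
  have := HV x ltac:(lra); rewrite -/h /W; lra.
set B := S * (M * (2 * (A * Rpower h alpha))) in Hd.
have eB : B = 2 * (S * M) * (A * Rpower h alpha) by rewrite /B; ring.
have hB : 0 <= B by rewrite eB; apply: Rmult_le_pos; lra.
have [Hsup Hinc] := spline_error g m n rho hn hrho hg hm L alpha A B c W hL HL ltac:(lra) hA hB Wper hw
  (fun j hj => ltac:(rewrite Cmod_minus_sym; exact: Hd)).
have hb1 := Rmult_le_compat_r _ _ _ pAr (proj1 hb).
have hb2 := Rmult_le_compat_r _ _ _ pAr (proj2 hb).
have hsup x : 0 <= x <= 2 * PI -> Cmod (w (g x) - spline_sum g m n rho c (g x))%C <= b * A * Rpower h alpha.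
  move=> hx; have := Hsup x hx; rewrite -/h Cmod_minus_sym /W; lra.
split.
  move=> t ht; have [x [hx <-]] := on_curve_reduce g hg 0 t ht.
  apply: Rle_trans (hsup x ltac:(lra)) _.
  have : 0 <= b * (A * Rpower h alpha) by apply: Rmult_le_pos; lra.
  lra.
have -> : 2 * (1 + 2 * b) * A * Rpower h (alpha - beta)
  = 2 * ((A + 2 * (b * A)) * Rpower h (alpha - beta)) by ring.
have pbA : 0 <= b * A by apply: Rmult_le_pos; lra.
apply: (holder_periodic 0); [lra | | by move=> x; rewrite (curve_periodic g hg) |].
  by apply: Rmult_le_pos; [lra | exact/Rlt_le/Rpower_pos].
rewrite Rplus_0_l; apply: holder_on_interpolate => //; first lra.
move=> x y hx hxy hy hd.
have -> : (w (g y) - spline_sum g m n rho c (g y) - (w (g x) - spline_sum g m n rho c (g x))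
   = (w (g y) - w (g x)) - (spline_sum g m n rho c (g y) - spline_sum g m n rho c (g x)))%C by ring.
apply: Rle_trans (Cmod_minus_le _ _) _.
have pq : 0 <= (y - x) / h by apply: Rdiv_le_0_compat; lra.
have h1 := hw x y hxy; have h2 := Hinc x y hx hxy hy hd.
rewrite -/h in h2.
suff : 10 * L * (B + A * Rpower (3 * h) alpha) * ((y - x) / h) <= b * A * Rpower h alpha * ((y - x) / h).
  by lra.
apply: Rmult_le_compat_r => //.
have h3 : 10 * L * (B + A * Rpower (3 * h) alpha) <= 10 * L * ((2 * (S * M) + 3) * (A * Rpower h alpha)).
  by apply: Rmult_le_compat_l; [lra | rewrite eB; lra].
lra.
Qed.

End Collocation.

Theorem theorem8p3
  (g : R -> C) (hg : contour g)
  (nd : nat) (thd : nat -> R) (hthd : jump_parameters nd thd)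
  (alpha beta mu : R)
  (hbeta : 0 < beta) (hba : beta < alpha) (ham : alpha < mu) (hmu : mu <= 1)
  (k : C -> C -> C) (hk : kernel_regular g mu k)
  (lam : C)
  (hker : forall v : C -> C, PH g nd thd beta v ->
     (forall t, on_curve g t -> id_minus g k lam v t = RtoC 0) ->
     forall t, on_curve g t -> v t = RtoC 0)
  (m : nat) (hm : m = 2%nat \/ m = 3%nat \/ m = 4%nat)
  (eta : R) (heta0 : 0 < eta) (heta1 : eta < 1 / (2 * INR nd))
  (rho : nat -> R)
  (hrho : forall n, (4 <= n)%nat -> admissible_phase nd thd eta n (rho n)) :
  exists Clam h0 : R, 0 < h0 /\
    forall n : nat, (4 <= n)%nat -> mesh n < h0 ->
    forall f phi : C -> C,
      PH g nd thd alpha f ->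
      PH g nd thd beta phi ->
      (forall t, on_curve g t -> id_minus g k lam phi t = f t) ->
      exists u : C -> C,
        collocation_solution g nd thd k lam m n (rho n) f u /\
        (forall u' : C -> C,
           collocation_solution g nd thd k lam m n (rho n) f u' ->
           forall t, on_curve g t -> u' t = u t) /\
        let phih := fun t => Cplus (u t) (jump_part g nd thd f t) in
        let err := fun t => Cminus (phi t) (phih t) in
        PH g nd thd beta err /\
        PH_norm g nd thd beta err
          <= Clam * Rpower (mesh n) (alpha - beta) * PH_norm g nd thd alpha f.
Proof.
have [h1 [ph1 Hex]] := collocation_unisolvent g nd thd alpha beta mu k lam m hg hthd hbeta hba ham hk hker hm.
have [kappa [h2 [pk [ph2 Herr]]]] := collocation_error g nd thd alpha beta mu k lam m hg hthd hbeta hba ham hmu hk hker hm.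
have [cW [pcW HW]] := solution_holder g nd thd alpha beta mu k lam hg hthd hbeta hba ham hmu hk hker.
have [cP [pcP HP]] := PH_of_holder g nd thd hg hthd beta hbeta.
(* [cP] weighs the Hoelder part of the error. The sup part is of order [h^alpha], and
   [h^beta <= h2^beta] brings it to the order [h^(alpha - beta)]. *)
exists ((Rpower h2 beta + cP) * (kappa * cW)), (Rmin h1 h2); split; first exact: Rmin_glb_lt.
move=> n hn hh f phi hf hphi Heq.
have hh1 : mesh n < h1 by apply: Rlt_le_trans hh (Rmin_l _ _).
have hh2 : mesh n < h2 by apply: Rlt_le_trans hh (Rmin_r _ _).
have [hr _] := hrho n hn.
pose F t := (cont_part g nd thd f t + lam * int_op g k (jump_part g nd thd f) t)%C.
have [c [Hc Huniq]] := Hex n (rho n) (fun i => F (g (node n (rho n) i))) hn hr hh1.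
pose Nf := PH_norm g nd thd alpha f.
have hN : 0 <= Nf := PH_norm_ge0 g nd thd hthd alpha f hf.
have jint := jump_part_integrable g nd thd hg hthd f.
have pint := PH_integrable g nd thd hg hthd beta phi ltac:(lra) hphi.
exists (spline_sum g m n (rho n) c); split; [|split].
- by split; [exists c | move=> i hi; exact: Hc].
(* [u'] agrees with a spline sum on the curve only, which is all that [id_minus] sees. *)
- move=> u' [[c' hc'] hu'] t ht; rewrite hc' //.
  apply: sum_C_ext => j hj; rewrite (Huniq c') // => i hi.
  rewrite -[RHS](hu' i hi); apply: id_minus_ext; first exact: on_curve_param.
  by move=> s hs; rewrite hc'.
move=> phih err.
pose w t := (phi t - jump_part g nd thd f t)%C.
have pA : 0 <= cW * Nf by apply: Rmult_le_pos; lra.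
have [] := Herr n (rho n) c (cW * Nf) w hn hr hh2 pA.
- exact: curve_integrable_minus.
- exact: HW.
(* Both sides equal [f_C + lam K J_f] at the node, by linearity of [I - lam K] and the equation for
   [phi]. *)
- move=> i hi; rewrite Hc // (id_minus_minus g mu) //; last exact: on_curve_param.
  rewrite Heq /F /id_minus /cont_part; [ring | exact: on_curve_param].
move=> Esup Ehol.
have pr := Rpower_pos (mesh n) (alpha - beta).
have pkA : 0 <= kappa * (cW * Nf) by apply: Rmult_le_pos; lra.
have ph := mesh_pos n hn.
have pC : 0 <= kappa * (cW * Nf) * Rpower (mesh n) (alpha - beta) by apply: Rmult_le_pos; lra.
have e t : err t = (w t - spline_sum g m n (rho n) c t)%C by rewrite /err /phih /w; ring.
have [||h3 h4] := HP _ (kappa * (cW * Nf) * Rpower (mesh n) alpha) err pC.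
- by move=> x y hxy; rewrite !e; exact: Ehol.
- by move=> t ht; rewrite e; exact: Esup.
split=> //; apply: Rle_trans h4 _; rewrite -/Nf.
have : Rpower (mesh n) alpha <= Rpower h2 beta * Rpower (mesh n) (alpha - beta).
  rewrite (Rpower_split (mesh n) alpha beta); apply: Rmult_le_compat_r; first lra.
  by apply: Rpower_le_l; lra.
move=> /(Rmult_le_compat_l _ _ _ pkA); lra.
Qed.
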